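(* Let $W\subseteq\mathrm{GL}(\mathfrak{h})$ be an irreducible complex reflection group. For all $g\in G_W$ and $c\in\mathcal{C}$ we have, inside the algebra $D(\mathfrak{h}^\circ)\rtimes W$, $$eH_ce=eH_{g(c)}e\quad\text{and}\quad f(y_c)e=f(y_{g(c)})e\quad\text{for all } f\in\mathbf{C}[\mathfrak{h}^*]^W.$$
   Context: $\mathcal{A}$ is the set of reflecting hyperplanes of $W$; for $H\in\mathcal{A}$, $W_H$ is the pointwise stabilizer of $H$ (cyclic), $n_H=|W_H|$, $\alpha_H\in\mathfrak{h}^*$ has zero set $H$, and $e_{H,j}=\frac1{n_H}\sum_{w\in W_H}\det^{-j}(w)\,w$, where $\det$ is the determinant character of $W\subseteq\mathrm{GL}(\mathfrak{h})$. $\mathfrak{h}^\circ$ is the complement of the reflecting hyperplanes in $\mathfrak{h}$, $D(\mathfrak{h}^\circ)$ is its algebra of algebraic differential operators, and $D(\mathfrak{h}^\circ)\rtimes W$ is the algebra of operators generated by it and $W$. $\mathcal{C}$ is the space of tuples $c=(c_{H,j})_{H\in\mathcal{A},0\le j\le n_H-1}$ of complex numbers with $c_{w(H),j}=c_{H,j}$ for all $w\in W$. $G_W$ is the group of tuples $s=(s_H)_{H\in\mathcal{A}}$ with $s_H$ a permutation of $\{0,\dots,n_H-1\}$ and $s_{w(H)}=s_H$ for all $w\in W$. With $\rho_{H,j}=j/n_H$ and $(sc)_{H,j}=c_{H,s_H^{-1}(j)}$ for the permutation action, $G_W$ acts on $\mathcal{C}$ by the dot action; $g(c)$ denotes the dot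 action $g\cdot c$, where $s\cdot c=s(c+\rho)-\rho$. For $c\in\mathcal{C}$ and $y\in\mathfrak{h}$ the Dunkl operator is $y_c=\partial_y-\sum_{H\in\mathcal{A}}\frac{\alpha_H(y)}{\alpha_H}\sum_{j=0}^{n_H-1}n_Hc_{H,j}e_{H,j}\in D(\mathfrak{h}^\circ)\rtimes W$; the Dunkl operators for fixed $c$ commute with one another. For $f\in\mathbf{C}[\mathfrak{h}^*]$ (a polynomial in elements $y\in\mathfrak{h}$), $f(y_c)$ denotes the operator obtained by replacing each $y$ by $y_c$. The rational Cherednik algebra $H_c$ is the subalgebra of $D(\mathfrak{h}^\circ)\rtimes W$ generated by $\mathbf{C}[\mathfrak{h}]$, $W$, and all $y_c$ for $y\in\mathfrak{h}$. $e=\frac1{|W|}\sum_{w\in W}w$ is the symmetrizing idempotent. *)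

(* Defs.v *)
From HB Require Import structures.
From mathcomp Require Import all_boot all_order all_fingroup all_algebra.
From mathcomp Require Import all_field all_character.
From mathcomp Require Import boolp classical_sets functions reals complex.
From mathcomp Require Import mpoly ring.

Set Implicit Arguments.
Unset Strict Implicit.
Unset Printing Implicit Defensive.

Import GRing.Theory.
Local Open Scope classical_set_scope.
Local Open Scope ring_scope.

(* Operators on an F-module A are functions A -> A, added and scaled
   pointwise and multiplied by composition. *)
Section Operators.
Variables (F : fieldType) (A : lmodType F).
Implicit Types (S G : set (A -> A)) (P Q : A -> A).

Definition operator_algebra S : Prop :=
  [/\ S idfun,
      forall (a : F) P Q, S P -> S Q -> S (a *: P + Q)
    & forall P Q, S P -> S Q -> S (P \o Q)].

Definition generated_algebra G : set (A -> A) := smallest operator_algebra G.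

Lemma generated_algebra_sub G : G `<=` generated_algebra G.
Proof. exact: sub_smallest. Qed.

Lemma generated_algebraP G : operator_algebra (generated_algebra G).
Proof.
split=> [S [[S1 _ _] _] //|a P Q GP GQ S SG|P Q GP GQ S SG].
- by case: (SG) => -[_ SL _] _; apply: SL; [exact: GP|exact: GQ].
- by case: (SG) => -[_ _ SM] _; apply: SM; [exact: GP|exact: GQ].
Qed.

Lemma generated_algebra_min G S :
  operator_algebra S -> G `<=` S -> generated_algebra G `<=` S.
Proof. by move=> SA GS; exact: smallest_sub. Qed.

Lemma operator_algebraZ S a P : operator_algebra S -> S P -> S (a *: P).
Proof.
case=> S1 SL _ SP; have S0 : S 0.
  by have := SL (-1) _ _ S1 S1; rewrite scaleN1r addNr.
by have := SL a _ _ SP S0; rewrite addr0.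
Qed.

Lemma operator_algebra_sum S I (r : seq I) (p : pred I) (P : I -> A -> A) :
  operator_algebra S -> (forall i, p i -> S (P i)) ->
  S (\sum_(i <- r | p i) P i).
Proof.
case=> S1 SL _ SP; elim/big_rec: _ => [|i Q pi SQ].
  by have := SL (-1) _ _ S1 S1; rewrite scaleN1r addNr.
by have := SL 1 _ _ (SP _ pi) SQ; rewrite scale1r.
Qed.

End Operators.

(* Grothendieck's algebra D(A) of differential operators on a commutative
   algebra A. *)
Section DifferentialOperators.
Variables (F : fieldType) (A : comAlgType F).

Definition ad_mul (a : A) (P : A -> A) : A -> A :=
  fun f => P (a * f) - a * P f.

Fixpoint diffop_of_order (k : nat) (P : A -> A) : Prop :=
  linear P /\ forall a : A,
    if k is k'.+1 then diffop_of_order k' (ad_mul a P) else ad_mul a P = 0.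

Definition diffops : set (A -> A) := [set P | exists k, diffop_of_order k P].

End DifferentialOperators.

Section RationalFunctions.
Variables (F : fieldType) (n : nat).
Implicit Types (y v : 'cV[F]_n) (p q : {mpoly F[n]}).

Definition ratfun := {fraction {mpoly F[n]}}.

Definition polyfrac p : ratfun := FracField.tofrac p.

Definition num (f : ratfun) : {mpoly F[n]} := (frac (generic_quotient.repr f)).1.
Definition den (f : ratfun) : {mpoly F[n]} := (frac (generic_quotient.repr f)).2.

Definition peval p v : F := p.@[fun i => v i 0].

Definition pderive y p : {mpoly F[n]} := \sum_(i < n) y i 0 *: p^`M(i).

(* p |-> p o g *)
Definition psubst (g : 'M[F]_n) p : {mpoly F[n]} :=
  p \mPo [tuple \sum_(k < n) g i k *: 'X_k | i < n].

(* linear form xi on F^n as an element of F[X_1, .., X_n] *)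
Definition linear_form (xi : 'rV[F]_n) : {mpoly F[n]} :=
  \sum_(i < n) xi 0 i *: 'X_i.

Definition ratderive y (f : ratfun) : ratfun :=
  polyfrac (pderive y (num f) * den f - num f * pderive y (den f))
    / polyfrac (den f * den f).

Definition ratsubst (g : 'M[F]_n) (f : ratfun) : ratfun :=
  polyfrac (psubst g (num f)) / polyfrac (psubst g (den f)).

Lemma den_neq0 f : den f != 0.
Proof. exact: denom_ratioP. Qed.

Lemma polyfrac_eq0 p : (polyfrac p == 0) = (p == 0).
Proof. exact: tofrac_eq0. Qed.

Lemma polyfracM p q : polyfrac (p * q) = polyfrac p * polyfrac q.
Proof. exact: rmorphM. Qed.

Lemma polyfracD p q : polyfrac (p + q) = polyfrac p + polyfrac q.
Proof. exact: rmorphD. Qed.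

Lemma num_den f : f = polyfrac (num f) / polyfrac (den f).
Proof.
have d0 : polyfrac (den f) != 0 by rewrite polyfrac_eq0 den_neq0.
apply: (mulIf d0); rewrite divfK // /polyfrac /num /den.
rewrite -{1}[f]generic_quotient.reprK; set x := generic_quotient.repr f.
rewrite !generic_quotient.piE /=.
apply/generic_quotient.eqmodP; rewrite /= FracField.equivfE /FracField.mulf.
have x0 : (frac x).2 != 0 by exact: denom_ratioP.
by rewrite !numden_Ratio ?mulr1 ?oner_eq0 // mulrC.
Qed.

Lemma polyfrac_eq p q r s : q != 0 -> s != 0 ->
  (polyfrac p / polyfrac q == polyfrac r / polyfrac s) = (p * s == r * q).
Proof.
move=> q0 s0; rewrite eqr_div ?polyfrac_eq0 // -!polyfracM.
exact: tofrac_eq.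
Qed.

Lemma pderive_is_linear y : linear (pderive y).
Proof.
move=> a p q; rewrite /pderive scaler_sumr -big_split /=.
apply: eq_bigr => i _; rewrite linearP /= scalerDr !scalerA.
by rewrite mulrC.
Qed.

HB.instance Definition _ y := GRing.isLinear.Build F {mpoly F[n]} {mpoly F[n]}
  _ (pderive y) (pderive_is_linear y).

Lemma pderiveM y p q : pderive y (p * q) = pderive y p * q + p * pderive y q.
Proof.
rewrite /pderive mulr_suml mulr_sumr -big_split /=.
by apply: eq_bigr => i _; rewrite mderivM scalerDr scalerAl scalerAr.
Qed.

Lemma ratderive_frac y p q : q != 0 ->
  ratderive y (polyfrac p / polyfrac q) =
  polyfrac (pderive y p * q - p * pderive y q) / polyfrac (q * q).
Proof.
move=> q0; set f := _ / _.
have d0 := den_neq0 f; apply/eqP; rewrite polyfrac_eq ?mulf_neq0 //.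
have /eqP : f = polyfrac (num f) / polyfrac (den f) by exact: num_den.
rewrite {1}/f polyfrac_eq // => /eqP E.
have := congr1 (pderive y) E; rewrite !pderiveM.
set N := num f in E *; set d := den f in d0 E *.
set N' := pderive y N; set d' := pderive y d.
set p' := pderive y p; set q' := pderive y q => E'.
apply/eqP; transitivity (d * q * (N' * q + N * q') - (d * q' + q * d') * (N * q)).
  by ring.
by rewrite -E -E'; ring.
Qed.

Lemma peval_subst g p v : peval (psubst g p) v = peval p (g *m v).
Proof.
rewrite /peval /psubst comp_mpoly_meval; apply: meval_eq => i.
rewrite tnth_mktuple mxE raddf_sum /=; apply: eq_bigr => k _.
by rewrite mevalZ mevalXU.
Qed.

Lemma psubst_comp g h p : psubst g (psubst h p) = psubst (h *m g) p.
Proof.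
rewrite /psubst !(comp_mpolyEX p) linear_sum /=.
apply: eq_bigr => m _; rewrite !comp_mpolyZ; congr (_ *: _).
rewrite !comp_mpolyX rmorph_prod /=; apply: eq_bigr => i _.
rewrite rmorphXn /= !tnth_mktuple; congr (_ ^+ _).
rewrite raddf_sum /=; under eq_bigr => k _ do
  rewrite comp_mpolyZ comp_mpolyXU -tnth_nth tnth_mktuple scaler_sumr.
rewrite exchange_big /=; apply: eq_bigr => j _.
by rewrite mxE scaler_suml; apply: eq_bigr => k _; rewrite scalerA.
Qed.

Lemma psubst1 p : psubst 1%:M p = p.
Proof.
rewrite /psubst -[RHS]comp_mpoly_id; congr comp_mpoly; apply: eq_mktuple => i.
rewrite (bigD1 i) //= mxE eqxx scale1r big1 ?addr0 // => k ki.
by rewrite mxE eq_sym (negPf ki) scale0r.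
Qed.

Lemma psubst_eq0 g p : g \in unitmx -> (psubst g p == 0) = (p == 0).
Proof.
move=> gu; apply/eqP/eqP => [E|->]; last by rewrite /psubst comp_mpoly0.
by rewrite -[p]psubst1 -(mulmxV gu) -psubst_comp E /psubst comp_mpoly0.
Qed.

Lemma ratsubst_frac g p q : g \in unitmx -> q != 0 ->
  ratsubst g (polyfrac p / polyfrac q) =
  polyfrac (psubst g p) / polyfrac (psubst g q).
Proof.
move=> gu q0; set f := _ / _; have d0 := den_neq0 f.
apply/eqP; rewrite polyfrac_eq ?psubst_eq0 //.
have /eqP : f = polyfrac (num f) / polyfrac (den f) by exact: num_den.
rewrite {1}/f polyfrac_eq // => /eqP E.
by rewrite -!rmorphM /= E.
Qed.

End RationalFunctions.

Section ReflectionRepresentation.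
Variables (F : fieldType) (n : nat) (W : finGroupType).
Variable rho : mx_representation F [set: W]%G n.
Local Notation h := 'cV[F]_n.
Implicit Types (w : W) (H : {vspace h}) (v y : h).

Definition wlin w : 'End(h) := linfun (mulmx (rho w)).

Definition irreducible_rep : Prop :=
  (0 < n)%N /\ forall U : {vspace h},
    (forall w, wlin w @: U <= U)%VS -> U = 0%VS \/ U = fullv.

Definition is_reflection w : bool := (\dim (fixedSpace (wlin w))).+1 == n.

Definition reflection_rep : Prop :=
  << [set w | is_reflection w]%SET >>%g = [set: W]%SET.

Definition arrangement : seq {vspace h} :=
  undup [seq fixedSpace (wlin w) | w <- enum W & is_reflection w].

Definition pstab H : {set W} := [set w | (H <= fixedSpace (wlin w))%VS]%SET.

Definition nstab H : nat := #|pstab H|.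

Definition regular_point v : bool := all (fun H => v \notin H) arrangement.

(* The regular functions on h° are the fractions whose denominator does not
   vanish at any point of h°. *)
Definition regular_on_complement : {pred ratfun F n} := fun f =>
  `[< exists p q : {mpoly F[n]}, [/\ q != 0,
        (forall v, regular_point v -> peval q v != 0)
      & f = polyfrac p / polyfrac q] >].

Lemma regular_subring_closed : subring_closed regular_on_complement.
Proof.
split.
- apply/asboolP; exists 1, 1; split; rewrite ?oner_eq0 //.
    by move=> v _; rewrite /peval meval1 oner_eq0.
  by rewrite divff // polyfrac_eq0 oner_eq0.
- move=> _ _ /asboolP[p [q [q0 qr ->]]] /asboolP[p' [q' [q'0 q'r ->]]].
  apply/asboolP; exists (p * q' - p' * q), (q * q'); split.
  + by rewrite mulf_neq0.
  + by move=> v vr; rewrite /peval mevalM mulf_neq0 ?qr ?q'r.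
  + rewrite -mulNr addf_div ?polyfrac_eq0 // polyfracM; congr (_ / _).
    by rewrite /polyfrac !(rmorphB, rmorphM) /= mulNr.
- move=> _ _ /asboolP[p [q [q0 qr ->]]] /asboolP[p' [q' [q'0 q'r ->]]].
  apply/asboolP; exists (p * p'), (q * q'); split.
  + by rewrite mulf_neq0.
  + by move=> v vr; rewrite /peval mevalM mulf_neq0 ?qr ?q'r.
  + by rewrite mulf_div !polyfracM.
Qed.

HB.instance Definition _ := GRing.isSubringClosed.Build (ratfun F n)
  regular_on_complement regular_subring_closed.

Definition coordring := {f : ratfun F n | regular_on_complement f}.

HB.instance Definition _ := SubChoice.on coordring.
HB.instance Definition _ := [SubChoice_isSubComNzRing of coordring by <:].

Definition polyreg_subproof (p : {mpoly F[n]}) :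
  regular_on_complement (polyfrac p).
Proof.
apply/asboolP; exists p, 1; split; first exact: oner_neq0.
- by move=> v _; rewrite /peval meval1 oner_eq0.
- by rewrite /polyfrac rmorph1 divr1.
Qed.

Definition polyreg (p : {mpoly F[n]}) : coordring :=
  exist _ (polyfrac p) (polyreg_subproof p).

Lemma polyreg_is_zmod_morphism : zmod_morphism polyreg.
Proof. by move=> p q; apply: val_inj; exact: rmorphB. Qed.

Lemma polyreg_is_monoid_morphism : monoid_morphism polyreg.
Proof.
split=> [|p q]; apply: val_inj => /=; first exact: rmorph1.
exact: rmorphM.
Qed.

HB.instance Definition _ := GRing.isZmodMorphism.Build {mpoly F[n]} coordring
  polyreg polyreg_is_zmod_morphism.
HB.instance Definition _ := GRing.isMonoidMorphism.Build {mpoly F[n]} coordring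
  polyreg polyreg_is_monoid_morphism.

Definition coordring_scale (a : F) (f : coordring) : coordring :=
  polyreg a%:MP * f.

Lemma coordring_scaleA a b f :
  coordring_scale a (coordring_scale b f) = coordring_scale (a * b) f.
Proof. by rewrite /coordring_scale mulrA -rmorphM -mpolyCM. Qed.

Lemma coordring_scale1 : left_id 1 coordring_scale.
Proof. by move=> f; rewrite /coordring_scale mpolyC1 rmorph1 mul1r. Qed.

Lemma coordring_scaleDr : right_distributive coordring_scale +%R.
Proof. by move=> a f g; rewrite /coordring_scale mulrDr. Qed.

Lemma coordring_scaleDl f : {morph coordring_scale^~ f : a b / a + b}.
Proof. by move=> a b; rewrite /coordring_scale mpolyCD rmorphD mulrDl. Qed.

HB.instance Definition _ := GRing.Zmodule_isLmodule.Build F coordring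
  coordring_scaleA coordring_scale1 coordring_scaleDr coordring_scaleDl.

Lemma coordring_scaleAl (a : F) (f g : coordring) : a *: (f * g) = a *: f * g.
Proof. exact: mulrA. Qed.

HB.instance Definition _ :=
  GRing.Lmodule_isLalgebra.Build F coordring coordring_scaleAl.
HB.instance Definition _ := GRing.Lalgebra_isComAlgebra.Build F coordring.

Lemma val_coordringZ (a : F) (f : coordring) :
  val (a *: f) = polyfrac a%:MP * val f.
Proof. exact: rmorphM. Qed.

Lemma val_coordringD (f g : coordring) : val (f + g) = val f + val g.
Proof. by []. Qed.

Lemma val_coordringM (f g : coordring) : val (f * g) = val f * val g.
Proof. by []. Qed.

Lemma ratderive_subproof y (f : coordring) :
  regular_on_complement (ratderive y (val f)).
Proof.
case: f => _ /= /asboolP[p [q [q0 qr ->]]]; apply/asboolP.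
rewrite ratderive_frac //; do 2 eexists; split; last reflexivity.
- by rewrite mulf_neq0.
- by move=> v vr; rewrite /peval mevalM mulf_neq0 ?qr.
Qed.

Definition derive_op y (f : coordring) : coordring :=
  exist _ (ratderive y (val f)) (ratderive_subproof y f).

Lemma val_derive_op y f : val (derive_op y f) = ratderive y (val f).
Proof. by []. Qed.

Lemma rhoM w w' : rho (w * w')%g = rho w *m rho w'.
Proof. by rewrite repr_mxM ?finset.in_setT. Qed.

Lemma rho_unit w : rho w \in unitmx.
Proof. by apply: (repr_mx_unit rho); rewrite finset.in_setT. Qed.

Lemma rhoV w : rho w^-1%g *m rho w = 1%:M.
Proof. by rewrite -rhoM mulVg repr_mx1. Qed.

Lemma mem_fix w v : (v \in fixedSpace (wlin w)) = (rho w *m v == v).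
Proof. by apply/fixedSpaceP/eqP; rewrite /wlin lfunE. Qed.

Lemma wlin_ker w : lker (wlin w) = 0%VS.
Proof.
apply/eqP; rewrite -subv0; apply/subvP => v.
rewrite memv_ker /wlin lfunE /= => /eqP E; rewrite memv0.
by rewrite -[v]mul1mx -(rhoV w) -mulmxA E mulmx0.
Qed.

Lemma fix_conj w w' :
  (wlin w @: fixedSpace (wlin w') = fixedSpace (wlin (w * w' * w^-1)%g))%VS.
Proof.
apply/vspaceP => v; apply/memv_imgP/idP => [[u]|].
  rewrite !mem_fix => /eqP E ->; rewrite /wlin lfunE /= !rhoM.
  by rewrite -!mulmxA (mulmxA _ _ u) rhoV mul1mx E.
rewrite mem_fix => /eqP E; exists (rho w^-1%g *m v).
  rewrite mem_fix mulmxA -rhoM -{2}E mulmxA -rhoM.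
  by rewrite !mulgA mulVg mul1g.
by rewrite /wlin lfunE /= mulmxA -rhoM mulgV repr_mx1 mul1mx.
Qed.

Lemma arrangementP H : reflect
  (exists2 w, is_reflection w & H = fixedSpace (wlin w)) (H \in arrangement).
Proof.
rewrite mem_undup; apply: (iffP mapP) => [[w]|[w rw ->]].
  by rewrite mem_filter => /andP[rw _] ->; exists w.
by exists w => //; rewrite mem_filter rw mem_enum.
Qed.

Lemma arrangement_stable w H :
  H \in arrangement -> (wlin w @: H)%VS \in arrangement.
Proof.
case/arrangementP => w' rw' ->; apply/arrangementP.
exists (w * w' * w^-1)%g; last exact: fix_conj.
by rewrite /is_reflection -fix_conj limg_dim_eq // wlin_ker capv0.
Qed.

Lemma regular_point_stable w v : regular_point v -> regular_point (rho w *m v).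
Proof.
move/allP => vr; apply/allP => H HA.
apply: contra (vr _ (arrangement_stable w^-1 HA)) => vH.
apply/memv_imgP; exists (rho w *m v) => //.
by rewrite /wlin lfunE /= mulmxA rhoV mul1mx.
Qed.

Lemma ratsubst_subproof w (f : coordring) :
  regular_on_complement (ratsubst (rho w^-1%g) (val f)).
Proof.
case: f => _ /= /asboolP[p [q [q0 qr ->]]]; apply/asboolP.
rewrite ratsubst_frac ?rho_unit //; do 2 eexists; split; last reflexivity.
- by rewrite psubst_eq0 ?rho_unit.
- by move=> v vr; rewrite peval_subst qr // regular_point_stable.
Qed.

(* (w f)(v) = f (w^-1 v) *)
Definition act_op w (f : coordring) : coordring :=
  exist _ (ratsubst (rho w^-1%g) (val f)) (ratsubst_subproof w f).

Definition mul_op (g : coordring) : coordring -> coordring := fun f => g * f.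

(* D(h°) x| W, realized faithfully by operators on F[h°] *)
Definition diffops_crossed_group : set (coordring -> coordring) :=
  generated_algebra (@diffops F coordring `|` range act_op).

Definition idem_op H (j : nat) : coordring -> coordring :=
  (nstab H)%:R^-1 *: \sum_(w in pstab H) (\det (rho w) ^- j) *: act_op w.

Definition sym_op : coordring -> coordring :=
  #|W|%:R^-1 *: \sum_(w : W) act_op w.

Definition defining_forms (alpha : {vspace h} -> 'rV[F]_n) : Prop :=
  forall H, H \in arrangement -> forall v, (alpha H *m v == 0) = (v \in H).

(* 1/xi if it is regular on the complement, and 0 otherwise *)
Definition inv_form (xi : 'rV[F]_n) : coordring :=
  insubd (0 : coordring) (polyfrac (linear_form xi))^-1.

Lemma peval_linear_form xi v : peval (linear_form xi) v = (xi *m v) 0 0.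
Proof.
rewrite /peval /linear_form raddf_sum mxE /=; apply: eq_bigr => i _.
by rewrite mevalZ mevalXU.
Qed.

Lemma inv_formE alpha H : defining_forms alpha -> H \in arrangement ->
  val (inv_form (alpha H)) = (polyfrac (linear_form (alpha H)))^-1.
Proof.
move=> alphaP HA; apply: insubdK; apply/asboolP.
exists 1, (linear_form (alpha H)); split.
- apply/eqP => E.
  have: forall v, v \in H.
    move=> v; rewrite -(alphaP _ HA); apply/eqP/matrixP => i j.
    rewrite !ord1 -peval_linear_form E /peval meval0 mxE //.
  case/arrangementP: HA => w; rewrite /is_reflection => /eqP dw -> hv.
  have : fixedSpace (wlin w) = fullv.
    by apply/vspaceP => v; rewrite memvf; exact: hv.
  move=> E'; move: dw; rewrite E' dimvf /dim /= muln1 => /eqP.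
  by rewrite eqn_leq ltnn.
- move=> v /allP /(_ _ HA); rewrite -(alphaP _ HA) peval_linear_form.
  apply: contra => /eqP E; apply/eqP/matrixP => i j.
  by rewrite !ord1 E mxE.
- by rewrite /polyfrac rmorph1 mul1r.
Qed.

(* Only the components at H in the arrangement are used. *)
Definition param := forall H, 'I_(nstab H) -> F.
Definition permparam := forall H, {perm 'I_(nstab H)}.

Lemma nstab_stable w H : nstab (wlin w @: H)%VS = nstab H.
Proof.
rewrite /nstab -(cardJg (pstab H) w^-1); apply: eq_card => w'.
rewrite mem_conjg invgK !inE; set x := (w' ^ w)%g.
have -> : (w' = w * x * w^-1)%g by rewrite /x /conjg !mulgA mulgV mul1g mulgK.
rewrite -fix_conj.
apply/idP/idP => [/subvP sub|]; last exact: limgS.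
apply/subvP => v vH; have /memv_imgP[u uf] := sub _ (memv_img (wlin w) vH).
rewrite /wlin !lfunE /= => /(congr1 (mulmx (rho w^-1%g))).
by rewrite !mulmxA rhoV !mul1mx => ->.
Qed.

(* nstab (w H) and nstab H are equal but not convertible, so components at H
   and w(H) are compared at indices with equal values. *)
Definition param_space (c : param) : Prop :=
  forall w H (j : 'I_(nstab H)) (j' : 'I_(nstab (wlin w @: H)%VS)),
    H \in arrangement -> j' = j :> nat -> c _ j' = c H j.

Definition perm_group (s : permparam) : Prop :=
  forall w H (j : 'I_(nstab H)) (j' : 'I_(nstab (wlin w @: H)%VS)),
    H \in arrangement -> j' = j :> nat -> s _ j' = s H j :> nat.

Definition rho_param : param := fun H j => j%:R / (nstab H)%:R.

Definition perm_param (s : permparam) (c : param) : param :=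
  fun H j => c H ((((s H)^-1)%g : {perm 'I_(nstab H)}) j).

Definition dot_action (s : permparam) (c : param) : param := fun H j =>
  perm_param s (fun H' j' => c H' j' + rho_param j') j - rho_param j.

Section Cherednik.
Variable alpha : {vspace h} -> 'rV[F]_n.

Definition dunkl (c : param) y : coordring -> coordring :=
  derive_op y - \sum_(H <- arrangement) (alpha H *m y) 0 0 *:
    (mul_op (inv_form (alpha H)) \o
      \sum_(j < nstab H) ((nstab H)%:R * c H j) *: idem_op H j).

Definition cherednik (c : param) : set (coordring -> coordring) :=
  generated_algebra
    (range (mul_op \o polyreg) `|` range act_op `|` range (dunkl c)).

Lemma derive_op_is_linear y : linear (derive_op y).
Proof.
move=> a f g; apply: val_inj.
rewrite val_coordringD val_coordringZ.
rewrite !val_derive_op val_coordringD val_coordringZ.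
have /asboolP[p [q [q0 _ fE]]] := valP f.
have /asboolP[p' [q' [q'0 _ gE]]] := valP g.
rewrite fE gE mulrA -polyfracM mul_mpolyC.
rewrite addf_div ?polyfrac_eq0 // -!polyfracM -polyfracD.
rewrite !ratderive_frac ?mulf_neq0 //.
rewrite (mulrA (polyfrac _)) addf_div ?polyfrac_eq0 ?mulf_neq0 //.
rewrite -!polyfracM -polyfracD; apply/eqP.
rewrite polyfrac_eq ?mulf_neq0 // linearD /= !pderiveM linearZ /=.
by rewrite -!mul_mpolyC; apply/eqP; ring.
Qed.

Lemma derive_opM y (f g : coordring) :
  derive_op y (f * g) = derive_op y f * g + f * derive_op y g.
Proof.
apply: val_inj; rewrite val_coordringD !val_coordringM.
rewrite !val_derive_op val_coordringM.
have /asboolP[p [q [q0 _ fE]]] := valP f.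
have /asboolP[p' [q' [q'0 _ gE]]] := valP g.
rewrite fE gE mulf_div -!polyfracM !ratderive_frac ?mulf_neq0 //.
rewrite !mulf_div -!polyfracM addf_div ?polyfrac_eq0 ?mulf_neq0 //.
rewrite -!polyfracM -polyfracD; apply/eqP.
rewrite polyfrac_eq ?mulf_neq0 // !pderiveM.
by apply/eqP; ring.
Qed.

Lemma mul_op_diffop g : diffop_of_order 0 (mul_op g).
Proof.
split=> [a f f'|a]; first by rewrite /mul_op mulrDr scalerAr.
by apply/funext => f; rewrite /ad_mul /mul_op mulrCA subrr.
Qed.

Lemma derive_op_diffop y : diffop_of_order 1 (derive_op y).
Proof.
split=> [|a]; first exact: derive_op_is_linear.
suff -> : ad_mul a (derive_op y) = mul_op (derive_op y a) by exact: mul_op_diffop.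
by apply/funext => f; rewrite /ad_mul derive_opM addrK.
Qed.

Lemma cherednik_sub c : cherednik c `<=` diffops_crossed_group.
Proof.
have DA : operator_algebra diffops_crossed_group by exact: generated_algebraP.
have mulD g : diffops_crossed_group (mul_op g).
  by apply: generated_algebra_sub; left; exists 0%N; exact: mul_op_diffop.
have actD w : diffops_crossed_group (act_op w).
  by apply: generated_algebra_sub; right; exists w.
apply: generated_algebra_min => // _ [[[p _ <-]|[w _ <-]]|[y _ <-]] //.
  exact: mulD.
have scaleD a P : diffops_crossed_group P -> diffops_crossed_group (a *: P).
  exact: operator_algebraZ.
have sumD I (r : seq I) (p : pred I) (P : I -> coordring -> coordring) :
    (forall i, p i -> diffops_crossed_group (P i)) ->
    diffops_crossed_group (\sum_(i <- r | p i) P i).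
  exact: operator_algebra_sum.
rewrite /dunkl addrC -scaleN1r; case: (DA) => _ DL DM; apply: DL.
  apply: (sumD) => H _; apply: (scaleD); apply: DM => //.
  apply: (sumD) => j _; apply: (scaleD); apply: (scaleD).
  by apply: (sumD) => w _; exact: scaleD.
by apply: generated_algebra_sub; left; exists 1%N; exact: derive_op_diffop.
Qed.

Definition spherical (c : param) : set (coordring -> coordring) :=
  [set sym_op \o P \o sym_op | P in cherednik c].

(* The variable X_i of F[h^*] is the i-th standard basis vector of h. The
   Dunkl operators commute, so that the order of the factors is immaterial. *)
Definition dunkl_poly (c : param) (f : {mpoly F[n]}) : coordring -> coordring :=
  \sum_(m <- msupp f) f@_m *:
    \big[comp/idfun]_(i < n) iter (m i) (comp (dunkl c (delta_mx i 0))) idfun.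

End Cherednik.

(* W-invariants in F[h^*] = S(h), where w maps X_i to sum_k (rho w)_{k,i} X_k *)
Definition dual_invariant (f : {mpoly F[n]}) : Prop :=
  forall w, psubst (rho w)^T f = f.

End ReflectionRepresentation.

Arguments sym_op {F n W} rho _.

(* Main.v *)
(* The operator f(y_c)e and the elements of e H_c e are read as maps from the
   W-invariant rational functions to the rational functions. As the Dunkl
   operators commute, an element of H_c e is, on invariants, a unique
   combination of the monomials in the y_{c'} with rational coefficients, for
   any parameter c'; it lies in H_{c'} e if and only if these coefficients are
   polynomials. Uniqueness holds because a differential operator that kills
   all the invariants is zero.

   Since the coefficients only have poles along the hyperplanes, it suffices
   to show that they have no pole at the generic point of each H. Over the
   local ring O of this point, O H_c e is generated by the Dunkl operators of
   the cyclic group W_H, because H_c e is stable under W and 1/alpha_{H'} lies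
   in O for H' <> H. So for W_H-invariant elements the question is one of rank
   one, where the algebra is generated by functions, the derivatives along H,
   the Euler operator x d/dv and v_c^N with x = alpha_H and N = n_H. On
   invariants x^N v_c^N is the product over j of x d/dv - (j + N c_{H,j}),
   which is symmetric in the numbers j + N c_{H,j}; the dot action permutes
   these. Hence e H_c e = e H_{g(c)} e.

   For a monomial m of degree d, the difference of e m(y_c) e and e
   m(y_{g(c)}) e then lies in e H_{g(c)} e, has order less than d and degree
   -d, so it is zero: its coefficients would be polynomials of negative
   degree. *)

Require Import Defs.
From HB Require Import structures.
From mathcomp Require Import all_boot all_order all_fingroup all_algebra.
From mathcomp Require Import all_field all_character.
From mathcomp Require Import boolp classical_sets functions reals complex.
From mathcomp Require Import ssrcomplements mpoly ring.

Set Implicit Arguments.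
Unset Strict Implicit.
Unset Printing Implicit Defensive.

Import GRing.Theory Num.Theory.
Local Open Scope ring_scope.

(** Reading operators on the W-invariants removes the group: w moves to the right through a monomial
    in the Dunkl operators, rotating their directions, and then acts as 1. What is left is a left
    vector space over the rational functions, where coefficients can be compared. Passing from c to
    c' there costs only poles, since the two Dunkl operators differ by group elements with
    coefficients alpha_H(y)/alpha_H, and it keeps the leading terms; this reduces uniqueness for any
    c to c = 0, that is, to partial derivatives.

    The obstacle is the pole along H, and the left factor e removes it. Averaging f v_c^a over W_H
    turns f into a function on which W_H acts by det^-a, and such a function is divisible by x^r,
    with r the remainder of a modulo N. This leaves x^r v_c^r, a product of operators x d/dv - const
    in which no Dunkl operator remains, and a power of v_c^N, which depends on the unordered
    exponents only. *)

Lemma mnm_ind n (P : 'X_{1..n} -> Prop) :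
  P 0%MM -> (forall i m, P m -> P (U_(i) + m)%MM) -> forall m, P m.
Proof.
move=> P0 PS m; have [k] := ubnP (mdeg m); elim: k m => // k IH m mk.
have [->//|m0] := eqVneq m 0%MM.
have /existsP[i mi] : [exists i, m i != 0%N].
  apply: contraNT m0; rewrite negb_exists => /forallP E; apply/eqP/mnmP => i.
  by rewrite mnm0E; apply/eqP; rewrite -[_ == _]negbK E.
have E : m = (U_(i) + (m - U_(i)))%MM by rewrite addmC submK ?lep1mP.
rewrite E; apply: PS; apply: IH.
by move: mk; rewrite {1}E mdegD mdeg1 add1n ltnS.
Qed.

(* Locked, as unification would otherwise unfold them to numerators and
   denominators. *)
HB.lock Definition rderive (F : fieldType) (n : nat) (y : 'cV[F]_n)
  (f : ratfun F n) : ratfun F n := ratderive y f.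

HB.lock Definition rsubst (F : fieldType) (n : nat) (h : 'M[F]_n)
  (f : ratfun F n) : ratfun F n := ratsubst h f.

(** * Derivations and linear substitutions of rational functions *)

Section RatfunCalculus.
Variables (F : fieldType) (n : nat).
Implicit Types (y v : 'cV[F]_n) (p q : {mpoly F[n]}) (f g : ratfun F n).

HB.instance Definition _ :=
  GRing.RMorphism.copy (@polyfrac F n) (@FracField.tofrac {mpoly F[n]}).

Lemma polyfracN p : polyfrac (- p) = - polyfrac p.
Proof. exact: rmorphN. Qed.

Definition ratC (a : F) : ratfun F n := polyfrac a%:MP.

Lemma ratC_is_zmod_morphism : zmod_morphism ratC.
Proof. by move=> a b; rewrite /ratC !rmorphB. Qed.

Lemma ratC_is_monoid_morphism : monoid_morphism ratC.
Proof. by split=> [|a b]; rewrite /ratC ?rmorph1 // !rmorphM. Qed.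

HB.instance Definition _ := GRing.isZmodMorphism.Build F (ratfun F n)
  ratC ratC_is_zmod_morphism.
HB.instance Definition _ := GRing.isMonoidMorphism.Build F (ratfun F n)
  ratC ratC_is_monoid_morphism.

Lemma ratfunP f : exists p q, q != 0 /\ f = polyfrac p / polyfrac q.
Proof. by exists (num f), (den f); split; [exact: den_neq0|exact: num_den]. Qed.

Lemma polyfrac_div1 p : polyfrac p = polyfrac p / polyfrac 1.
Proof. by rewrite rmorph1 divr1. Qed.

Lemma polyfrac_add p q r s : q != 0 -> s != 0 ->
  polyfrac p / polyfrac q + polyfrac r / polyfrac s =
  polyfrac (p * s + r * q) / polyfrac (q * s).
Proof.
move=> q0 s0; rewrite addf_div ?polyfrac_eq0 //.
by rewrite (polyfracD (p * s)) (polyfracM p) (polyfracM r) (polyfracM q).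
Qed.

Lemma polyfrac_sub p q r s : q != 0 -> s != 0 ->
  polyfrac p / polyfrac q - polyfrac r / polyfrac s =
  polyfrac (p * s - r * q) / polyfrac (q * s).
Proof. by move=> q0 s0; rewrite -mulNr -polyfracN polyfrac_add // mulNr. Qed.

Lemma polyfrac_mul p q r s :
  (polyfrac p / polyfrac q) * (polyfrac r / polyfrac s) =
  polyfrac (p * r) / polyfrac (q * s).
Proof. by rewrite mulf_div (polyfracM p) (polyfracM q). Qed.

Lemma rderive_frac y p q : q != 0 ->
  rderive y (polyfrac p / polyfrac q) =
  polyfrac (pderive y p * q - p * pderive y q) / polyfrac (q * q).
Proof. by move=> q0; rewrite rderive.unlock ratderive_frac. Qed.

Lemma rsubst_frac h p q : h \in unitmx -> q != 0 ->
  rsubst h (polyfrac p / polyfrac q) =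
  polyfrac (psubst h p) / polyfrac (psubst h q).
Proof. by move=> hu q0; rewrite rsubst.unlock ratsubst_frac. Qed.

Lemma rderive_poly y p : rderive y (polyfrac p) = polyfrac (pderive y p).
Proof.
rewrite polyfrac_div1 rderive_frac ?oner_neq0 // !mulr1 rmorph1 divr1.
have -> : pderive y 1 = 0 :> {mpoly F[n]}.
  by rewrite /pderive big1 // => i _; rewrite -mpolyC1 mderivC scaler0.
by rewrite mulr0 subr0.
Qed.

Lemma rderiveM y f g :
  rderive y (f * g) = rderive y f * g + f * rderive y g.
Proof.
have [p [q [q0 ->]]] := ratfunP f; have [r [s [s0 ->]]] := ratfunP g.
rewrite polyfrac_mul !rderive_frac ?mulf_neq0 //.
rewrite !polyfrac_mul polyfrac_add ?mulf_neq0 //; apply/eqP.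
rewrite polyfrac_eq ?mulf_neq0 // !pderiveM.
by apply/eqP; ring.
Qed.

Lemma rderive_is_zmod_morphism y : zmod_morphism (@rderive F n y).
Proof.
move=> f g.
have [p [q [q0 ->]]] := ratfunP f; have [r [s [s0 ->]]] := ratfunP g.
rewrite polyfrac_sub // !rderive_frac ?mulf_neq0 //.
rewrite polyfrac_sub ?mulf_neq0 //; apply/eqP.
rewrite polyfrac_eq ?mulf_neq0 // linearB /= !pderiveM.
by apply/eqP; ring.
Qed.

HB.instance Definition _ y := GRing.isZmodMorphism.Build (ratfun F n)
  (ratfun F n) (rderive y) (rderive_is_zmod_morphism y).

Lemma rderive_ratC y a : rderive y (ratC a) = 0.
Proof.
rewrite rderive_poly /pderive big1 ?rmorph0 // => i _.
by rewrite mderivC scaler0.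
Qed.

Lemma rderive1 y : rderive y (1 : ratfun F n) = 0.
Proof. by rewrite -(rmorph1 ratC) rderive_ratC. Qed.

Lemma rderiveV y f : rderive y f^-1 = - (rderive y f / f ^+ 2).
Proof.
have [->|f0] := eqVneq f 0; first by rewrite invr0 !raddf0 mul0r oppr0.
apply: (mulfI f0); have := rderive1 y; rewrite -(divff f0) rderiveM.
move/eqP; rewrite addrC addr_eq0 => /eqP ->.
by rewrite mulrN expr2 invfM [f * (_ * _)]mulrCA mulVKf // mulrC.
Qed.

(** If g q = p, the Leibniz rule forces the derivative of g, so a derivation of the fraction field
    is determined by its values on polynomials. *)
Lemma rderive_ext y (E : ratfun F n -> ratfun F n) :
  zmod_morphism E -> (forall f g, E (f * g) = E f * g + f * E g) ->
  (forall p, E (polyfrac p) = rderive y (polyfrac p)) ->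
  E =1 rderive y.
Proof.
move=> EB EM EP f; have [p [q [q0 ->]]] := ratfunP f.
have q0' : polyfrac q != 0 by rewrite polyfrac_eq0.
set g := _ / _; have gE : g * polyfrac q = polyfrac p by rewrite divfK.
by apply: (mulIf q0'); have := EP p; rewrite -gE EM rderiveM EP => /addIr.
Qed.

Lemma pderiveDl y v p : pderive (y + v) p = pderive y p + pderive v p.
Proof.
by rewrite /pderive -big_split; apply: eq_bigr => i _; rewrite mxE scalerDl.
Qed.

Lemma pderiveZl a y p : pderive (a *: y) p = a *: pderive y p.
Proof.
by rewrite /pderive scaler_sumr; apply: eq_bigr => i _; rewrite mxE scalerA.
Qed.

Lemma rderiveDl y v f : rderive (y + v) f = rderive y f + rderive v f.
Proof.
apply/esym; apply: (@rderive_ext (y + v) (fun f => _ f + _ f)) => [g h|g h|p].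
- by rewrite !raddfB addrACA opprD.
- by rewrite !rderiveM; ring.
- by rewrite !rderive_poly pderiveDl rmorphD.
Qed.

Lemma rderiveZl a y f : rderive (a *: y) f = ratC a * rderive y f.
Proof.
apply/esym; apply: (@rderive_ext (a *: y) (fun f => _ * _ f)) => [g h|g h|p].
- by rewrite !raddfB mulrBr.
- by rewrite !rderiveM; ring.
- by rewrite !rderive_poly pderiveZl -mul_mpolyC rmorphM.
Qed.

Lemma pderive_comm y v p : pderive y (pderive v p) = pderive v (pderive y p).
Proof.
rewrite /pderive.
transitivity (\sum_i \sum_j (y i 0 * v j 0) *: p^`M(j)^`M(i)).
  apply: eq_bigr => i _; rewrite (linear_sum (mderiv i)) scaler_sumr.
  by apply: eq_bigr => j _; rewrite /= linearZ scalerA.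
rewrite exchange_big; apply: eq_bigr => j _ /=.
rewrite (linear_sum (mderiv j)) scaler_sumr; apply: eq_bigr => i _.
by rewrite linearZ /= scalerA mulrC mderiv_comm.
Qed.

Lemma rderive_comm y v f :
  rderive y (rderive v f) = rderive v (rderive y f).
Proof.
have [p [q [q0 ->]]] := ratfunP f.
have q0' : polyfrac q != 0 by rewrite polyfrac_eq0.
set g := _ / _.
have E : g * polyfrac q = polyfrac p by rewrite divfK.
have P : rderive y (rderive v (polyfrac p))
         = rderive v (rderive y (polyfrac p)).
  by rewrite !rderive_poly pderive_comm.
have Q : rderive y (rderive v (polyfrac q))
         = rderive v (rderive y (polyfrac q)).
  by rewrite !rderive_poly pderive_comm.
(* Both sides are expanded on g q: the mixed terms are symmetric in y and v, [Q] cancels the terms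
   in q, and the commutator at g times q remains. *)
move: P; rewrite -E !rderiveM. rewrite (raddfD (rderive y))
  (raddfD (rderive v)) /= !rderiveM Q.
move/eqP; rewrite -subr_eq0 => /eqP P.
apply: (mulIf q0'); apply/eqP; rewrite -subr_eq0 -P; apply/eqP; ring.
Qed.

Lemma rsubst_poly h p : h \in unitmx ->
  rsubst h (polyfrac p) = polyfrac (psubst h p).
Proof.
move=> hu; rewrite polyfrac_div1 rsubst_frac ?oner_neq0 //.
by rewrite /psubst comp_mpoly1 rmorph1 divr1.
Qed.

Lemma rsubst_is_zmod_morphism h : h \in unitmx ->
  zmod_morphism (@rsubst F n h).
Proof.
move=> hu f g.
have [p [q [q0 ->]]] := ratfunP f; have [r [s [s0 ->]]] := ratfunP g.
rewrite polyfrac_sub // !rsubst_frac ?mulf_neq0 //.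
by rewrite polyfrac_sub ?psubst_eq0 // /psubst rmorphB !rmorphM.
Qed.

Lemma rsubst_is_monoid_morphism h : h \in unitmx ->
  monoid_morphism (@rsubst F n h).
Proof.
move=> hu; split=> [|f g].
  by rewrite -(rmorph1 (@polyfrac F n)) rsubst_poly // /psubst comp_mpoly1.
have [p [q [q0 ->]]] := ratfunP f; have [r [s [s0 ->]]] := ratfunP g.
rewrite polyfrac_mul !rsubst_frac ?mulf_neq0 //.
by rewrite polyfrac_mul /psubst !rmorphM.
Qed.

Lemma rsubst_comp h k f : h \in unitmx -> k \in unitmx ->
  rsubst h (rsubst k f) = rsubst (k *m h) f.
Proof.
move=> hu ku; have [p [q [q0 ->]]] := ratfunP f.
have ? : k *m h \in unitmx by rewrite unitmx_mul ku.
rewrite (rsubst_frac _ ku q0) (rsubst_frac _ hu) ?psubst_eq0 //.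
by rewrite rsubst_frac // !psubst_comp.
Qed.

Lemma rsubst1 f : rsubst 1%:M f = f.
Proof.
have [p [q [q0 ->]]] := ratfunP f.
by rewrite rsubst_frac ?unitmx1 // !psubst1.
Qed.

Lemma psubst_is_zmod_morphism h : zmod_morphism (@psubst F n h).
Proof. by move=> p q; rewrite /psubst rmorphB. Qed.

Lemma psubst_is_monoid_morphism h : monoid_morphism (@psubst F n h).
Proof. by split=> [|p q]; rewrite /psubst ?comp_mpoly1 // rmorphM. Qed.

HB.instance Definition _ h := GRing.isZmodMorphism.Build {mpoly F[n]}
  {mpoly F[n]} (@psubst F n h) (psubst_is_zmod_morphism h).
HB.instance Definition _ h := GRing.isMonoidMorphism.Build {mpoly F[n]}
  {mpoly F[n]} (@psubst F n h) (psubst_is_monoid_morphism h).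

Lemma psubstC h a : psubst h a%:MP = a%:MP :> {mpoly F[n]}.
Proof. by rewrite /psubst comp_mpolyC. Qed.

Lemma psubstZ h a p : psubst h (a *: p) = a *: psubst h p.
Proof. by rewrite /psubst comp_mpolyZ. Qed.

Lemma psubstX h i : psubst h 'X_i = \sum_(k < n) h i k *: 'X_k :> {mpoly F[n]}.
Proof. by rewrite /psubst comp_mpolyXU -tnth_nth tnth_mktuple. Qed.

Lemma rsubst_ratC h a : h \in unitmx -> rsubst h (ratC a) = ratC a.
Proof. by move=> hu; rewrite rsubst_poly // psubstC. Qed.

Lemma mpoly_var_ind (P : {mpoly F[n]} -> Prop) :
  (forall a, P a%:MP) -> (forall p q, P p -> P q -> P (p + q)) ->
  (forall i p, P p -> P ('X_i * p)) -> forall p, P p.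
Proof.
move=> PC PD PX p; rewrite [p]mpolyE; elim/big_rec: _ => [|m q _ Pq].
  by rewrite -mpolyC0.
apply: (PD) => //; move: {q Pq} p@_m => a.
elim/mnm_ind: m => [|i m IH]; first by rewrite mpolyX0 -mul_mpolyC mulr1.
by rewrite mpolyXD scalerAr; apply: PX.
Qed.

Lemma pderiveX y i : pderive y 'X_i = (y i 0)%:MP :> {mpoly F[n]}.
Proof.
rewrite /pderive (bigD1 i) //= mderivX mnm1E eqxx scale1r -{1}[U_(i)%MM]add0m
  addmK mpolyX0.
rewrite big1 ?addr0 ?alg_mpolyC // => j ji.
by rewrite mderivX mnm1E eq_sym (negPf ji) scale0r scaler0.
Qed.

Lemma pderiveC y a : pderive y a%:MP = 0 :> {mpoly F[n]}.
Proof. by rewrite /pderive big1 // => i _; rewrite mderivC scaler0. Qed.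

Lemma pderive_subst y h p :
  pderive y (psubst h p) = psubst h (pderive (h *m y) p).
Proof.
elim/mpoly_var_ind: p => [a|p q IHp IHq|i p IH].
- by rewrite psubstC !pderiveC raddf0.
- by rewrite !raddfD /= IHp IHq.
rewrite rmorphM /= !pderiveM IH rmorphD !rmorphM /= pderiveX psubstC.
congr (_ * _ + _).
rewrite psubstX linear_sum /= mxE rmorph_sum /=; apply: eq_bigr => k _.
by rewrite linearZ /= pderiveX mpolyCM mul_mpolyC.
Qed.

Lemma rderive_subst y h f : h \in unitmx ->
  rderive y (rsubst h f) = rsubst h (rderive (h *m y) f).
Proof.
move=> hu; have [p [q [q0 ->]]] := ratfunP f.
rewrite rsubst_frac // !rderive_frac ?psubst_eq0 // rsubst_frac ?mulf_neq0 //.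
by rewrite !pderive_subst !(rmorphB, rmorphM).
Qed.

End RatfunCalculus.

(** The block matrix with rows (1, -a) and (z, 1) is factored in two ways, and determinants are
    compared. *)
Lemma det_add1_rank1 (F : comNzRingType) n (z : 'cV[F]_n) (a : 'rV[F]_n) :
  \det (1%:M + z *m a) = 1 + (a *m z) 0 0.
Proof.
have E : block_mx 1%:M 0 z 1%:M *m block_mx 1%:M (- a) 0 (1%:M + z *m a)
       = block_mx (1%:M + a *m z) (- a) 0 1%:M *m block_mx 1%:M 0 z 1%:M.
  rewrite !mulmx_block !(mul1mx, mul0mx, mulmx1, mulmx0, addr0, add0r).
  by rewrite mulNmx mulmxN addrK addrC addrK.
have := congr1 determinant E.
rewrite !det_mulmx !det_ublock !det_lblock !det1 !mul1r !mulr1 => ->.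
by rewrite det_mx11 !mxE eqxx.
Qed.

(** * The groups W_H, their determinant character and the hyperplanes *)

Section Geometry.
Variables (F : numFieldType) (n : nat) (W : finGroupType).
Variable rho : mx_representation F [set: W]%G n.
Variable alpha : {vspace 'cV[F]_n} -> 'rV[F]_n.
Hypothesis rho_faithful : mx_faithful rho.
Hypothesis alphaP : defining_forms rho alpha.
Implicit Types (H : {vspace 'cV[F]_n}) (y v : 'cV[F]_n) (w u : W).

Local Notation arr := (arrangement rho).
Local Notation pst := (pstab rho).

Definition ev H y : F := (alpha H *m y) 0 0.
Definition chi w : F := \det (rho w).

Lemma evE H y : ev H y = (alpha H *m y) 0 0.
Proof. by []. Qed.

Lemma evP H : H \in arr -> forall y, (ev H y == 0) = (y \in H).
Proof.
move=> HA y; rewrite -(alphaP HA); apply/eqP/eqP => [E|E].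
  by apply/matrixP => i j; rewrite !ord1 [RHS]mxE.
by rewrite /ev E mxE.
Qed.

Lemma evD H y v : ev H (y + v) = ev H y + ev H v.
Proof. by rewrite /ev mulmxDr mxE. Qed.

Lemma evZ H a y : ev H (a *: y) = a * ev H y.
Proof. by rewrite /ev -scalemxAr mxE. Qed.

Lemma evN H y : ev H (- y) = - ev H y.
Proof. by rewrite /ev mulmxN mxE. Qed.

Lemma ev_sum H (I : finType) (P : pred I) (f : I -> 'cV[F]_n) :
  ev H (\sum_(i | P i) f i) = \sum_(i | P i) ev H (f i).
Proof. by rewrite /ev mulmx_sumr summxE. Qed.

Lemma alpha_ev H y : alpha H *m y = (ev H y)%:M.
Proof. by rewrite [LHS]mx11_scalar. Qed.

Lemma arr_dim H : H \in arr -> (\dim H).+1 = n.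
Proof. by case/arrangementP => w /eqP rw ->. Qed.

Lemma transversal_ex H : H \in arr -> exists v, ev H v = 1.
Proof.
move=> HA; have [v vH] : exists v, v \notin H.
  apply: contrapT => E; have := arr_dim HA.
  have -> : H = fullv.
    apply/vspaceP => v; rewrite memvf; apply: contrapT => vH; apply: E.
    by exists v; apply/negP.
  by rewrite dimvf /dim /= muln1 => /eqP; rewrite eqn_leq ltnn.
exists ((ev H v)^-1 *: v).
by rewrite evZ mulVf // evP.
Qed.

Lemma pstabP H w : reflect (forall y, y \in H -> rho w *m y = y) (w \in pst H).
Proof.
rewrite inE; apply: (iffP subvP) => fw y yH; first by apply/eqP;
  rewrite -mem_fix fw.
by rewrite mem_fix fw.
Qed.

Lemma pstab_group_set H : group_set (pst H).
Proof.
apply/group_setP; split=> [|u w uH wH]; apply/pstabP => y yH.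
  by rewrite repr_mx1 mul1mx.
by rewrite rhoM -mulmxA (pstabP _ _ wH) // (pstabP _ _ uH).
Qed.
Canonical pstab_group H := Group (pstab_group_set H).

Lemma nstab_gt0 H : (0 < nstab rho H)%N.
Proof. exact: cardG_gt0. Qed.

Lemma nstab_neq0 H : (nstab rho H)%:R != 0 :> F.
Proof. by rewrite pnatr_eq0 -lt0n nstab_gt0. Qed.

Lemma chiM w u : chi (w * u)%g = chi w * chi u.
Proof. by rewrite /chi rhoM det_mulmx. Qed.

Lemma chi1 : chi 1%g = 1.
Proof. by rewrite /chi repr_mx1 det1. Qed.

Lemma chi_neq0 w : chi w != 0.
Proof. by rewrite -unitfE -unitmxE rho_unit. Qed.

Lemma chiV w : chi w^-1%g = (chi w)^-1.
Proof.
by apply: (mulfI (chi_neq0 w)); rewrite -chiM mulgV chi1 divff ?chi_neq0.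
Qed.

Lemma chiX w k : chi (w ^+ k)%g = chi w ^+ k.
Proof.
by elim: k => [|k IH]; rewrite ?chi1 // expgS chiM IH exprS.
Qed.

(** The map [rho w - 1] kills H, so it is determined by its value z at a vector on which [alpha H]
    is 1. *)
Lemma pstab_rank1 H w : H \in arr -> w \in pst H ->
  exists2 z : 'cV[F]_n, rho w = 1%:M + z *m alpha H & chi w = 1 + ev H z.
Proof.
move=> HA wH; have [u0 u1] := transversal_ex HA.
exists (rho w *m u0 - u0); last first.
  rewrite -/(ev H _) /chi -det_add1_rank1; congr (\det _).
(* Both goals are now the same matrix identity. It is checked on vectors: y minus a multiple of [u0]
   lies in H, where w is trivial. *)
all: apply/row_matrixP => i; apply/rowP => j.
all: have E y : rho w *m y = (1%:M + (rho w *m u0 - u0) *m alpha H) *m y.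
1,3: have yH : y - ev H y *: u0 \in H by rewrite -evP // evD evN evZ u1 mulr1
  subrr.
1,2: have := pstabP _ _ wH _ yH; rewrite mulmxBr -scalemxAr => /eqP.
1,2: rewrite subr_eq => /eqP ->; rewrite mulmxDl mul1mx -mulmxA alpha_ev.
1,2: by rewrite mul_mx_scalar scalerBr -addrA [- _ + _]addrC.
all: have := congr1 (fun M : 'cV_n => M i 0) (E (delta_mx j 0)).
all: by rewrite -!colE !mxE.
Qed.

(** An element of determinant 1 would be a transvection, with k-th power 1 + k z alpha; finite order
    in characteristic zero forces z alpha = 0. *)
Lemma chi_inj H w : H \in arr -> w \in pst H -> chi w = 1 -> w = 1%g.
Proof.
move=> HA wH w1; have [z wE] := pstab_rank1 HA wH; rewrite w1 => /eqP.
rewrite addrC -subr_eq subrr eq_sym => /eqP z0.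
have wX k : rho (w ^+ k)%g = 1%:M + k%:R *: (z *m alpha H).
  elim: k => [|k IH]; first by rewrite expg0 repr_mx1 scale0r addr0.
  rewrite expgS rhoM IH wE mulmxDl mul1mx mulmxDr mulmx1 -scalemxAr mulmxA.
  rewrite -(mulmxA z) alpha_ev z0 (raddf0 (@scalar_mx F 1)) mulmx0 mul0mx
    scaler0 addr0.
  by rewrite -addrA -{2}[z *m _]scale1r -scalerDl natr1.
have := wX #[w]%g; rewrite expg_order repr_mx1 => /eqP.
rewrite addrC -subr_eq subrr eq_sym scaler_eq0 pnatr_eq0 -leqn0 leqNgt
  order_gt0.
move=> /eqP E; have r1 : rho w = 1%:M by rewrite wE E addr0.
apply/set1gP; apply: (fintype.subsetP rho_faithful).
by apply/rkerP; rewrite inE.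
Qed.

Lemma chi_nstab H w : w \in pst H -> chi w ^+ nstab rho H = 1.
Proof.
move=> wH; rewrite -chiX (_ : (w ^+ _)%g = 1%g) ?chi1 //.
have /dvdnP[k ->] : (#[w]%g %| nstab rho H)%N by apply:
  (@cardSg _ (pstab_group H)); rewrite cycle_subG.
by rewrite mulnC expgM expg_order expg1n.
Qed.

(** Otherwise the injective character [chi] would map the N elements of W_H to k-th roots of unity,
    of which there are at most k < N. This takes the place of a generator of W_H. *)
Lemma chi_nontriv H k : H \in arr -> (0 < k < nstab rho H)%N ->
  exists2 w, w \in pst H & chi w ^+ k != 1.
Proof.
move=> HA /andP[k0 kN]; apply: contrapT => E.
have u1 : all k.-unity_root [seq chi w | w <- enum (pst H)].
  apply/allP => x /mapP[w]; rewrite mem_enum => wH -> {x}.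
  apply/unity_rootP/eqP; apply: contrapT => /negP w1; apply: E.
  by exists w.
have uq : uniq [seq chi w | w <- enum (pst H)].
  rewrite map_inj_in_uniq ?enum_uniq // => w u; rewrite !mem_enum => wH uH E'.
  apply/eqP; rewrite eq_mulgV1; apply/eqP; apply: (chi_inj HA).
    by rewrite groupM ?groupV.
  by rewrite chiM chiV E' divff ?chi_neq0.
have := max_unity_roots k0 u1 uq; rewrite size_map -cardE.
by rewrite leqNgt kN.
Qed.

Lemma chi_orth H i j : H \in arr -> (i < nstab rho H)%N ->
  (j < nstab rho H)%N ->
  \sum_(w in pst H) chi w ^- j * chi w ^+ i = (i == j)%:R * (nstab rho H)%:R.
Proof.
move=> HA iN jN; have [->|ij] := eqVneq i j.
  under eq_bigr do rewrite mulVf ?expf_neq0 ?chi_neq0 //.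
  by rewrite sumr_const mul1r.
rewrite mul0r; set S := \sum_(w in _) _.
have [u uH u1] : exists2 u, u \in pst H & chi u ^- j * chi u ^+ i != 1.
  have [ji|ij'] := ltnP j i.
    have [|u uH u1] := @chi_nontriv H (i - j) HA.
      by rewrite subn_gt0 ji (leq_ltn_trans (leq_subr _ _)).
    by exists u => //; rewrite mulrC -expfB.
  have {ij ij'}ji : (i < j)%N by rewrite ltn_neqAle ij.
  have [|u uH u1] := @chi_nontriv H (j - i) HA.
    by rewrite subn_gt0 ji (leq_ltn_trans (leq_subr _ _)).
  exists u => //; apply: contra u1 => /eqP E.
  by rewrite expfB // -[X in _ == X]invr1 -E invfM invrK.
have ES : S = chi u ^- j * chi u ^+ i * S.
  rewrite {1}/S (reindex_inj (mulgI u)) /= mulr_sumr.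
  apply: eq_big => [w|w _]; first by rewrite groupMl.
  by rewrite chiM !exprMn invfM mulrACA.
apply/eqP; move/eqP: ES; rewrite eq_sym -subr_eq0 -{2}[S]mul1r -mulrBl mulf_eq0.
by rewrite subr_eq0 (negPf u1).
Qed.

(** The projection of [u0] to the [chi]-isotypic part of h is a common eigenvector, so one v serves
    all elements of W_H. *)
Lemma root_ex H : H \in arr -> exists v, ev H v = 1 /\
  forall w, w \in pst H -> rho w = 1%:M + (chi w - 1) *: (v *m alpha H).
Proof.
move=> HA; have [u0 u1] := transversal_ex HA.
set N := (nstab rho H)%:R : F.
pose v := N^-1 *: \sum_(w in pst H) (chi w)^-1 *: (rho w *m u0).
have evw w y : w \in pst H -> ev H (rho w *m y) = chi w * ev H y.
  move=> wH; have [z -> ->] := pstab_rank1 HA wH.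
  by rewrite mulmxDl mul1mx -mulmxA alpha_ev mul_mx_scalar evD evZ mulrDl mul1r
    mulrC.
have v1 : ev H v = 1.
  rewrite evZ ev_sum (eq_bigr (fun=> 1)) => [|w wH].
    by rewrite sumr_const mulVf ?nstab_neq0.
  by rewrite evZ evw // u1 mulr1 mulVf ?chi_neq0.
exists v; split=> // w wH; have [z wE cE] := pstab_rank1 HA wH.
have wv : rho w *m v = chi w *: v.
  rewrite -scalemxAr scalerA mulrC -scalerA; congr (_ *: _).
  rewrite mulmx_sumr scaler_sumr [RHS](reindex_inj (mulgI w)) /=.
  apply: eq_big => [u|u _]; first by rewrite groupMl.
  rewrite scalerA chiM invfM mulrA mulfV ?chi_neq0 // mul1r.
  by rewrite -scalemxAr rhoM -mulmxA.
rewrite {1}wE scalemxAl; congr (_ + _ *m _).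
have : rho w *m v = v + z by rewrite wE mulmxDl mul1mx -mulmxA alpha_ev v1
  mulmx1.
by rewrite wv scalerBl scale1r => ->; rewrite addrC addKr.
Qed.

Definition coroot H : 'cV[F]_n := xget 0 [set v | ev H v = 1 /\
  forall w, w \in pst H -> rho w = 1%:M + (chi w - 1) *: (v *m alpha H)].

Lemma corootP H : H \in arr -> ev H (coroot H) = 1 /\ forall w, w \in pst H ->
  rho w = 1%:M + (chi w - 1) *: (coroot H *m alpha H).
Proof. by move=> HA; exact: (xgetPex 0 (root_ex HA)). Qed.

Lemma ev_coroot H : H \in arr -> ev H (coroot H) = 1.
Proof. by move=> HA; have [] := corootP HA. Qed.

Lemma pstab_act H w y : H \in arr -> w \in pst H ->
  rho w *m y = y + ((chi w - 1) * ev H y) *: coroot H.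
Proof.
move=> HA wH; have [_ /(_ w wH) {1}->] := corootP HA.
by rewrite mulmxDl mul1mx -scalemxAl -mulmxA alpha_ev mul_mx_scalar scalerA.
Qed.

Lemma pstab_form H w (xi : 'rV[F]_n) : H \in arr -> w \in pst H ->
  xi *m rho w = xi + ((chi w - 1) * (xi *m coroot H) 0 0) *: alpha H.
Proof.
move=> HA wH; have [_ /(_ w wH) {1}->] := corootP HA.
rewrite mulmxDr mulmx1 -scalemxAr mulmxA -scalerA; congr (_ + _ *: _).
by rewrite {1}[xi *m _]mx11_scalar mul_scalar_mx.
Qed.

Lemma pstab_hyper H w : w \in pst H -> (wlin rho w @: H)%VS = H.
Proof.
move=> /pstabP wH; apply/vspaceP => y; apply/memv_imgP/idP => [[x xH ->]|yH].
  by rewrite /wlin lfunE /= wH.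
by exists y => //; rewrite /wlin lfunE /= wH.
Qed.

Lemma pstab_img H u w : (w \in pst H)
  = ((u * w * u^-1)%g \in pst (wlin rho u @: H)).
Proof.
rewrite !inE -fix_conj; apply/idP/idP => [|/subvP sub]; first exact: limgS.
apply/subvP => y yH; have /memv_imgP[x xf] := sub _ (memv_img (wlin rho u) yH).
rewrite /wlin !lfunE /= => /(congr1 (mulmx (rho u^-1%g))).
by rewrite !mulmxA rhoV !mul1mx => ->.
Qed.

(** The forms are chosen independently for each hyperplane, so W permutes them only up to scalars:
    both sides vanish on H, and the scalar is read off at the coroot. *)
Lemma alpha_img H u : H \in arr ->
  exists2 l, l != 0 & alpha (wlin rho u @: H)%VS *m rho u = l *: alpha H.
Proof.
move=> HA; have uHA := arrangement_stable u HA.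
set H' := (wlin rho u @: H)%VS in uHA *.
exists (ev H' (rho u *m coroot H)).
  rewrite evP //; apply/negP => /memv_imgP[x xH].
  rewrite /wlin lfunE /= => /(congr1 (mulmx (rho u^-1%g))).
  rewrite !mulmxA rhoV !mul1mx => E; move: xH; rewrite -E -evP // ev_coroot //.
  by rewrite oner_eq0.
have E y : alpha H' *m rho u *m y = (ev H' (rho u *m coroot H) *: alpha H) *m y.
  rewrite -mulmxA alpha_ev -scalemxAl alpha_ev scale_scalar_mx; congr (_%:M).
  have : y - ev H y *: coroot H \in H.
    by rewrite -evP // evD evN evZ ev_coroot // mulr1 subrr.
  move/(memv_img (wlin rho u)); rewrite -evP // /wlin lfunE /= mulmxBr evD evN.
  by rewrite -scalemxAr evZ subr_eq0 mulrC => /eqP.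
apply/rowP => j; have := congr1 (fun M : 'M_1 => M 0 0) (E (delta_mx j 0)).
by rewrite -!colE !mxE.
Qed.

Lemma arr_perm u : perm_eq [seq (wlin rho u @: H)%VS | H <- arr] arr.
Proof.
have inj w : injective (fun H => wlin rho w @: H)%VS.
  move=> H H' E; apply/vspaceP => y.
  have mem (K : {vspace 'cV[F]_n}) : (y \in K)
    = (rho w *m y \in (wlin rho w @: K)%VS).
    apply/idP/memv_imgP => [yK|[x xK]]; first by exists y => //;
      rewrite /wlin lfunE.
    rewrite /wlin lfunE /= => /(congr1 (mulmx (rho w^-1%g))).
    by rewrite !mulmxA rhoV !mul1mx => ->.
  by rewrite !mem E.
apply: uniq_perm; rewrite ?map_inj_uniq ?undup_uniq // => H.
have sub w K : K \in arr -> (wlin rho w @: K)%VS \in arr by exact: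
  arrangement_stable.
apply/mapP/idP => [[K KA ->]|HA]; first exact: sub.
exists (wlin rho u^-1%g @: H)%VS; first exact: sub.
apply/vspaceP => y; apply/idP/memv_imgP => [yH|[x /memv_imgP[z zH ->] ->]].
  exists (rho u^-1%g *m y); last by rewrite /wlin lfunE /= mulmxA -rhoM mulgV
    repr_mx1 mul1mx.
  by apply/memv_imgP; exists y => //; rewrite /wlin lfunE.
by rewrite /wlin !lfunE /= mulmxA -rhoM mulgV repr_mx1 mul1mx.
Qed.

Lemma arr_sub_eq H H' : H \in arr -> H' \in arr -> (H <= H')%VS -> H = H'.
Proof.
move=> HA HA' sub; apply/eqP; rewrite eqEdim sub /=.
have E := etrans (arr_dim HA) (esym (arr_dim HA')).
by move: E => [->].
Qed.

(** The coefficient of w in the group algebra element sum_j n_H c_{H,j} e_{H,j}; the factor n_H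
    cancels the denominator of the idempotent. *)
Definition dunkl_coef (c : param rho) H w : F :=
  \sum_(j < nstab rho H) c H j * chi w ^- j.

Lemma dunkl_coef_img c H u w : param_space c -> H \in arr ->
  dunkl_coef c (wlin rho u @: H)%VS (u * w * u^-1)%g = dunkl_coef c H w.
Proof.
move=> cP HA; rewrite /dunkl_coef.
rewrite (reindex (cast_ord (esym (nstab_stable rho u H)))) /=; last first.
  by exists (cast_ord (nstab_stable rho u H)) => i _;
    rewrite ?cast_ordK ?cast_ordKV.
apply: eq_bigr => j _; rewrite (cP u H j) //; congr (_ * _ ^- _).
by rewrite !chiM chiV mulrAC mulfV ?chi_neq0 // mul1r.
Qed.

Lemma dot_action_param_space (s : permparam rho) (c : param rho) :
  perm_group s -> param_space c -> param_space (dot_action s c).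
Proof.
move=> sP cP u H j j' HA E; rewrite /dot_action /perm_param /rho_param.
set x := ((s H)^-1%g : {perm _}) j; set x' := ((s _)^-1%g : {perm _}) j'.
have xx : x' = x :> nat.
  pose x2 := cast_ord (esym (nstab_stable rho u H)) x.
  suff -> : x' = x2 by [].
  apply: (@perm_inj _ (s (wlin rho u @: H)%VS)); rewrite permKV; apply: val_inj.
  by rewrite /= (sP u H x) // permKV.
by rewrite (cP u H x) // xx E nstab_stable.
Qed.

End Geometry.

(** * Linear forms as rational functions *)

Section LinearForms.
Variables (F : fieldType) (n : nat).
Implicit Types (xi : 'rV[F]_n) (y : 'cV[F]_n).

Definition lform xi : ratfun F n := polyfrac (linear_form xi).

Lemma linear_formD xi xi' :
  linear_form (xi + xi') = linear_form xi + linear_form xi'.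
Proof.
by rewrite /linear_form -big_split; apply: eq_bigr => i _; rewrite mxE scalerDl.
Qed.

Lemma linear_formZ a xi : linear_form (a *: xi) = a *: linear_form xi.
Proof.
by rewrite /linear_form scaler_sumr; apply: eq_bigr => i _; rewrite mxE scalerA.
Qed.

Lemma mpolyX_linear_form i : 'X_i = linear_form (delta_mx 0 i) :> {mpoly F[n]}.
Proof.
rewrite /linear_form (bigD1 i) //= mxE !eqxx scale1r big1 ?addr0 // => j ji.
by rewrite mxE (negPf ji) andbF scale0r.
Qed.

Lemma lformD xi xi' : lform (xi + xi') = lform xi + lform xi'.
Proof. by rewrite /lform linear_formD polyfracD. Qed.

Lemma lformZ a xi : lform (a *: xi) = ratC n a * lform xi.
Proof. by rewrite /lform linear_formZ -mul_mpolyC polyfracM. Qed.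

Lemma psubst_linear_form (h : 'M[F]_n) xi :
  psubst h (linear_form xi) = linear_form (xi *m h).
Proof.
rewrite /linear_form rmorph_sum /=.
under eq_bigr => i _ do rewrite psubstZ psubstX scaler_sumr.
rewrite exchange_big; apply: eq_bigr => k _ /=.
by rewrite mxE scaler_suml; apply: eq_bigr => i _; rewrite scalerA.
Qed.

Lemma rderive_lform y xi : rderive y (lform xi) = ratC n ((xi *m y) 0 0).
Proof.
rewrite rderive_poly /linear_form linear_sum /ratC mxE; congr polyfrac.
rewrite rmorph_sum /=; apply: eq_bigr => i _.
by rewrite linearZ /= pderiveX mpolyCM mul_mpolyC.
Qed.

Lemma lform_eq0 xi : (lform xi == 0) = (xi == 0).
Proof.
rewrite polyfrac_eq0; apply/eqP/eqP => [E|->]; last first.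
  by rewrite /linear_form big1 // => i _; rewrite mxE scale0r.
apply/rowP => i; have := congr1 (mcoeff U_(i)) E.
rewrite /linear_form raddf_sum /= mcoeff0 mxE => <-.
rewrite (bigD1 i) //= mcoeffZ mcoeffXU eqxx mulr1 big1 ?addr0 // => j ji.
by rewrite mcoeffZ mcoeffXU (negPf ji) mulr0.
Qed.

End LinearForms.

(** * Dunkl operators on rational functions and their commutativity *)

Section DunklTerms.
Variables (F : numFieldType) (n : nat) (W : finGroupType).
Variable rho : mx_representation F [set: W]%G n.
Variable alpha : {vspace 'cV[F]_n} -> 'rV[F]_n.
Hypothesis rho_faithful : mx_faithful rho.
Hypothesis alphaP : defining_forms rho alpha.
Implicit Types (H : {vspace 'cV[F]_n}) (y v : 'cV[F]_n) (w u : W).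
Implicit Types (psi : ratfun F n) (c : param rho).

Local Notation arr := (arrangement rho).
Local Notation pst := (pstab rho).
Local Notation "c %:L" := (ratC n c) (at level 2, format "c %:L").
Local Notation ev := (ev alpha).
Local Notation chi := (chi rho).
Local Notation coroot := (coroot rho alpha).

Definition wact w psi := rsubst (rho w^-1%g) psi.

Lemma wact_is_zmod_morphism w : zmod_morphism (wact w).
Proof. exact: rsubst_is_zmod_morphism (rho_unit _ _). Qed.

Lemma wact_is_monoid_morphism w : monoid_morphism (wact w).
Proof. exact: rsubst_is_monoid_morphism (rho_unit _ _). Qed.

HB.instance Definition _ w := GRing.isZmodMorphism.Build (ratfun F n)
  (ratfun F n) (wact w) (wact_is_zmod_morphism w).
HB.instance Definition _ w := GRing.isMonoidMorphism.Build (ratfun F n)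
  (ratfun F n) (wact w) (wact_is_monoid_morphism w).

Lemma wactM w u psi : wact (w * u)%g psi = wact w (wact u psi).
Proof. by rewrite /wact rsubst_comp ?rho_unit // invMg rhoM. Qed.

Lemma wact1 psi : wact 1%g psi = psi.
Proof. by rewrite /wact invg1 repr_mx1 rsubst1. Qed.

Lemma wact_ratC w a : wact w a%:L = a%:L.
Proof. by rewrite /wact rsubst_ratC ?rho_unit. Qed.

Lemma wact_lform w xi : wact w (lform xi) = lform (xi *m rho w^-1%g).
Proof. by rewrite /wact /lform rsubst_poly ?rho_unit // psubst_linear_form. Qed.

Lemma wact_poly w p : wact w (polyfrac p) = polyfrac (psubst (rho w^-1%g) p).
Proof. by rewrite /wact rsubst_poly ?rho_unit. Qed.

Lemma wact_derive w y psi :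
  wact w (rderive y psi) = rderive (rho w *m y) (wact w psi).
Proof. by rewrite /wact rderive_subst ?rho_unit // mulmxA rhoV mul1mx. Qed.

Lemma alpha_neq0 H : H \in arr -> alpha H != 0.
Proof.
move=> HA; have := ev_coroot alphaP HA.
by apply: contra_eqN => /eqP E; rewrite !evE E mul0mx mxE eq_sym oner_eq0.
Qed.

Lemma lform_alpha_neq0 H : H \in arr -> lform (alpha H) != 0.
Proof. by move=> HA; rewrite lform_eq0 alpha_neq0. Qed.

(* The form alpha_H(y) / alpha_H does not depend on the choice of alpha_H. *)
Definition logform H y : ratfun F n := (ev H y)%:L / lform (alpha H).

Definition hterm c H y psi : ratfun F n :=
  logform H y * \sum_(w in pst H) (dunkl_coef c H w)%:L * wact w psi.

Lemma logformE H y : logform H y = (ev H y)%:L / lform (alpha H).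
Proof. by []. Qed.

Lemma htermE c H y psi : hterm c H y psi =
  logform H y * \sum_(w in pst H) (dunkl_coef c H w)%:L * wact w psi.
Proof. by []. Qed.

End DunklTerms.

(** The list [A] is a parameter so that one definition covers the whole arrangement and the rank one
    group W_H, where it is [[:: H]]. *)
HB.lock Definition dunklL (F : numFieldType) (n : nat) (W : finGroupType)
    (rho : mx_representation F [set: W]%G n)
    (alpha : {vspace 'cV[F]_n} -> 'rV[F]_n)
    (A : seq {vspace 'cV[F]_n}) (c : param rho) (y : 'cV[F]_n)
    (psi : ratfun F n) : ratfun F n :=
  rderive y psi - \sum_(H <- A) hterm alpha c H y psi.

Section Dunkl.
Variables (F : numFieldType) (n : nat) (W : finGroupType).
Variable rho : mx_representation F [set: W]%G n.
Variable alpha : {vspace 'cV[F]_n} -> 'rV[F]_n.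
Hypothesis rho_faithful : mx_faithful rho.
Hypothesis alphaP : defining_forms rho alpha.
Implicit Types (H : {vspace 'cV[F]_n}) (y v : 'cV[F]_n) (w u : W).
Implicit Types (psi : ratfun F n) (c : param rho).

Local Notation arr := (arrangement rho).
Local Notation pst := (pstab rho).
Local Notation "c %:L" := (ratC n c) (at level 2, format "c %:L").
Local Notation ev := (ev alpha).
Local Notation chi := (chi rho).
Local Notation coroot := (coroot rho alpha).

Local Notation wact := (wact rho).
Local Notation logform := (logform alpha).
Local Notation hterm := (hterm alpha).
Local Notation dunklL := (dunklL alpha).

Lemma dunklLE A c y psi :
  dunklL A c y psi = rderive y psi - \sum_(H <- A) hterm c H y psi.
Proof. by rewrite dunklL.unlock. Qed.

Lemma logformD H y v : logform H (y + v) = logform H y + logform H v.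
Proof. by rewrite !logformE evD rmorphD mulrDl. Qed.

Lemma logformZ H a y : logform H (a *: y) = a%:L * logform H y.
Proof. by rewrite !logformE evZ rmorphM mulrA. Qed.

Lemma hterm_is_zmod_morphism c H y : zmod_morphism (hterm c H y).
Proof.
move=> f g; rewrite !htermE -mulrBr -sumrB; congr (_ * _).
by apply: eq_bigr => w _; rewrite raddfB mulrBr.
Qed.

HB.instance Definition _ c H y := GRing.isZmodMorphism.Build (ratfun F n)
  (ratfun F n) (hterm c H y) (hterm_is_zmod_morphism c H y).

Lemma dunklL_is_zmod_morphism A c y : zmod_morphism (dunklL A c y).
Proof.
move=> f g; rewrite !dunklLE raddfB /=.
under eq_bigr do rewrite raddfB /=.
by rewrite sumrB !opprD !opprK addrACA.
Qed.

HB.instance Definition _ A c y := GRing.isZmodMorphism.Build (ratfun F n)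
  (ratfun F n) (dunklL A c y) (dunklL_is_zmod_morphism A c y).

Lemma hterm_ratC c H y a psi : hterm c H y (a%:L * psi)
  = a%:L * hterm c H y psi.
Proof.
rewrite !htermE [RHS]mulrCA; congr (_ * _); rewrite mulr_sumr.
by apply: eq_bigr => w _; rewrite rmorphM /= wact_ratC mulrCA.
Qed.

Lemma dunklL_ratC A c y a psi :
  dunklL A c y (a%:L * psi) = a%:L * dunklL A c y psi.
Proof.
rewrite !dunklLE rderiveM rderive_ratC mul0r add0r mulrBr mulr_sumr.
by congr (_ - _); apply: eq_bigr => H _; rewrite hterm_ratC.
Qed.

Lemma htermDl c H y v psi : hterm c H (y + v) psi = hterm c H y psi
  + hterm c H v psi.
Proof. by rewrite !htermE logformD mulrDl. Qed.

Lemma htermZl c H a y psi : hterm c H (a *: y) psi = a%:L * hterm c H y psi.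
Proof. by rewrite !htermE logformZ mulrA. Qed.

Lemma dunklLDl A c y v psi :
  dunklL A c (y + v) psi = dunklL A c y psi + dunklL A c v psi.
Proof.
rewrite !dunklLE rderiveDl; under eq_bigr do rewrite htermDl.
by rewrite big_split opprD addrACA.
Qed.

Lemma dunklLZl A c a y psi : dunklL A c (a *: y) psi = a%:L * dunklL A c y psi.
Proof.
rewrite !dunklLE rderiveZl mulrBr mulr_sumr.
by congr (_ - _); apply: eq_bigr => H _; rewrite htermZl.
Qed.

Lemma dunklL_basis A c y psi :
  dunklL A c y psi = \sum_i (y i 0)%:L * dunklL A c (delta_mx i 0) psi.
Proof.
rewrite {1}[y]matrix_sum_delta; under eq_bigr do rewrite big_ord1.
elim/big_rec2: _ => [|i f v _ <-]; last by rewrite dunklLDl dunklLZl.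
by have := dunklLZl A c 0 0 psi; rewrite scale0r rmorph0 mul0r.
Qed.

Lemma logform_wact u H y : H \in arr ->
  wact u (logform H y) = logform (wlin rho u @: H)%VS (rho u *m y).
Proof.
move=> HA; have [l l0 E] := alpha_img alphaP u HA.
rewrite !logformE fmorph_div /= wact_ratC wact_lform.
have -> : alpha H *m rho u^-1%g = l^-1 *: alpha (wlin rho u @: H)%VS.
  by rewrite -[alpha H](scalerK l0) -E -scalemxAl -mulmxA -rhoM mulgV repr_mx1
    mulmx1.
have -> : ev (wlin rho u @: H)%VS (rho u *m y) = l * ev H y.
  by rewrite !evE mulmxA E -scalemxAl mxE.
by rewrite lformZ rmorphM fmorphV invfM invrK /= mulrCA mulrA.
Qed.

Lemma hterm_wact u c H y psi : param_space c -> H \in arr ->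
  wact u (hterm c H y psi) = hterm c (wlin rho u @: H)%VS (rho u *m y)
    (wact u psi).
Proof.
move=> cP HA; rewrite !htermE rmorphM /= logform_wact //; congr (_ * _).
rewrite rmorph_sum [RHS](reindex (fun w => u * w * u^-1)%g) /=; last first.
  exists (fun w => u^-1 * w * u)%g => w _; rewrite !mulgA;
    first by rewrite mulVg mul1g mulgKV.
  by rewrite mulgV mul1g mulgK.
apply: eq_big => [w|w wH]; first by rewrite -pstab_img.
rewrite rmorphM /= wact_ratC dunkl_coef_img // -!wactM.
by rewrite mulgKV.
Qed.

Lemma dunklL_wact u c y psi : param_space c ->
  wact u (dunklL arr c y psi) = dunklL arr c (rho u *m y) (wact u psi).
Proof.
move=> cP; rewrite !dunklLE rmorphB /= wact_derive rmorph_sum /=; congr (_ - _).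
apply: etrans (perm_big _ (arr_perm rho u)).
rewrite big_map big_seq [RHS]big_seq.
by apply: eq_bigr => H HA; rewrite hterm_wact.
Qed.

(* The commutator [y_c, xi], a scalar plus an element of the group algebra. *)
Definition dunkl_comm c (xi : 'rV[F]_n) y psi : ratfun F n :=
  ((xi *m y) 0 0)%:L * psi
  - \sum_(H <- arr) (ev H y * (xi *m coroot H) 0 0)%:L *
      \sum_(w in pst H) (dunkl_coef c H w * (chi w^-1%g - 1))%:L * wact w psi.

(** W_H moves [xi] only by multiples of [alpha H], which cancel the pole of [logform H y]. *)
Lemma hterm_lform c H y xi psi : H \in arr ->
  hterm c H y (lform xi * psi) = lform xi * hterm c H y psi +
  (ev H y * (xi *m coroot H) 0 0)%:L *
      \sum_(w in pst H) (dunkl_coef c H w * (chi w^-1%g - 1))%:L * wact w psi.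
Proof.
move=> HA; rewrite !htermE mulrCA.
have -> : (ev H y * (xi *m coroot H) 0 0)%:L =
    logform H y * (lform (alpha H) * ((xi *m coroot H) 0 0)%:L).
  by rewrite !logformE mulrA divfK ?(lform_alpha_neq0 alphaP HA) //
    (rmorphM (ratC n)).
rewrite -mulrA -mulrDr; congr (_ * _); rewrite !mulr_sumr -big_split /=.
apply: eq_bigr => w wH; rewrite rmorphM /= wact_lform.
rewrite (pstab_form alphaP _ HA) ?groupV // lformD lformZ !rmorphM; ring.
Qed.

Lemma dunklL_lform c y xi psi :
  dunklL arr c y (lform xi * psi) = lform xi * dunklL arr c y psi
    + dunkl_comm c xi y psi.
Proof.
rewrite !dunklLE rderiveM rderive_lform /dunkl_comm mulrBr mulr_sumr.
rewrite addrACA [lform xi * _ + _]addrC; congr (_ + _).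
rewrite -opprD -big_split; congr (- _); rewrite big_seq [RHS]big_seq.
by apply: eq_bigr => H HA; rewrite hterm_lform.
Qed.

(** By the Jacobi identity this says that [y_c, v_c] commutes with [xi]. An element of W_H moves v
    by a multiple of [ev H v] times the coroot, so every term carries the symmetric factor
    [ev H y * ev H v]. *)
Lemma dunkl_comm_sym c xi y v psi : param_space c ->
  dunkl_comm c xi y (dunklL arr c v psi)
    - dunklL arr c v (dunkl_comm c xi y psi)
  = dunkl_comm c xi v (dunklL arr c y psi)
    - dunklL arr c y (dunkl_comm c xi v psi).
Proof.
move=> cP.
pose G y v := - \sum_(H <- arr) \sum_(w in pst H)
  (ev H y * ev H v * ((xi *m coroot H) 0 0 *
    (dunkl_coef c H w * (chi w^-1%g - 1)) *
    (chi w - 1)))%:L * dunklL arr c (coroot H) (wact w psi).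
suff E y' v' : dunkl_comm c xi y' (dunklL arr c v' psi)
    - dunklL arr c v' (dunkl_comm c xi y' psi) = G y' v'.
  rewrite !E /G; congr (- _); apply: eq_bigr => H _; apply: eq_bigr => w _.
  by rewrite [ev H y * _]mulrC.
rewrite /dunkl_comm (raddfB (dunklL arr c v')) /= dunklL_ratC.
rewrite opprB addrC addrA subrK (raddf_sum (dunklL arr c v')) -sumrB /G -sumrN.
rewrite big_seq [RHS]big_seq; apply: eq_bigr => H HA.
rewrite /= dunklL_ratC -mulrBr (raddf_sum (dunklL arr c v')) -sumrB mulr_sumr
  -sumrN.
apply: eq_bigr => w wH /=; rewrite dunklL_ratC -mulrBr dunklL_wact //.
rewrite (pstab_act alphaP _ HA wH) dunklLDl dunklLZl !rmorphM; ring.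
Qed.


Lemma dunklL_one c y :
  dunklL arr c y 1 = - \sum_(H <- arr) logform H y *
    (\sum_(w in pst H) dunkl_coef c H w)%:L.
Proof.
rewrite !dunklLE rderive1 sub0r; congr (- _); apply: eq_bigr => H _.
rewrite !htermE rmorph_sum /=; congr (_ * _); apply: eq_bigr => w _.
by rewrite rmorph1 mulr1.
Qed.

Lemma rderive_logform v H y : H \in arr ->
  rderive v (logform H y) = - ((ev H y * ev H v)%:L / lform (alpha H) ^+ 2).
Proof.
move=> HA; rewrite !logformE rderiveM rderive_ratC mul0r add0r rderiveV.
by rewrite rderive_lform mulrN mulrA rmorphM.
Qed.

(** Three contributions are symmetric separately: the derivatives of the forms 1/alpha, the product
    of the two values at 1, and the terms in which W_H moves v. *)
Lemma dunklL_comm_one c y v : param_space c ->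
  dunklL arr c y (dunklL arr c v 1) = dunklL arr c v (dunklL arr c y 1).
Proof.
move=> cP; pose ka H := \sum_(w in pst H) dunkl_coef c H w.
pose G y v := (\sum_(H <- arr) (ev H v * ev H y * ka H)%:L / lform (alpha H) ^+
  2)
  + dunklL arr c y 1 * dunklL arr c v 1
  - \sum_(H <- arr) (ev H y * ev H v)%:L / lform (alpha H) *
      ((\sum_(w in pst H) dunkl_coef c H w * (chi w - 1))%:L * dunklL arr c
        (coroot H) 1).
suff E y' v' : dunklL arr c y' (dunklL arr c v' 1) = G y' v'.
  rewrite !E /G; congr (_ + _ - _).
  - by apply: eq_bigr => H _; rewrite [ev H y * _]mulrC.
  - by rewrite mulrC.
  by apply: eq_bigr => H _; rewrite [ev H y * _]mulrC.
set g := dunklL arr c v' 1.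
have gw H w : H \in arr -> w \in pst H ->
    wact w g = g + ((chi w - 1) * ev H v')%:L * dunklL arr c (coroot H) 1.
  move=> HA wH; rewrite /g dunklL_wact // rmorph1.
  by rewrite (pstab_act alphaP _ HA wH) dunklLDl dunklLZl.
rewrite {1}dunklLE; have -> : rderive y' g =
    \sum_(H <- arr) (ev H v' * ev H y' * ka H)%:L / lform (alpha H) ^+ 2.
  rewrite /g dunklL_one raddfN /= (raddf_sum (rderive y')) -sumrN.
  rewrite big_seq [RHS]big_seq; apply: eq_bigr => H HA /=.
  rewrite rderiveM rderive_ratC mulr0 addr0 rderive_logform // mulNr opprK.
  by rewrite [(_ * ka H)%:L]rmorphM mulrAC.
rewrite /G -addrA; congr (_ + _); rewrite dunklL_one mulNr -opprD; congr (- _).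
rewrite mulr_suml -big_split /= big_seq [RHS]big_seq; apply: eq_bigr => H HA.
rewrite !htermE [(_ * _)%:L / _ * _]mulrA.
have -> : \sum_(w in pst H) (dunkl_coef c H w)%:L * wact w g =
    (ka H)%:L * g + (ev H v')%:L *
     ((\sum_(w in pst H) dunkl_coef c H w * (chi w - 1))%:L * dunklL arr c
       (coroot H) 1).
  rewrite /ka !rmorph_sum /= !mulr_suml mulr_sumr -big_split /=.
  by apply: eq_bigr => w wH; rewrite (gw H w HA wH) !rmorphM; ring.
by rewrite !logformE rmorphM; ring.
Qed.

(** The commutator [B] commutes with linear forms, hence with polynomials and with fractions; so it
    is multiplication by its value at 1, which is zero. *)
Lemma dunklL_commutes c y v psi : param_space c ->
  dunklL arr c y (dunklL arr c v psi) = dunklL arr c v (dunklL arr c y psi).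
Proof.
move=> cP; pose B psi := dunklL arr c y (dunklL arr c v psi)
                       - dunklL arr c v (dunklL arr c y psi).
have Blf xi f : B (lform xi * f) = lform xi * B f.
  rewrite /B !dunklL_lform (raddfD (dunklL arr c y)) (raddfD (dunklL arr c v))
    /=.
  rewrite !dunklL_lform.
  have := dunkl_comm_sym xi y v f cP => /eqP; rewrite subr_eq => /eqP ->; ring.
have BB : zmod_morphism B.
  by move=> f g; rewrite /B !raddfB /= addrACA.
pose Ba : {additive _ -> _} := HB.pack B (GRing.isZmodMorphism.Build _ _ B BB).
have Bp p f : B (polyfrac p * f) = polyfrac p * B f.
  elim/mpoly_var_ind: p f => [a|p q IHp IHq|i p IH] f.
  - by rewrite /B !dunklL_ratC mulrBr.
  - by rewrite polyfracD !mulrDl -IHp -IHq -(raddfD Ba).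
  by rewrite mpolyX_linear_form polyfracM -!mulrA Blf IH.
suff B0 : B psi = 0 by apply/eqP; rewrite -subr_eq0; apply/eqP.
have [p [q [q0 ->]]] := ratfunP psi.
have q0' : polyfrac q != 0 by rewrite polyfrac_eq0.
apply: (mulfI q0'); rewrite -Bp mulrC divfK // -[polyfrac p]mulr1 Bp.
by rewrite /B dunklL_comm_one // subrr !mulr0.
Qed.

End Dunkl.

(** * Differential operators that vanish on the invariants *)

Section DifferentialOperatorsOnInvariants.
Variables (L : fieldType) (W : finGroupType) (act : W -> {rmorphism L -> L}).
Hypothesis act1 : forall f, act 1%g f = f.
Hypothesis actM : forall w u f, act (w * u)%g f = act w (act u f).
Implicit Types (P : L -> L) (f g x : L).

Definition fixed f := forall w, act w f = f.

Definition commul (a : L) P f := P (a * f) - a * P f.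

(** The strict bound lets k = 0 mean P = 0, so that inductions on the order start from a trivial
    case. *)
Fixpoint order_lt k P : Prop :=
  if k is k'.+1 then forall a, order_lt k' (commul a P) else forall f, P f = 0.

Lemma order_lt_mul k g P : order_lt k P -> order_lt k (fun f => g * P f).
Proof.
elim: k P => [|k IH] P /= dP => [f|a]; first by rewrite dP mulr0.
have -> : commul a (fun f => g * P f) = fun f => g * commul a P f.
  by apply/funext => f; rewrite /commul mulrBr mulrCA [g * (a * _)]mulrCA.
exact/IH/dP.
Qed.

Lemma order_ltD k P Q : order_lt k P -> order_lt k Q ->
  order_lt k (fun f => P f + Q f).
Proof.
elim: k P Q => [|k IH] P Q /= dP dQ => [f|a]; first by rewrite dP dQ addr0.
have -> : commul a (fun f => P f + Q f) = fun f => commul a P f + commul a Q f.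
  by apply/funext => f; rewrite /commul mulrDr opprD addrACA.
exact/IH.
Qed.

Lemma order_ltS k P : order_lt k P -> order_lt k.+1 P.
Proof.
elim: k P => [|k IH] P dP; first by move=> a f; rewrite /commul !dP mulr0 subr0.
by move=> a; apply/IH/dP.
Qed.

Lemma order_lt_leq k l P : (k <= l)%N -> order_lt k P -> order_lt l P.
Proof.
move/subnK <- => dP; elim: (l - k)%N => [|j IH] //.
by rewrite addSn; exact: order_ltS.
Qed.

Lemma order_lt_derive (E : {additive L -> L}) k P :
  (forall f g, E (f * g) = E f * g + f * E g) ->
  order_lt k P -> order_lt k.+1 (fun f => E (P f)).
Proof.
move=> EM; elim: k P => [|k IH] P dP.
  by move=> a f; rewrite /commul !dP raddf0 mulr0 subr0.
move=> a.
have -> : commul a (fun f => E (P f)) = fun f => E (commul a P f) + E a * P f.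
  by apply/funext => f; rewrite /commul raddfB EM; ring.
by apply: order_ltD; [exact/IH/dP|exact: order_lt_mul].
Qed.

(* The witness is the product of X - z over the orbit of x. *)
Lemma fixed_separable x : exists g : {poly L},
  [/\ forall i, fixed g`_i, root g x & g^`().[x] != 0].
Proof.
pose s := undup [seq act w x | w <- enum W].
exists (\prod_(z <- s) ('X - z%:P)); split.
- move=> i w; rewrite -coef_map map_prod_XsubC;
  rewrite -(big_map (act w) xpredT (fun z => (_ - z%:P))); congr (_`_i).
  congr polyseq; apply: perm_big; apply: uniq_perm; rewrite ?undup_uniq //.
    by rewrite map_inj_uniq ?undup_uniq //; exact: fmorph_inj.
  have sub u z : z \in s -> act u z \in s.
    rewrite !mem_undup => /mapP[v _ ->]; rewrite -actM.
    by apply/mapP; exists (u * v)%g => //; rewrite mem_enum.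
  move=> z; apply/mapP/idP => [[t ts ->]|zs]; first exact: sub.
  by exists (act w^-1%g z); [exact: sub|rewrite -actM mulgV act1].
- rewrite root_prod_XsubC mem_undup; apply/mapP; exists 1%g; rewrite ?act1 //.
  by rewrite mem_enum.
- have : separable_poly (\prod_(z <- s) ('X - z%:P)).
    by rewrite separable_prod_XsubC undup_uniq.
  rewrite separable_poly.unlock => /coprimep_root; apply.
  rewrite root_prod_XsubC mem_undup; apply/mapP; exists 1%g; rewrite ?act1 //.
  by rewrite mem_enum.
Qed.

(* If [P, x] commutes with x then 0 = [P, g(x)] = g'(x) [P, x]. *)
Lemma commul_sqr_zero P x : zmod_morphism P ->
  (forall a f, fixed a -> P (a * f) = a * P f) ->
  (forall f, commul x (commul x P) f = 0) -> forall f, commul x P f = 0.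
Proof.
move=> PB PK PP f; have [g [gK gx g'x]] := fixed_separable x.
pose Pa : {additive _ -> _} := HB.pack P (GRing.isZmodMorphism.Build _ _ P PB).
have [q qE] : exists q, commul x P f = q by exists (commul x P f).
rewrite qE.
have Px i : P (x ^+ i * f) = x ^+ i * P f + x ^+ i.-1 *+ i * q.
  elim: i => [|i IH]; first by rewrite expr0 !mul1r mulr0n mul0r addr0.
  have Q j : commul x P (x ^+ j * f) = x ^+ j * q.
    elim: j => [|j IHj]; first by rewrite expr0 !mul1r qE.
    have := PP (x ^+ j * f) => /eqP; rewrite {1}/commul subr_eq0 => /eqP.
    by rewrite IHj exprS -!mulrA => ->.
  have := Q i => /eqP; rewrite {1}/commul subr_eq => /eqP.
  rewrite mulrA -exprS => ->; rewrite IH mulrDr mulrA -exprS addrCA;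
    congr (_ + _).
  rewrite mulrA mulrnAr; case: i {IH} => [|i] /=;
    first by rewrite mulr0n mul0r addr0 expr0.
  by rewrite -exprS -mulrDl -mulrS.
have := congr1 (fun t => P (t * f)) (rootP gx);
  have P0 : P 0 = 0 by exact: (raddf0 Pa).
have PS m (G : 'I_m -> L) : P (\sum_i G i) = \sum_i P (G i).
  exact: (raddf_sum Pa).
rewrite mul0r P0 horner_coef mulr_suml PS.
under eq_bigr => i _ do rewrite -mulrA (PK _ _ (gK i)) Px mulrDr mulrA.
rewrite big_split /= -mulr_suml -horner_coef (rootP gx) mul0r add0r.
under eq_bigr do rewrite mulrA.
rewrite -mulr_suml => /eqP; rewrite mulf_eq0 => /orP[|/eqP //].
suff -> : \sum_(i < size g) g`_i * (x ^+ i.-1 *+ i)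
  = g^`().[x] by rewrite (negPf g'x).
rewrite -[X in X^`()]coefK poly_def raddf_sum horner_sum; apply: eq_bigr => i _.
by rewrite /= linearZ /= derivXn hornerZ hornerMn hornerXn.
Qed.

Lemma commul_is_zmod_morphism x P : zmod_morphism P ->
  zmod_morphism (commul x P).
Proof. by move=> PB f g; rewrite /commul mulrBr !PB; ring. Qed.

(** Taking the commutator with [x] lowers the order, so by induction [commul x P] commutes with [x],
    and [commul_sqr_zero] applies. *)
Lemma order_lt_commul_zero k P x : zmod_morphism P ->
  (forall a f, fixed a -> P (a * f) = a * P f) -> order_lt k.+1 P ->
  forall f, commul x P f = 0.
Proof.
elim: k P => [|k IH] P PB PK dP; first exact: dP.
apply: commul_sqr_zero => //; apply: IH (dP x);
  first exact: commul_is_zmod_morphism.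
by move=> a f aK; rewrite /commul [x * (a * f)]mulrCA !(PK a) //; ring.
Qed.

(** For an invariant a, [commul a P] has lower order and kills the invariants, so it vanishes by
    induction: P is linear over the invariants. Hence P commutes with all functions and is
    multiplication by P 1 = 0. *)
Lemma order_lt_fixed_zero k P : zmod_morphism P -> order_lt k P ->
  (forall f, fixed f -> P f = 0) -> forall f, P f = 0.
Proof.
elim: k P => [|k IH] P PB dP P0; first exact: dP.
have PK a f : fixed a -> P (a * f) = a * P f.
  move=> aK; apply/eqP; rewrite -subr_eq0; apply/eqP; move: f.
  apply: (IH (commul a P)); [exact: commul_is_zmod_morphism|exact: dP|move=>
    f fK].
  by rewrite /commul !P0 ?mulr0 ?subr0 // => w; rewrite rmorphM aK fK.
move=> f; have := order_lt_commul_zero f PB PK dP 1; rewrite /commul mulr1.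
by rewrite (P0 1) ?mulr0 ?subr0 // => w; rewrite rmorph1.
Qed.

End DifferentialOperatorsOnInvariants.

(** * Monomials in commuting operators *)

Section MonomialOperators.
Variables (T : Type) (n : nat) (f : 'I_n -> T -> T).
Hypothesis fC : forall i j x, f i (f j x) = f j (f i x).

(** Written with the same iterated composition as in [dunkl_poly], so that the two can be compared
    factor by factor. *)
Definition monop (m : 'X_{1..n}) : T -> T :=
  \big[comp/idfun]_(i < n) iter (m i) (comp (f i)) idfun.

Lemma iter_compE (g : T -> T) k x : iter k (comp g) idfun x = iter k g x.
Proof. by elim: k => //= k ->. Qed.

Lemma monop0 x : monop 0%MM x = x.
Proof.
rewrite /monop; elim/big_rec: _ => //= i g _ E.
by rewrite E mnm0E.
Qed.

Lemma monopS i m x : monop (U_(i) + m)%MM x = f i (monop m x).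
Proof.
rewrite /monop; set r := index_enum _.
have comm (s : seq 'I_n) y : f i
  ((\big[comp/idfun]_(j <- s) iter (m j) (comp (f j)) idfun) y)
    = (\big[comp/idfun]_(j <- s) iter (m j) (comp (f j)) idfun) (f i y).
  elim: s y => [|j s IH] y; first by rewrite !big_nil.
  rewrite !big_cons /= !iter_compE -IH.
  by elim: (m j) => //= k <-.
have : i \in r by rewrite mem_index_enum.
have : uniq r by rewrite index_enum_uniq.
elim: r x => // j s IH x /=; rewrite inE !big_cons /= !iter_compE =>
  /andP[js us].
have out (y : T) : i \notin s ->
    (\big[comp/idfun]_(j <- s) iter ((U_(i) + m)%MM j) (comp (f j)) idfun) y
    = (\big[comp/idfun]_(j <- s) iter (m j) (comp (f j)) idfun) y.
  move=> ns; congr (_ y); apply: eq_big_seq => k ks.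
  rewrite mnmDE mnm1E; suff -> : (i == k) = false by [].
  by apply: contraNF ns => /eqP ->.
case/orP => [/eqP E|si].
  by rewrite E in out *; rewrite out // mnmDE mnm1E eqxx.
rewrite IH // mnmDE mnm1E; suff -> : (i == j) = false.
  by rewrite add0n; elim: (m j) => //= k ->.
by apply: contraNF js => /eqP <-.
Qed.

End MonomialOperators.

(** * Normal forms of operators restricted to the invariants *)

Section NormalForms.
Variables (F : numFieldType) (n : nat) (W : finGroupType).
Variable rho : mx_representation F [set: W]%G n.
Variable alpha : {vspace 'cV[F]_n} -> 'rV[F]_n.
Hypothesis alphaP : defining_forms rho alpha.
Implicit Types (H : {vspace 'cV[F]_n}) (y v : 'cV[F]_n) (w u : W).
Implicit Types (psi phi f : ratfun F n) (c : param rho).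
Implicit Types (P Q Z : ratfun F n -> ratfun F n) (m : 'X_{1..n}).
Implicit Types (A : ratfun F n -> Prop).

Local Notation L := (ratfun F n).
Local Notation arr := (arrangement rho).
Local Notation pst := (pstab rho).
Local Notation "c %:L" := (ratC n c) (at level 2, format "c %:L").
Local Notation wact := (wact rho).
Local Notation logform := (logform alpha).
Local Notation hterm := (hterm alpha).
Local Notation dunklL := (dunklL alpha).

Definition winv phi := forall w, wact w phi = phi.

(* Additive span of a set of maps, with maps identified when they agree on
   the W-invariants. *)
Inductive aspan (G : (L -> L) -> Prop) : (L -> L) -> Prop :=
| aspan_nil P : (forall phi, winv phi -> P phi = 0) -> aspan G P
| aspan_cons Q P' P : G Q -> aspan G P' ->
    (forall phi, winv phi -> P phi = Q phi + P' phi) -> aspan G P.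

Lemma aspan_eq G P Q : (forall phi, winv phi -> P phi = Q phi) ->
  aspan G P -> aspan G Q.
Proof.
move=> PQ sP; case: sP PQ => {}P.
  by move=> P0 PQ; apply: aspan_nil => phi Kphi; rewrite -PQ // P0.
move=> P' Q' GP sQ E PQ; apply: (aspan_cons GP sQ) => phi Kphi.
by rewrite -PQ // E.
Qed.

Lemma aspan_gen (G : (L -> L) -> Prop) P : G P -> aspan G P.
Proof.
move=> GP; apply: (aspan_cons GP (@aspan_nil G (fun=> 0) _)) => // phi _.
by rewrite addr0.
Qed.

Lemma aspanD G P Q : aspan G P -> aspan G Q ->
  aspan G (fun phi => P phi + Q phi).
Proof.
move=> sP sQ; elim: sP => {P} [P P0|R P' P GR _ IH E].
  by apply: aspan_eq sQ => phi Kphi; rewrite P0 // add0r.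
by apply: (aspan_cons GR IH) => phi Kphi; rewrite E // addrA.
Qed.

Lemma aspan_sum G (I : Type) (r : seq I) (p : pred I) (P : I -> L -> L) :
  (forall i, p i -> aspan G (P i)) ->
  aspan G (fun phi => \sum_(i <- r | p i) P i phi).
Proof.
move=> sP; elim: r => [|i r IH].
  by apply: aspan_nil => phi _; rewrite big_nil.
case pi: (p i); last by apply: aspan_eq IH => phi _; rewrite big_cons pi.
by apply: aspan_eq (aspanD (sP _ pi) IH) => phi _; rewrite big_cons pi.
Qed.

Lemma aspan_map (G G' : (L -> L) -> Prop) (Z : {additive L -> L}) P :
  (forall Q, G Q -> aspan G' (fun phi => Z (Q phi))) ->
  aspan G P -> aspan G' (fun phi => Z (P phi)).
Proof.
move=> GZ; elim=> {P} [P P0|Q P' P GQ _ IH E].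
  by apply: aspan_nil => phi Kphi; rewrite P0 // raddf0.
by apply: aspan_eq (aspanD (GZ _ GQ) IH) => phi Kphi; rewrite E // raddfD.
Qed.

Lemma aspan_mono (G G' : (L -> L) -> Prop) P :
  (forall Q, G Q -> G' Q) -> aspan G P -> aspan G' P.
Proof. by move=> GG; apply: (aspan_map (Z := idfun)) => Q /GG;
  exact: aspan_gen. Qed.

Lemma aspan_mul (G G' : (L -> L) -> Prop) f P :
  (forall Q, G Q -> G' (fun phi => f * Q phi)) ->
  aspan G P -> aspan G' (fun phi => f * P phi).
Proof.
move=> GG; elim=> {P} [P P0|Q P' P GQ _ IH E].
  by apply: aspan_nil => phi Kphi; rewrite P0 // mulr0.
by apply: aspan_cons (GG _ GQ) IH _ => phi Kphi; rewrite E // mulrDr.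
Qed.

Definition coefring A := [/\ forall a : F, A a%:L,
  forall f g, A f -> A g -> A (f + g) & forall f g, A f -> A g -> A (f * g)].

Lemma coefring0 A : coefring A -> A 0.
Proof. by case=> AC _ _; have := AC 0; rewrite rmorph0. Qed.

Lemma coefring1 A : coefring A -> A 1.
Proof. by case=> AC _ _; have := AC 1; rewrite rmorph1. Qed.

Lemma coefring_sum A (I : Type) (r : seq I) (p : pred I) (f : I -> L) :
  coefring A -> (forall i, p i -> A (f i)) -> A (\sum_(i <- r | p i) f i).
Proof.
move=> AR Af; elim/big_rec: _ => [|i g pi Ag]; first exact: coefring0.
by case: AR => _ AD _; exact/AD/Ag/Af.
Qed.

Lemma coefringN A f : coefring A -> A f -> A (- f).
Proof.
case=> AC _ AM Af; have -> : - f = (-1)%:L * f by rewrite rmorphN1 mulN1r.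
exact/AM/Af/AC.
Qed.

Definition constants f := exists a : F, f = a%:L.

Lemma constants_ring : coefring constants.
Proof.
split=> [a|_ _ [a ->] [b ->]|_ _ [a ->] [b ->]]; first by exists a.
  by exists (a + b); rewrite rmorphD.
by exists (a * b); rewrite rmorphM.
Qed.

Definition dunkl_mon c (m : 'X_{1..n}) : L -> L :=
  monop (fun i => dunklL arr c (delta_mx i 0)) m.

Lemma dunkl_monE c m psi :
  dunkl_mon c m psi = monop (fun i => dunklL arr c (delta_mx i 0)) m psi.
Proof. by []. Qed.

Lemma dunkl_mon0 c psi : dunkl_mon c 0%MM psi = psi.
Proof. exact: monop0. Qed.

Lemma dunkl_monS c i m psi : param_space c ->
  dunkl_mon c (U_(i) + m)%MM psi
    = dunklL arr c (delta_mx i 0) (dunkl_mon c m psi).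
Proof. by move=> cP; apply: monopS => j k f; exact: dunklL_commutes. Qed.

Lemma dunkl_mon_is_zmod_morphism c m : param_space c ->
  zmod_morphism (dunkl_mon c m).
Proof.
move=> cP f g; elim/mnm_ind: m => [|i m IH]; first by rewrite !dunkl_mon0.
by rewrite !dunkl_monS // IH raddfB.
Qed.

(** The ring [A] keeps track of the poles of the coefficients, and k of the order. *)
Definition dspan_generator A c k Q := exists f m,
  [/\ A f, (mdeg m < k)%N & Q = fun phi => f * dunkl_mon c m phi].

Definition dspan A c k := aspan (dspan_generator A c k).

Lemma dspan_mono A A' c k k' P : (forall f, A f -> A' f) -> (k <= k')%N ->
  dspan A c k P -> dspan A' c k' P.
Proof.
move=> AA kk; apply: aspan_mono => _ [f [m [Af mk ->]]].
by exists f, m; split=> //; [exact: AA|exact: leq_trans kk].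
Qed.

Lemma dspan_mul A c k f P : coefring A -> A f -> dspan A c k P ->
  dspan A c k (fun phi => f * P phi).
Proof.
move=> [_ _ AM] Af; apply: aspan_mul => _ [g [m [Ag mk ->]]].
exists (f * g), m; split=> //; first exact: AM.
by apply/funext => phi; rewrite mulrA.
Qed.

Lemma dspan_dunkl_mon A c m k : coefring A -> (mdeg m < k)%N ->
  dspan A c k (dunkl_mon c m).
Proof.
move=> AR mk; apply: aspan_gen; exists 1, m; split=> //.
  exact: coefring1.
by apply/funext => phi; rewrite mul1r.
Qed.

Lemma dspan_dunkl_dunkl_mon A c y m : param_space c -> coefring A ->
  dspan A c (mdeg m).+2 (fun phi => dunklL arr c y (dunkl_mon c m phi)).
Proof.
move=> cP AR; have [AC _ _] := AR.
apply: (aspan_eq (P := fun phi =>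
  \sum_i (y i 0)%:L * dunkl_mon c (U_(i) + m)%MM phi)).
  by move=> phi _; rewrite [RHS]dunklL_basis; apply: eq_bigr => i _;
    rewrite dunkl_monS.
apply: aspan_sum => i _; apply: dspan_mul => //; apply: dspan_dunkl_mon => //.
by rewrite mdegD mdeg1.
Qed.

Lemma dspan_constants_dunkl c y k P : param_space c ->
  dspan constants c k P -> dspan constants c k.+1
    (fun phi => dunklL arr c y (P phi)).
Proof.
move=> cP; apply: aspan_map => _ [f [m [[a ->] mk ->]]].
apply: (aspan_eq (P := fun phi => a%:L * dunklL arr c y (dunkl_mon c m phi))).
  by move=> phi _; rewrite /= dunklL_ratC.
apply: dspan_mul; [exact: constants_ring|by exists a|].
by apply: dspan_mono (dspan_dunkl_dunkl_mon y m cP constants_ring).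
Qed.

(** Moving w to the right only rotates the directions of the Dunkl operators. The induction runs
    over [constants], because constants commute with Dunkl operators. *)
Lemma dspan_act_dunkl_mon A c w m : param_space c -> coefring A ->
  dspan A c (mdeg m).+1 (fun phi => wact w (dunkl_mon c m phi)).
Proof.
move=> cP AR; apply: (@dspan_mono constants _ _ (mdeg m).+1) => //.
  by case: AR => AC _ _ _ [a ->].
elim/mnm_ind: m => [|i m IH].
  apply: aspan_eq (dspan_dunkl_mon c constants_ring (ltnSn (mdeg 0%MM))).
  by move=> phi Kphi; rewrite !dunkl_mon0 Kphi.
rewrite mdegD mdeg1; apply: aspan_eq
  (dspan_constants_dunkl (rho w *m delta_mx i 0) cP IH).
by move=> phi Kphi; rewrite /= dunkl_monS // dunklL_wact.
Qed.

Lemma dspan_act A c w k P : param_space c -> coefring A ->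
  (forall f, A f -> A (wact w f)) -> dspan A c k P ->
  dspan A c k (fun phi => wact w (P phi)).
Proof.
move=> cP AR Aw; apply: aspan_map => _ [f [m [Af mk ->]]].
apply: (aspan_eq (P := fun phi => wact w f * wact w (dunkl_mon c m phi))).
  by move=> phi _; rewrite /= rmorphM.
by apply: dspan_mul; [|exact: Aw|exact: dspan_mono
  (dspan_act_dunkl_mon w m cP AR)].
Qed.

(** A Dunkl operator for another parameter, or for W_H alone, differs from y_c by group elements,
    and these do not raise the degree of a monomial. So only the coefficients have to be controlled:
    those of the difference, and those of the commutators with functions in [A]. *)
Lemma dspan_close A c k (Z : {additive L -> L}) y (g : W -> L) P :
  param_space c -> coefring A -> (forall w, A (g w)) ->
  (forall psi, Z psi = dunklL arr c y psi + \sum_w g w * wact w psi) ->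
  (forall f, A f -> exists2 h : W -> L, forall w, A (h w) &
     forall psi, Z (f * psi) = f * Z psi + \sum_w h w * wact w psi) ->
  dspan A c k P -> dspan A c k.+1 (fun phi => Z (P phi)).
Proof.
move=> cP AR Ag Zg Zf; apply: aspan_map => _ [f [m [Af mk ->]]].
have [h Ah Zh] := Zf _ Af.
have S (g' : W -> L) : (forall w, A (g' w)) ->
    dspan A c k.+1 (fun phi => \sum_w g' w * wact w (dunkl_mon c m phi)).
  move=> Ag'; apply: aspan_sum => w _; apply: dspan_mul => //.
  by apply: dspan_mono (dspan_act_dunkl_mon w m cP AR) => //; exact: ltnW.
apply: (aspan_eq (P := fun phi => f * (dunklL arr c y (dunkl_mon c m phi)
    + \sum_w g w * wact w (dunkl_mon c m phi))
      + \sum_w h w * wact w (dunkl_mon c m phi))).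
  by move=> phi _; rewrite Zh Zg.
apply: aspanD; last exact: S.
apply: dspan_mul => //; apply: aspanD; last exact: S.
by apply: dspan_mono (dspan_dunkl_dunkl_mon y m cP AR).
Qed.

Lemma hterm_mul c H y f psi : hterm c H y (f * psi) = f * hterm c H y psi
  + \sum_(w in pst H) (dunkl_coef c H w)%:L * (logform H y * (wact w f - f)) *
    wact w psi.
Proof.
rewrite !htermE !mulr_sumr -big_split; apply: eq_bigr => w _ /=.
by rewrite rmorphM /=; ring.
Qed.

Lemma dunklL_mul_comm A S c y f : coefring A -> A (rderive y f) ->
  (forall H w, H \in S -> w \in pst H -> A (logform H y * (wact w f - f))) ->
  exists2 h : W -> L, forall w, A (h w) & forall psi,
    dunklL S c y (f * psi) = f * dunklL S c y psi + \sum_w h w * wact w psi.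
Proof.
move=> AR Adf Alog; have [AC AD AM] := AR.
(* The ordinary derivative contributes at w = 1 only; every H in [S] that w fixes pointwise
   contributes a difference quotient of f. *)
exists (fun w => (w == 1%g)%:R%:L * rderive y f - \sum_(H <- S | w \in pst H)
                  (dunkl_coef c H w)%:L * (logform H y * (wact w f - f))).
  move=> w; apply: (AD); first by apply: AM.
  apply: coefringN => //; rewrite big_seq_cond;
    apply: coefring_sum => // H /andP[HS wH].
  by apply: (AM) => //; exact: Alog.
move=> psi; rewrite !dunklLE rderiveM.
under [X in _ = _ + X]eq_bigr do rewrite mulrBl.
rewrite sumrB [X in _ = _ + (X - _)](bigD1 1%g) //= eqxx rmorph1 mul1r wact1.
rewrite [X in _ = _ + (_ + X - _)]big1 ?addr0; last first.
  by move=> w w1; rewrite (negPf w1) rmorph0 !mul0r.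
have -> : \sum_w (\sum_(H <- S | w \in pst H) (dunkl_coef c H w)%:L *
  (logform H y * (wact w f - f)))
    * wact w psi = \sum_(H <- S) (hterm c H y (f * psi) - f * hterm c H y psi).
  under eq_bigr do rewrite mulr_suml.
  rewrite (exchange_big_dep xpredT) //=; apply: eq_bigr => H _.
  by rewrite hterm_mul addrC addKr.
by rewrite sumrB -mulr_sumr; ring.
Qed.

Lemma dunklL_change A c c' y : coefring A ->
  (forall H, H \in arr -> A (logform H y)) ->
  exists2 g : W -> L, forall w, A (g w) & forall psi,
    dunklL arr c' y psi = dunklL arr c y psi + \sum_w g w * wact w psi.
Proof.
move=> AR Alog; have [AC AD AM] := AR.
exists (fun w => \sum_(H <- arr | w \in pst H)
                  (dunkl_coef c H w - dunkl_coef c' H w)%:L * logform H y).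
  move=> w; rewrite big_seq_cond; apply: coefring_sum => // H /andP[HS wH].
  by apply: (AM) => //; exact: Alog.
move=> psi; rewrite !dunklLE.
under [X in _ = _ + X]eq_bigr do rewrite mulr_suml.
rewrite (exchange_big_dep xpredT) //= -addrA; congr (_ + _).
rewrite -!sumrN -big_split /=; apply: eq_bigr => H _.
rewrite !htermE !mulr_sumr -!sumrN -big_split; apply: eq_bigr => w _ /=.
by rewrite rmorphB; ring.
Qed.

End NormalForms.

(** * Uniqueness of normal forms *)

Lemma lem_mdeg_eq n (m k : 'X_{1..n}) :
  (m <= k)%MM -> (mdeg k <= mdeg m)%N -> m = k.
Proof.
move=> le_mk; have E := submK le_mk; rewrite -{1}E mdegD.
rewrite -{2}[mdeg m]add0n leq_add2r leqn0 mdeg_eq0 => /eqP E0.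
by rewrite -E E0 add0m.
Qed.

(** The polynomial [s] is the full symbol of a normal form: its coefficients are rational functions,
    kept to the left of the Dunkl operators. *)
HB.lock Definition symop (F : numFieldType) (n : nat) (W : finGroupType)
    (rho : mx_representation F [set: W]%G n)
    (alpha : {vspace 'cV[F]_n} -> 'rV[F]_n)
    (c : param rho) (s : {mpoly (ratfun F n)[n]}) (psi : ratfun F n) :
    ratfun F n :=
  \sum_(m <- msupp s) s@_m * dunkl_mon alpha c m psi.

Section Uniqueness.
Variables (F : numFieldType) (n : nat) (W : finGroupType).
Variable rho : mx_representation F [set: W]%G n.
Variable alpha : {vspace 'cV[F]_n} -> 'rV[F]_n.
Hypothesis alphaP : defining_forms rho alpha.
Implicit Types (H : {vspace 'cV[F]_n}) (y v : 'cV[F]_n) (w u : W).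
Implicit Types (psi phi f : ratfun F n) (c : param rho).
Implicit Types (P Q Z : ratfun F n -> ratfun F n) (m : 'X_{1..n}).
Implicit Types (A : ratfun F n -> Prop).

Local Notation L := (ratfun F n).
Local Notation arr := (arrangement rho).
Local Notation pst := (pstab rho).
Local Notation "c %:L" := (ratC n c) (at level 2, format "c %:L").
Local Notation wact := (wact rho).
Local Notation logform := (logform alpha).
Local Notation hterm := (hterm alpha).
Local Notation dunklL := (dunklL alpha).

Local Notation winv := (winv rho).
Local Notation dunkl_mon := (dunkl_mon alpha).
Local Notation dspan := (dspan alpha).

Local Notation symop := (symop alpha).

Lemma symopE c s psi : symop c s psi
  = \sum_(m <- msupp s) s@_m * dunkl_mon c m psi.
Proof. by rewrite symop.unlock. Qed.

Lemma symopwE c k s psi : (msize s <= k)%N ->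
  symop c s psi = \sum_(m : 'X_{1..n < k}) s@_m * dunkl_mon c m psi.
Proof.
move=> le_sk; pose I : subFinType _ := 'X_{1..n < k}.
rewrite !symopE (big_mksub I) ?msupp_uniq //=; first last.
  by move=> x /msize_mdeg_lt /leq_trans; apply.
by rewrite big_rmcond //= => j /memN_msupp_eq0 ->; rewrite mul0r.
Qed.

Lemma symopD c s t psi : symop c (s + t) psi = symop c s psi + symop c t psi.
Proof.
pose k := maxn (msize s) (msize t).
rewrite !(@symopwE c k) ?leq_maxl ?leq_maxr ?mmeasureD_le // -big_split.
by apply: eq_bigr => m _; rewrite mcoeffD mulrDl.
Qed.

Lemma symopZ c f s psi : symop c (f *: s) psi = f * symop c s psi.
Proof.
rewrite !(@symopwE c (msize s)) ?msizeZ_le // mulr_sumr.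
by apply: eq_bigr => m _; rewrite mcoeffZ mulrA.
Qed.

Lemma symopB c s t psi : symop c (s - t) psi = symop c s psi - symop c t psi.
Proof. by rewrite symopD -scaleN1r symopZ mulN1r. Qed.

Lemma symopX c m psi : symop c 'X_[m] psi = dunkl_mon c m psi.
Proof. by rewrite !symopE msuppX big_seq1 mcoeffX eqxx mul1r. Qed.

Lemma symop0 c psi : symop c 0 psi = 0.
Proof. by rewrite !symopE msupp0 big_nil. Qed.

Lemma symop_is_zmod_morphism c s : param_space c -> zmod_morphism (symop c s).
Proof.
move=> cP f g; rewrite !symopE -sumrB; apply: eq_bigr => m _.
by rewrite -mulrBr dunkl_mon_is_zmod_morphism.
Qed.

Lemma dspan_symop A c k P : coefring A -> dspan A c k P ->
  exists s : {mpoly L[n]},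
  [/\ forall m, A s@_m, (msize s <= k)%N & forall phi, winv phi ->
    P phi = symop c s phi].
Proof.
move=> AR; have [_ AD AM] := AR; elim=> {P} [P P0|Q P' P [f [m [Af mk ->]]] _].
  exists 0; split=> [m||phi Kphi]; rewrite ?mmeasure0 //.
    by rewrite mcoeff0; exact: coefring0.
  by rewrite symop0 P0.
case=> s [As sk E] EP; exists (f *: 'X_[m] + s); split=> [m'||phi Kphi].
- rewrite mcoeffD mcoeffZ mcoeffX; apply: (AD) => //; apply: (AM) => //.
  by case: (m == m'); [exact: coefring1|exact: coefring0].
- apply: leq_trans (mmeasureD_le _ _ _) _; rewrite geq_max sk andbT.
  by apply: leq_trans (msizeZ_le _ _) _; rewrite msizeX.
- by rewrite symopD symopZ symopX EP // E.
Qed.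

Lemma symop_dspan A c s : coefring A -> (forall m, A s@_m) ->
  dspan A c (msize s) (symop c s).
Proof.
move=> AR As.
apply: (aspan_eq (P := fun phi =>
  \sum_(m <- msupp s | m \in msupp s) s@_m * dunkl_mon c m phi)).
  by move=> phi _; rewrite !symopE -big_seq.
apply: aspan_sum => m ms; apply: dspan_mul => //; apply: dspan_dunkl_mon => //.
exact: msize_mdeg_lt.
Qed.

Definition zero_param : param rho := fun _ _ => 0.

Lemma zero_param_space : param_space zero_param.
Proof. by []. Qed.

Lemma dunklL_zero y psi : dunklL arr zero_param y psi = rderive y psi.
Proof.
rewrite dunklLE big1 ?subr0 // => H _; rewrite htermE big1 ?mulr0 // => w _.
by rewrite /dunkl_coef big1 ?rmorph0 ?mul0r // => j _; rewrite mul0r.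
Qed.

Lemma dunkl_mon_zero_poly m p : dunkl_mon zero_param m (polyfrac p)
  = polyfrac p^`M[m].
Proof.
elim/mnm_ind: m => [|i m IH]; first by rewrite dunkl_mon0 mderivm0m.
rewrite dunkl_monS ?zero_param_space // IH dunklL_zero rderive_poly addmC
  mderivmDm mderivmU1m.
congr polyfrac; rewrite /pderive (bigD1 i) //= mxE !eqxx scale1r big1 ?addr0 //
  => j ji.
by rewrite mxE (negPf ji) scale0r.
Qed.

Lemma dunkl_mon_zero_order_lt m : order_lt (mdeg m).+1 (dunkl_mon zero_param m).
Proof.
elim/mnm_ind: m => [|i m IH].
  by rewrite mdeg0 => a f; rewrite /commul !dunkl_mon0 subrr.
have -> : dunkl_mon zero_param (U_(i) + m)%MM
    = fun f => rderive (delta_mx i 0) (dunkl_mon zero_param m f).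
  by apply/funext => f; rewrite dunkl_monS ?zero_param_space // dunklL_zero.
by rewrite mdegD mdeg1; apply: order_lt_derive IH => f g; exact: rderiveM.
Qed.

Lemma symop_zero_order_lt s : order_lt (msize s) (symop zero_param s).
Proof.
have -> : symop zero_param s = fun f =>
  \sum_(m <- msupp s) s@_m * dunkl_mon zero_param m f.
  by apply/funext => f; rewrite symopE.
suff S r : {subset r <= msupp s} ->
    order_lt (msize s) (fun f => \sum_(m <- r) s@_m * dunkl_mon zero_param m f)
      by exact: S.
elim: r => [_|m r IH ms].
  apply: (@order_lt_leq _ 0) => // f; exact: big_nil.
have -> : (fun f => \sum_(i <- m :: r) s@_i * dunkl_mon zero_param i f)
    = fun f => s@_m * dunkl_mon zero_param m f
      + \sum_(i <- r) s@_i * dunkl_mon zero_param i f.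
  by apply/funext => f; rewrite big_cons.
apply: order_ltD; last by apply: IH => i ir; apply: ms; rewrite inE ir orbT.
apply: order_lt_mul; apply: order_lt_leq (dunkl_mon_zero_order_lt m).
by apply: msize_mdeg_lt; apply: ms; rewrite inE eqxx.
Qed.

Lemma symop_zero_uniq s : (forall phi, winv phi -> symop zero_param s phi = 0)
  -> s = 0.
Proof.
move=> s0; have {}s0 phi : symop zero_param s phi = 0.
  move: phi; apply: (@order_lt_fixed_zero _ _ (fun w => wact w) _ _ (msize s))
    => //.
  - exact: wact1.
  - exact: wactM.
  - exact/symop_is_zmod_morphism/zero_param_space.
  - exact: symop_zero_order_lt.
apply/mpolyP => k; rewrite mcoeff0; have [d] := ubnP (mdeg k).
elim: d k => // d IH k kd.
(* On X^k only the term m = k survives: coefficients in smaller degree vanish by induction, and any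
   other m exceeds k at some variable. The factor left over is a product of factorials. *)
have := s0 (polyfrac 'X_[k]).
rewrite (@symopwE _ (maxn (msize s) (mdeg k).+1)) ?leq_maxl //.
pose bk : 'X_{1..n < maxn (msize s) (mdeg k).+1} := BMultinom
  (leq_maxr (msize s) (mdeg k).+1).
rewrite (bigD1 bk) //= big1 ?addr0 => [|m mk].
  rewrite dunkl_mon_zero_poly mderivmX => /eqP;
    rewrite mulf_eq0 => /orP[/eqP //|].
  rewrite polyfrac_eq0 -mul_mpolyC mulf_eq0 mpolyC_eq0 pnatr_eq0.
  case/orP; last by rewrite -(mmeasure_poly_eq0 mdeg) msizeX.
  rewrite prod_nat_seq_eq0 => /hasP[i _]; rewrite /= ffactnn => /eqP E.
  by have := fact_gt0 (k i); rewrite E.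
have [mk'|km] := ltnP (mdeg m) (mdeg k).
  by rewrite IH ?mul0r // (leq_trans mk').
have /existsP[i ki] : [exists i, k i < m i]%N.
  apply: contraNT mk; rewrite negb_exists => /forallP E.
  have le_mk : (m <= k)%MM by apply/mnm_lepP => i; rewrite leqNgt E.
  by apply/eqP/val_inj; exact: lem_mdeg_eq.
rewrite dunkl_mon_zero_poly mderivmX (bigD1 i) //= ffact_small // mul0n scale0r.
by rewrite rmorph0 mulr0.
Qed.

Lemma coefring_all : coefring (fun _ : L => True).
Proof. by []. Qed.

Lemma dunklL_close_all c c' y k P : param_space c ->
  dspan (fun _ : L => True) c k P ->
    dspan (fun _ : L => True) c k.+1 (fun phi => dunklL arr c' y (P phi)).
Proof.
move=> cP; have [g _ gE] := dunklL_change (alpha := alpha) c c' (y := y)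
  coefring_all (fun _ _ => I).
have hE f : True -> exists2 h : W -> L, W -> True & forall psi,
    dunklL arr c' y (f * psi) = f * dunklL arr c' y psi
      + \sum_w h w * wact w psi.
  by move=> _; exact: (dunklL_mul_comm (A := fun _ : L => True)).
exact: (dspan_close (Z := dunklL arr c' y) alphaP cP coefring_all (fun=> I) gE
  hE).
Qed.

(** The leading terms agree, which bounds the degree strictly; nothing is claimed here about the
    poles of the coefficients. *)
Lemma dunkl_mon_change c c' m : param_space c -> param_space c' ->
  dspan (fun _ : L => True) c (mdeg m)
    (fun phi => dunkl_mon c' m phi - dunkl_mon c m phi).
Proof.
move=> cP cP'; elim/mnm_ind: m => [|i m IH].
  by apply: aspan_nil => phi _; rewrite !dunkl_mon0 subrr.
have [g _ gE] := dunklL_change (alpha := alpha) c c' (y := delta_mx i 0)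
  coefring_all (fun _ _ => I).
rewrite mdegD mdeg1.
apply: (aspan_eq (P := fun phi =>
  dunklL arr c' (delta_mx i 0) (dunkl_mon c' m phi - dunkl_mon c m phi)
  + \sum_w g w * wact w (dunkl_mon c m phi))).
  by move=> phi _; rewrite !dunkl_monS // raddfB /= [X in _ - X + _]gE; ring.
apply: aspanD; first exact: dunklL_close_all.
apply: aspan_sum => w _; apply: dspan_mul => //.
exact: dspan_act_dunkl_mon.
Qed.

(** Rewriting the operator for the parameter 0 adds to s a symbol t of smaller size. If the operator
    kills the invariants then t + s = 0, which is impossible for nonzero s. *)
Lemma symop_uniq c s : param_space c ->
  (forall phi, winv phi -> symop c s phi = 0) -> s = 0.
Proof.
move=> cP s0; have zP := zero_param_space.
have : dspan (fun _ : L => True) zero_param (msize s).-1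
    (fun phi => symop c s phi - symop zero_param s phi).
  apply: (aspan_eq (P := fun phi => \sum_(m <- msupp s | m \in msupp s)
      s@_m * (dunkl_mon c m phi - dunkl_mon zero_param m phi))).
    by move=> phi _; rewrite -big_seq !symopE -sumrB; apply: eq_bigr => m _;
      rewrite mulrBr.
  apply: aspan_sum => m ms; apply: dspan_mul => //;
    apply: dspan_mono (dunkl_mon_change m zP cP) => //.
  by rewrite -ltnS prednK ?msize_mdeg_lt //
    (leq_ltn_trans _ (msize_mdeg_lt ms)).
case/(dspan_symop coefring_all) => t [_ tk tE].
have st : t + s = 0.
  by apply: symop_zero_uniq => phi Kphi;
    rewrite symopD -tE // s0 // sub0r addNr.
apply/eqP; rewrite -(mmeasure_poly_eq0 mdeg) -leqn0 leqNgt; apply/negP => s_gt0.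
have : (msize t < msize s)%N by rewrite (leq_ltn_trans tk) // prednK.
by rewrite -[s](addKr t) st addr0 mmeasureN ltnn.
Qed.

Lemma symop_inj c s t : param_space c ->
  (forall phi, winv phi -> symop c s phi = symop c t phi) -> s = t.
Proof.
move=> cP E; apply/eqP; rewrite -subr_eq0; apply/eqP;
  apply: (symop_uniq cP) => phi Kphi.
by rewrite symopB E // subrr.
Qed.

End Uniqueness.

(** * Coefficient rings: polynomials, the local ring at H, poles along the arrangement *)

Section CoefficientRings.
Variables (F : numFieldType) (n : nat) (W : finGroupType).
Variable rho : mx_representation F [set: W]%G n.
Variable alpha : {vspace 'cV[F]_n} -> 'rV[F]_n.
Hypothesis alphaP : defining_forms rho alpha.
Implicit Types (H : {vspace 'cV[F]_n}) (y v : 'cV[F]_n) (w u : W).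
Implicit Types (psi phi f : ratfun F n) (c : param rho).
Implicit Types (P Q Z : ratfun F n -> ratfun F n) (m : 'X_{1..n}).
Implicit Types (A : ratfun F n -> Prop).

Local Notation L := (ratfun F n).
Local Notation arr := (arrangement rho).
Local Notation pst := (pstab rho).
Local Notation "c %:L" := (ratC n c) (at level 2, format "c %:L").
Local Notation wact := (wact rho).
Local Notation logform := (logform alpha).
Local Notation hterm := (hterm alpha).
Local Notation dunklL := (dunklL alpha).

Local Notation winv := (winv rho).

Definition polyring f := exists p, f = polyfrac p.

Lemma polyring_coefring : coefring polyring.
Proof.
split=> [a|_ _ [p ->] [q ->]|_ _ [p ->] [q ->]]; first by exists a%:MP.
  by exists (p + q); rewrite polyfracD.
by exists (p * q); rewrite polyfracM.
Qed.

Lemma polyring_derive y f : polyring f -> polyring (rderive y f).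
Proof. by case=> p ->; exists (pderive y p); rewrite rderive_poly. Qed.

Lemma polyring_wact w f : polyring f -> polyring (wact w f).
Proof. by case=> p ->; exists (psubst (rho w^-1%g) p); rewrite wact_poly. Qed.

Section Hyperplane.
Variable H : {vspace 'cV[F]_n}.
Hypothesis HA : H \in arr.

Local Notation lin := (linear_form (alpha H)).

(** The projection onto H along the coroot. Substituting it restricts a polynomial to H and extends
    the result constantly along the coroot, so restrictions stay in the same polynomial ring. *)
Definition hyproj : 'M[F]_n := 1%:M - coroot rho alpha H *m alpha H.
Definition hypres (p : {mpoly F[n]}) := psubst hyproj p.

Lemma alpha_hyproj : alpha H *m hyproj = 0.
Proof.
by rewrite mulmxBr mulmx1 mulmxA alpha_ev ev_coroot // mul1mx subrr.
Qed.

Lemma pstab_hyproj w : w \in pst H -> rho w *m hyproj = hyproj.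
Proof.
move=> wH; have [_ /(_ w wH) ->] := corootP alphaP HA.
by rewrite mulmxDl mul1mx -scalemxAl -mulmxA alpha_hyproj mulmx0 scaler0 addr0.
Qed.

Lemma hypres_diff p : exists r, p - hypres p = lin * r.
Proof.
elim/mpoly_var_ind: p => [a|p q [r pr] [s qs]|i p [r pr]].
- by exists 0; rewrite /hypres psubstC subrr mulr0.
- by exists (r + s); rewrite mulrDr -pr -qs /hypres rmorphD opprD addrACA.
have [t ti] : exists t, 'X_i - hypres 'X_i = lin * t.
  exists (((delta_mx 0 i : 'rV[F]_n) *m coroot rho alpha H) 0 0)%:MP.
  rewrite /hypres mpolyX_linear_form psubst_linear_form -[- _]scaleN1r
    -linear_formZ -linear_formD.
  rewrite mulmxBr mulmx1 scaleN1r opprB addrC subrK mulmxA.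
  by rewrite {1}[_ *m coroot _ _ _]mx11_scalar mul_scalar_mx linear_formZ mulrC
    mul_mpolyC.
exists (t * p + hypres 'X_i * r).
rewrite mulrDr mulrA -ti [_ * (hypres _ * r)]mulrCA -pr /hypres rmorphM /=;
  ring.
Qed.

Lemma hypres_lin : hypres lin = 0.
Proof.
rewrite /hypres psubst_linear_form alpha_hyproj.
by rewrite /linear_form big1 // => i _; rewrite mxE scale0r.
Qed.

Lemma hypres_eq0 p : hypres p = 0 -> exists r, p = lin * r.
Proof. by move=> p0; have [r] := hypres_diff p; rewrite p0 subr0; exists r. Qed.

Lemma hypresM p q : hypres (p * q) = hypres p * hypres q.
Proof. exact: rmorphM. Qed.

Lemma hypresB p q : hypres (p - q) = hypres p - hypres q.
Proof. exact: rmorphB. Qed.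

Lemma hypres_pstab w p : w \in pst H -> hypres (psubst (rho w) p) = hypres p.
Proof. by move=> wH; rewrite /hypres psubst_comp pstab_hyproj. Qed.

(* The local ring of F[h] at the generic point of H. *)
Definition locring f := exists p q, hypres q != 0 /\ f
  = polyfrac p / polyfrac q.

Lemma hypres_neq0 q : hypres q != 0 -> q != 0.
Proof. by apply: contraNneq => ->; rewrite /hypres raddf0. Qed.

Lemma hypresM_neq0 p q : hypres p != 0 -> hypres q != 0 -> hypres (p * q) != 0.
Proof. by move=> p0 q0; rewrite hypresM mulf_neq0. Qed.

Lemma polyring_locring f : polyring f -> locring f.
Proof.
case=> p ->; exists p, 1; rewrite rmorph1 divr1; split=> //.
by rewrite /hypres rmorph1 oner_neq0.
Qed.

Lemma locring_coefring : coefring locring.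
Proof.
split=> [a|_ _ [p [q [q0 ->]]] [r [s [s0 ->]]]|_ _ [p [q [q0 ->]]]
  [r [s [s0 ->]]]].
- by apply: polyring_locring; exists a%:MP.
- exists (p * s + r * q), (q * s); split; first exact: hypresM_neq0.
  by rewrite (polyfrac_add p r (hypres_neq0 q0) (hypres_neq0 s0)).
- exists (p * r), (q * s); split; first exact: hypresM_neq0.
  by rewrite polyfrac_mul.
Qed.

Lemma locring_derive y f : locring f -> locring (rderive y f).
Proof.
case=> p [q [q0 ->]]; rewrite (rderive_frac y p (hypres_neq0 q0)).
by exists (pderive y p * q - p * pderive y q), (q * q); split;
  first exact: hypresM_neq0.
Qed.

Lemma locring_wact w f : w \in pst H -> locring f -> locring (wact w f).
Proof.
move=> wH [p [q [q0 ->]]]; rewrite fmorph_div /= !wact_poly.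
exists (psubst (rho w^-1%g) p), (psubst (rho w^-1%g) q); split; last by [].
by rewrite hypres_pstab // groupV.
Qed.

(** W_H fixes H pointwise, so it acts trivially on the residue field of the local ring, whose
    maximal ideal is generated by [alpha H]. *)
Lemma locring_wact_sub w f : w \in pst H -> locring f ->
  exists2 g, locring g & wact w f - f = lform (alpha H) * g.
Proof.
move=> wH [p [q [q0 ->]]]; rewrite fmorph_div /= !wact_poly.
set p' := psubst _ p; set q' := psubst _ q.
have p'p : hypres p' = hypres p by rewrite hypres_pstab // groupV.
have q'q : hypres q' = hypres q by rewrite hypres_pstab // groupV.
have q'0 : hypres q' != 0 by rewrite q'q.
have [|r rE] := @hypres_eq0 (p' * q - p * q').
  by rewrite hypresB !hypresM p'p q'q subrr.
exists (polyfrac r / polyfrac (q' * q)).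
  by exists r, (q' * q); split; [exact: hypresM_neq0|].
by rewrite mulrA /lform -polyfracM -rE
  (polyfrac_sub p' p (hypres_neq0 q'0) (hypres_neq0 q0)).
Qed.

Lemma locring_logform_sub w y f : w \in pst H -> locring f ->
  locring (logform H y * (wact w f - f)).
Proof.
move=> wH fO; have [g gO ->] := locring_wact_sub wH fO.
rewrite logformE mulrA divfK ?(lform_alpha_neq0 alphaP HA) //.
by have [OC _ OM] := locring_coefring; apply: OM.
Qed.

Lemma polyring_logform_sub w y f : w \in pst H -> polyring f ->
  polyring (logform H y * (wact w f - f)).
Proof.
move=> wH [p ->]; rewrite wact_poly.
have [|r rE] := @hypres_eq0 (psubst (rho w^-1%g) p - p).
  by rewrite hypresB hypres_pstab ?groupV // subrr.
rewrite -polyfracN -polyfracD rE polyfracM -/(lform _) logformE mulrA.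
rewrite divfK ?(lform_alpha_neq0 alphaP HA) //.
by exists ((ev alpha H y)%:MP * r); rewrite polyfracM.
Qed.

Lemma hypres_alpha H' : H' \in arr -> H' != H ->
  hypres (linear_form (alpha H')) != 0.
Proof.
move=> HA' H'H; rewrite /hypres psubst_linear_form -polyfrac_eq0 -/(lform _)
  lform_eq0.
apply: contraNneq H'H => E; apply/eqP/esym/(arr_sub_eq HA HA')/subvP => u uH.
rewrite -(evP alphaP HA'); have -> : u = hyproj *m u.
  have /eqP uH0 : ev alpha H u == 0 by rewrite (evP alphaP HA).
  by rewrite mulmxBl mul1mx -mulmxA alpha_ev uH0 raddf0 mulmx0 subr0.
by rewrite !evE mulmxA E mul0mx mxE.
Qed.

Lemma locring_logform H' y : H' \in arr -> H' != H -> locring (logform H' y).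
Proof.
move=> HA' H'H; rewrite logformE.
by exists (ev alpha H' y)%:MP, (linear_form (alpha H')); split;
  first exact: hypres_alpha.
Qed.

End Hyperplane.

Definition arrform (s : seq {vspace 'cV[F]_n}) : {mpoly F[n]} :=
  \prod_(H <- s) linear_form (alpha H).

(** Denominators are explicit products of the forms [alpha H], with multiplicity given by the list,
    so that poles can be removed one factor at a time. *)
Definition arrring f := exists p s,
  {subset s <= arr} /\ f = polyfrac p / polyfrac (arrform s).

Lemma arrform_neq0 s : {subset s <= arr} -> arrform s != 0.
Proof.
move=> sA; rewrite /arrform big_seq; elim/big_rec: _ => [|H p /sA HA p0].
  exact: oner_neq0.
by apply: mulf_neq0 p0; rewrite -polyfrac_eq0 -/(lform _)
  (lform_alpha_neq0 alphaP).
Qed.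

Lemma subset_cat s t : {subset s <= arr} -> {subset t <= arr} ->
  {subset s ++ t <= arr}.
Proof. by move=> sA tA H; rewrite mem_cat => /orP[/sA|/tA]. Qed.

Lemma arrform_cat s t : arrform (s ++ t) = arrform s * arrform t.
Proof. by rewrite /arrform big_cat. Qed.

Lemma polyring_arrring f : polyring f -> arrring f.
Proof. by case=> p ->; exists p, [::];
  rewrite /arrform big_nil rmorph1 divr1. Qed.

Lemma arrring_coefring : coefring arrring.
Proof.
split=> [a|_ _ [p [s [sA ->]]] [q [t [tA ->]]]|_ _ [p [s [sA ->]]]
  [q [t [tA ->]]]].
- by apply: polyring_arrring; exists a%:MP.
- exists (p * arrform t + q * arrform s), (s ++ t); split;
  first exact: subset_cat.
  by rewrite (polyfrac_add p q (arrform_neq0 sA) (arrform_neq0 tA)) arrform_cat.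
- exists (p * q), (s ++ t); split; first exact: subset_cat.
  by rewrite polyfrac_mul arrform_cat.
Qed.

Lemma arrring_derive y f : arrring f -> arrring (rderive y f).
Proof.
case=> p [s [sA ->]]; rewrite (rderive_frac y p (arrform_neq0 sA)).
exists (pderive y p * arrform s - p * pderive y (arrform s)), (s ++ s).
by split; [exact: subset_cat|rewrite arrform_cat].
Qed.

Lemma wact_arrform w s : {subset s <= arr} -> exists2 l : F, l != 0 &
  psubst (rho w^-1%g) (arrform s)
    = l *: arrform [seq (wlin rho w @: H)%VS | H <- s].
Proof.
rewrite /arrform; elim: s => [|H s IH] sA.
  by exists 1; rewrite ?oner_neq0 // !big_nil rmorph1 scale1r.
have [|l l0 E] := IH; first by move=> K Ks; apply: sA; rewrite inE Ks orbT.
have HA : H \in arr by apply: sA; rewrite inE eqxx.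
have [k k0 kE] := alpha_img alphaP w HA.
exists (k^-1 * l); first by rewrite mulf_neq0 ?invr_neq0.
rewrite map_cons !big_cons rmorphM /= E psubst_linear_form.
have -> : alpha H *m rho w^-1%g = k^-1 *: alpha (wlin rho w @: H)%VS.
  by rewrite -[alpha H](scalerK k0) -kE -scalemxAl -mulmxA -rhoM mulgV repr_mx1
    mulmx1.
by rewrite linear_formZ -scalerAl -scalerAr scalerA.
Qed.

Lemma arrring_wact w f : arrring f -> arrring (wact w f).
Proof.
case=> p [s [sA ->]]; have [l l0 E] := wact_arrform w sA.
rewrite fmorph_div /= !wact_poly E.
exists (l^-1 *: psubst (rho w^-1%g) p), [seq (wlin rho w @: H)%VS | H <- s];
  split.
  by move=> _ /mapP[H /sA HA ->]; exact: arrangement_stable.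
set P := psubst _ p; set Q := arrform _.
rewrite -!mul_mpolyC (polyfracM _ P) (polyfracM _ Q) -!/(ratC n _) fmorphV
  invfM.
by rewrite mulrCA !mulrA.
Qed.

Lemma arrring_logform H y : H \in arr -> arrring (logform H y).
Proof.
move=> HA; exists (ev alpha H y)%:MP, [:: H]; split; first by move=> K;
  rewrite inE => /eqP ->.
by rewrite logformE /arrform big_seq1.
Qed.

Lemma arrring_logform_sub H w y f : H \in arr -> arrring f ->
  arrring (logform H y * (wact w f - f)).
Proof.
move=> HA fA; have [_ AD AM] := arrring_coefring.
apply: (AM); first exact: arrring_logform.
apply: (AD); first exact: arrring_wact.
exact: (coefringN arrring_coefring).
Qed.

(** Clearing denominators and restricting to H shows that the numerator vanishes on H; it is then
    divisible by [alpha H], and one factor of the denominator cancels. *)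
Lemma locring_arrring_poly f : arrring f ->
  (forall H, H \in arr -> locring H f) -> polyring f.
Proof.
case=> p [s [sA ->]]; elim: s p sA => [|H s IH] p sA fO.
  by exists p; rewrite /arrform big_nil rmorph1 divr1.
have HA : H \in arr by apply: sA; rewrite inE eqxx.
have sA' : {subset s <= arr} by move=> K Ks; apply: sA; rewrite inE Ks orbT.
have E : arrform (H :: s) = linear_form (alpha H) * arrform s by rewrite
  /arrform big_cons.
have lin0 : linear_form (alpha H) != 0.
  by rewrite -polyfrac_eq0 -/(lform _) (lform_alpha_neq0 alphaP).
have [r rE] : exists r, p = linear_form (alpha H) * r.
  apply: (@hypres_eq0 H); have [q [t [t0 /eqP]]] := fO H HA.
  rewrite polyfrac_eq ?arrform_neq0 ?(hypres_neq0 t0) // => /eqP.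
  move/(congr1 (hypres H)); rewrite E !hypresM (hypres_lin HA) mul0r mulr0.
  by move/eqP; rewrite mulf_eq0 (negPf t0) orbF => /eqP.
move: fO; rewrite rE E.
have -> : polyfrac (linear_form (alpha H) * r) / polyfrac
  (linear_form (alpha H) * arrform s)
    = polyfrac r / polyfrac (arrform s).
  apply/eqP; rewrite polyfrac_eq ?mulf_neq0 ?arrform_neq0 //; apply/eqP; ring.
exact: IH.
Qed.

End CoefficientRings.

(** * The rank one algebra at a hyperplane *)

Section RankOne.
Variables (F : numFieldType) (n : nat) (W : finGroupType).
Variable rho : mx_representation F [set: W]%G n.
Variable alpha : {vspace 'cV[F]_n} -> 'rV[F]_n.
Hypothesis rho_faithful : mx_faithful rho.
Hypothesis alphaP : defining_forms rho alpha.
Implicit Types (H : {vspace 'cV[F]_n}) (y v : 'cV[F]_n) (w u : W).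
Implicit Types (psi phi f : ratfun F n) (c : param rho).
Implicit Types (P Q Z : ratfun F n -> ratfun F n) (m : 'X_{1..n}).
Implicit Types (A : ratfun F n -> Prop).

Local Notation L := (ratfun F n).
Local Notation arr := (arrangement rho).
Local Notation pst := (pstab rho).
Local Notation "c %:L" := (ratC n c) (at level 2, format "c %:L").
Local Notation wact := (wact rho).
Local Notation logform := (logform alpha).
Local Notation hterm := (hterm alpha).
Local Notation dunklL := (dunklL alpha).

Local Notation winv := (winv rho).


Local Notation dunkl_mon := (dunkl_mon alpha).
Local Notation dspan := (dspan alpha).
Local Notation ev := (ev alpha).
Local Notation chi := (chi rho).

Variable H : {vspace 'cV[F]_n}.
Hypothesis HA : H \in arr.

Local Notation N := (nstab rho H).
Local Notation v := (coroot rho alpha H).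
Local Notation polyring := (@polyring F n).
Local Notation locring := (locring rho alpha H).
Local Notation D1 c := (dunklL [:: H] c v).
Local Notation x := (lform (alpha H)).

Definition weight i psi := forall w, w \in pst H ->
  wact w psi = (chi w ^+ i)%:L * psi.

(** Indices are read modulo N, as weights of W_H are. *)
Definition cval c i : F := c H (Ordinal (ltn_pmod i (nstab_gt0 rho H))).

Lemma winv_weight phi : winv phi -> weight 0 phi.
Proof. by move=> Kphi w _; rewrite expr0 rmorph1 mul1r Kphi. Qed.

Lemma pstab_coroot w : w \in pst H -> rho w *m v = chi w *: v.
Proof.
move=> wH; rewrite (pstab_act alphaP _ HA wH) ev_coroot // mulr1.
by rewrite -{1}[v]scale1r -scalerDl addrC subrK.
Qed.

Lemma wact_x w : w \in pst H -> wact w x = (chi w)^-1%:L * x.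
Proof.
move=> wH; rewrite wact_lform (pstab_form alphaP _ HA) ?groupV //.
rewrite -/(ev H v) ev_coroot // mulr1 -{1}[alpha H]scale1r -scalerDl addrC
  subrK.
by rewrite lformZ chiV.
Qed.

Lemma rderive_x y : rderive y x = (ev H y)%:L.
Proof. by rewrite rderive_lform. Qed.

Lemma x_neq0 : x != 0.
Proof. exact: (lform_alpha_neq0 alphaP HA). Qed.

(** By orthogonality e_{H,j} acts on weight i as 1 if j = i modulo N, and as 0 otherwise. *)
Lemma hterm_weight c y i psi : weight i psi ->
  hterm c H y psi = logform H y * (N%:R * cval c i)%:L * psi.
Proof.
move=> wpsi; rewrite htermE -mulrA; congr (_ * _).
transitivity ((\sum_(w in pst H) dunkl_coef c H w * chi w ^+ i)%:L * psi).
  rewrite rmorph_sum mulr_suml /=; apply: eq_bigr => w wH.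
  by rewrite wpsi // mulrA rmorphM.
congr (_%:L * _).
transitivity (\sum_(j < N) c H j * \sum_(w in pst H) chi w ^- j * chi w ^+
  (i %% N)).
  under [RHS]eq_bigr do rewrite mulr_sumr.
  rewrite exchange_big; apply: eq_bigr => w wH /=;
    rewrite /dunkl_coef mulr_suml.
  apply: eq_bigr => j _; rewrite mulrA {1}(divn_eq i N) exprD mulnC exprM.
  by rewrite chi_nstab // expr1n mul1r.
have lt_iN := ltn_pmod i (nstab_gt0 rho H).
rewrite (bigD1 (Ordinal lt_iN)) //= [X in _ + X]big1 => [|j ji].
  rewrite (chi_orth rho_faithful alphaP) // eqxx /= mul1r addr0 mulrC;
    congr (_ * c H _); exact: val_inj.
rewrite (chi_orth rho_faithful alphaP) //;
  suff -> : (i %% N == j)%N = false by rewrite mul0r mulr0.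
by apply: contraNF ji => /eqP ij; apply/eqP/val_inj.
Qed.

Lemma dunkl1E c y psi : dunklL [:: H] c y psi = rderive y psi - hterm c H y psi.
Proof. by rewrite dunklLE big_seq1. Qed.

Lemma dunkl1_weight c i psi : weight i psi ->
  x * D1 c psi = x * rderive v psi - (N%:R * cval c i)%:L * psi.
Proof.
move=> wpsi; rewrite dunkl1E (hterm_weight _ _ wpsi) logformE ev_coroot //
  rmorph1 mul1r.
by rewrite mulrBr !mulrA divff ?x_neq0 // mul1r.
Qed.

Lemma dunkl1_wact c w y psi : param_space c -> w \in pst H ->
  wact w (dunklL [:: H] c y psi) = dunklL [:: H] c (rho w *m y) (wact w psi).
Proof.
move=> cP wH; rewrite !dunkl1E rmorphB /= wact_derive hterm_wact //.
by rewrite pstab_hyper.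
Qed.

Lemma weight_dunkl1 c i psi : param_space c -> weight i psi ->
  weight i.+1 (D1 c psi).
Proof.
move=> cP wpsi w wH; rewrite dunkl1_wact // wpsi // pstab_coroot //.
by rewrite dunklL_ratC dunklLZl mulrA -rmorphM exprSr.
Qed.

Lemma weight_iter c i a psi : param_space c -> weight i psi ->
  weight (i + a) (iter a (D1 c) psi).
Proof.
move=> cP wpsi; elim: a => [|a IH]; first by rewrite addn0.
by rewrite addnS; exact: weight_dunkl1.
Qed.

Lemma weight_iter0 c a psi : param_space c -> weight 0 psi ->
  weight a (iter a (D1 c) psi).
Proof. exact: weight_iter. Qed.

Lemma weight_mod i psi : weight (i + N) psi -> weight i psi.
Proof. by move=> wpsi w wH; rewrite wpsi // exprD chi_nstab // mulr1. Qed.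

Lemma weight_iterN c q psi : param_space c -> weight 0 psi ->
  weight 0 (iter (q * N) (D1 c) psi).
Proof.
move=> cP wpsi; elim: q => [|q IH] //.
by rewrite mulSn iterD; apply: weight_mod; exact: weight_iter.
Qed.

(** No parameter enters except through the list, and the factors commute; this is what makes the
    operator symmetric in the exponents. *)
Definition euler_prod (s : seq F) psi : L :=
  foldr (fun l g => x * rderive v g - l%:L * g) psi s.

Lemma euler_prodC l s psi :
  x * rderive v (euler_prod s psi) - l%:L * euler_prod s psi
  = euler_prod s (x * rderive v psi - l%:L * psi).
Proof.
elim: s => //= k s <-; set g := euler_prod s psi.
by rewrite !raddfB /= !rderiveM !rderive_ratC; ring.
Qed.

Lemma euler_prod_cat s t psi : euler_prod (s ++ t) psi
  = euler_prod s (euler_prod t psi).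
Proof. exact: foldr_cat. Qed.

Lemma euler_prod_perm s t psi : perm_eq s t ->
  euler_prod s psi = euler_prod t psi.
Proof.
elim: s t => [|l s IH] t; first by rewrite perm_sym => /perm_nilP ->.
move=> st; have lt : l \in t by rewrite -(perm_mem st) inE eqxx.
case/splitPr: lt st => t1 t2 st.
have -> : euler_prod (t1 ++ l :: t2) psi = euler_prod (l :: t1 ++ t2) psi.
  by rewrite /= !euler_prod_cat euler_prodC.
rewrite /= (IH (t1 ++ t2)) // -(perm_cons l) (perm_trans st) //.
by rewrite -cat1s perm_catCA.
Qed.

(** On weight i the operator x v_c is x d/dv - N c_{H,i}; pulling x d/dv out to the left of x^i
    subtracts i more. *)
Lemma iter_dunkl1_euler c i psi : param_space c -> weight 0 psi ->
  x ^+ i * iter i (D1 c) psi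
  = euler_prod (rev [seq j%:R + N%:R * cval c j | j <- iota 0 i]) psi.
Proof.
move=> cP wpsi; elim: i => [|i IH]; first by rewrite expr0 mul1r.
rewrite -addn1 iotaD map_cat rev_cat /= -IH addn1 exprSr -mulrA /=.
rewrite (@dunkl1_weight _ i); last exact: weight_iter0.
rewrite rderiveM [rderive v (x ^+ i)](_ : _ = i%:R%:L * x ^+ i.-1); last first.
  elim: {IH} i => [|i IH]; first by rewrite expr0 rderive1 rmorph0 mul0r.
  rewrite exprS rderiveM IH rderive_x ev_coroot // rmorph1 mul1r.
  case: i {IH} => [|i]; first by rewrite expr0 rmorph0 mul0r mulr0 addr0
    rmorph1 mulr1.
  by rewrite mulrCA -exprS -[in RHS]natr1 rmorphD rmorph1; ring.
case: i {IH} => [|i]; first by rewrite add0n rmorphD rmorph0 expr0; ring.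
rewrite [x ^+ i.+1]exprS /= rmorphD; ring.
Qed.

Definition derives (ys : seq 'cV[F]_n) psi : L :=
  foldr (fun y g => rderive y g) psi ys.

Lemma weight_derives ys psi : {subset ys <= H} -> weight 0 psi ->
  weight 0 (derives ys psi).
Proof.
move=> yH wpsi; elim: ys yH => [|y ys IH] yH //= w wH.
rewrite wact_derive (pstabP _ _ _ wH) ?yH ?inE ?eqxx //.
rewrite IH // ?expr0 ?rmorph1 ?mul1r //.
by move=> z zys; apply: yH; rewrite inE zys orbT.
Qed.

(* Elements of the local rank one algebra, restricted to the invariants. *)
Definition lspan_generator c Q := exists f a ys,
  [/\ locring f, {subset ys <= H} &
  Q = fun phi => f * iter a (D1 c) (derives ys phi)].

Definition lspan c := aspan rho (lspan_generator c).

Lemma lspan_mul c f P : locring f -> lspan c P ->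
  lspan c (fun phi => f * P phi).
Proof.
move=> Of; apply: aspan_mul => _ [g [a [ys [Og yH ->]]]].
exists (f * g), a, ys; split=> //; last by apply/funext => phi; rewrite mulrA.
by case: (locring_coefring rho alpha H) => _ _; apply.
Qed.

Lemma lspan_gen c f a ys : locring f -> {subset ys <= H} ->
  lspan c (fun phi => f * iter a (D1 c) (derives ys phi)).
Proof. by move=> Of yH; apply: aspan_gen; exists f, a, ys. Qed.

Lemma dunkl1_mul c f i psi : weight i psi ->
  D1 c (f * psi) = f * D1 c psi + (rderive v f -
    \sum_(w in pst H) (dunkl_coef c H w * chi w ^+ i)%:L *
      (logform H v * (wact w f - f))) * psi.
Proof.
move=> wpsi; rewrite !dunkl1E hterm_mul rderiveM mulrBl mulr_suml.
have -> : \sum_(w in pst H) (dunkl_coef c H w)%:L *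
  (logform H v * (wact w f - f)) * wact w psi
    = \sum_(w in pst H) (dunkl_coef c H w * chi w ^+ i)%:L *
      (logform H v * (wact w f - f)) * psi.
  by apply: eq_bigr => w wH; rewrite wpsi // rmorphM; ring.
ring.
Qed.

Lemma lspan_D1 c P : param_space c -> lspan c P ->
  lspan c (fun phi => D1 c (P phi)).
Proof.
move=> cP; have OR := locring_coefring rho alpha H; have [OC OD OM] := OR.
apply: aspan_map => _ [f [a [ys [Of yH ->]]]].
(* On weight a the commutator of v_c with f is multiplication by [f'], which is regular at H because
   [wact w f - f] is divisible by [alpha H]. *)
pose f' := rderive v f - \sum_(w in pst H) (dunkl_coef c H w * chi w ^+ a)%:L *
  (logform H v * (wact w f - f)).
apply: (aspan_eq (P := fun phi => f * iter a.+1 (D1 c) (derives ys phi)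
   + f' * iter a (D1 c) (derives ys phi))).
  move=> phi Kphi; rewrite /= (@dunkl1_mul c f a) //.
  by apply: weight_iter0 => //; apply: weight_derives => //; exact: winv_weight.
apply: aspanD; apply: lspan_gen => //.
apply: (OD); first exact: locring_derive.
apply: coefringN => //; apply: coefring_sum => // w wH; apply: (OM) => //.
exact: locring_logform_sub.
Qed.

Lemma logform_hyper y : y \in H -> logform H y = 0.
Proof. by rewrite -(evP alphaP HA) logformE => /eqP ->;
  rewrite rmorph0 mul0r. Qed.

Lemma dunkl1_hyper c y psi : y \in H -> dunklL [:: H] c y psi = rderive y psi.
Proof. by move=> yH; rewrite dunkl1E htermE logform_hyper // mul0r subr0. Qed.

Lemma rderive_dunkl1 c y psi : y \in H ->
  rderive y (D1 c psi) = D1 c (rderive y psi).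
Proof.
move=> yH; rewrite !dunkl1E raddfB /= rderive_comm; congr (_ - _).
have /eqP y0 : ev H y == 0 by rewrite (evP alphaP HA).
rewrite !htermE rderiveM (rderive_logform alpha _ _ HA) y0 mulr0 rmorph0 mul0r
  oppr0 mul0r add0r.
congr (_ * _); rewrite raddf_sum; apply: eq_bigr => w wH /=.
rewrite rderiveM rderive_ratC mul0r add0r wact_derive.
by rewrite (pstabP _ _ _ wH).
Qed.

Lemma rderive_iter c y a psi : y \in H ->
  rderive y (iter a (D1 c) psi) = iter a (D1 c) (rderive y psi).
Proof. by move=> yH; elim: a => //= a <-; rewrite rderive_dunkl1. Qed.

Lemma lspan_derive c y P : y \in H -> lspan c P ->
  lspan c (fun phi => rderive y (P phi)).
Proof.
move=> yH; apply: aspan_map => _ [f [a [ys [Of ysH ->]]]].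
apply: (aspan_eq (P := fun phi => rderive y f * iter a (D1 c) (derives ys phi)
   + f * iter a (D1 c) (derives (y :: ys) phi))).
  by move=> phi _; rewrite /= rderiveM rderive_iter.
apply: aspanD; apply: lspan_gen => //; first exact: locring_derive.
by move=> z; rewrite inE => /orP[/eqP ->|/ysH].
Qed.

Lemma lspan_dunkl1 c y P : param_space c -> lspan c P ->
  lspan c (fun phi => dunklL [:: H] c y (P phi)).
Proof.
move=> cP PL; pose z := y - ev H y *: v.
have zH : z \in H by rewrite -(evP alphaP HA) evD evN evZ ev_coroot // mulr1
  subrr.
apply: (aspan_eq (P := fun phi =>
  rderive z (P phi) + (ev H y)%:L * D1 c (P phi))).
  move=> phi _; rewrite -(dunkl1_hyper c _ zH) -dunklLZl -dunklLDl.
  by rewrite /z subrK.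
apply: aspanD; first exact: lspan_derive.
apply: lspan_mul; last exact: lspan_D1.
by case: (locring_coefring rho alpha H).
Qed.

Lemma dunklL_dunkl1 c y psi : dunklL arr c y psi
  = dunklL [:: H] c y psi - \sum_(H' <- arr | H' != H) hterm c H' y psi.
Proof.
by rewrite dunkl1E dunklLE (bigD1_seq H) ?undup_uniq //= opprD addrA.
Qed.

(** The other hyperplanes contribute elements outside W_H, so the induction on m has to treat all w
    in W together; their poles are invertible at H. *)
Lemma lspan_act_dunkl_mon c m w : param_space c ->
  lspan c (fun phi => wact w (dunkl_mon c m phi)).
Proof.
move=> cP; have [OC OD OM] := locring_coefring rho alpha H.
elim/mnm_ind: m w => [|i m IH] w.
  apply: (aspan_eq (P := fun phi => 1 * iter 0 (D1 c) (derives [::] phi))).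
    by move=> phi Kphi; rewrite mul1r dunkl_mon0 Kphi.
  by apply: lspan_gen => //; exact: coefring1 (locring_coefring rho alpha H).
pose y : 'cV[F]_n := rho w *m delta_mx i 0.
apply: (aspan_eq (P := fun phi => dunklL [:: H] c y (wact w (dunkl_mon c m phi))
  + \sum_(H' <- arr | (H' \in arr) && (H' != H)) (- logform H' y) *
     (\sum_(u in pst H') (dunkl_coef c H' u)%:L * wact (u * w)%g
       (dunkl_mon c m phi)))).
  move=> phi _; rewrite dunkl_monS // dunklL_wact // dunklL_dunkl1
    -big_seq_cond.
  rewrite -sumrN; congr (_ + _); apply: eq_bigr => H' _.
  rewrite htermE mulNr; congr (- (_ * _)); apply: eq_bigr => u _.
  by rewrite wactM.
apply: aspanD; first exact: lspan_dunkl1.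
apply: aspan_sum => H' /andP[H'A H'H]; apply: lspan_mul.
  by apply: coefringN; [exact: locring_coefring|exact: locring_logform].
by apply: aspan_sum => u _; exact: lspan_mul.
Qed.

Lemma dspan_lspan c k P : param_space c -> dspan polyring c k P -> lspan c P.
Proof.
move=> cP; apply: (aspan_map (Z := idfun)) => _ [f [m [Af _ ->]]].
apply: lspan_mul; first exact: polyring_locring.
apply: aspan_eq (lspan_act_dunkl_mon m 1%g cP) => phi _; exact: wact1.
Qed.

Lemma dspan_dunkl1 c k y P : param_space c -> dspan locring c k P ->
  dspan locring c k.+1 (fun phi => dunklL [:: H] c y (P phi)).
Proof.
move=> cP; have OR := locring_coefring rho alpha H; have [OC OD OM] := OR.
apply: (dspan_close (Z := dunklL [:: H] c y) (g := fun w =>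
    \sum_(H' <- arr | (H' \in arr) && [&& H' != H & w \in pst H'])
       (dunkl_coef c H' w)%:L * logform H' y) (y := y) alphaP cP OR).
- move=> w; apply: coefring_sum => // H' /and3P[H'A H'H _].
  by apply: (OM) => //; exact: locring_logform.
- move=> psi; rewrite dunklL_dunkl1.
  suff -> : \sum_w (\sum_(H' <- arr | (H' \in arr) &&
    [&& H' != H & w \in pst H'])
      (dunkl_coef c H' w)%:L * logform H' y) * wact w psi
      = \sum_(H' <- arr | H' != H) hterm c H' y psi by rewrite subrK.
  under eq_bigr do rewrite -big_seq_cond mulr_suml.
  rewrite (exchange_big_dep (fun H' => H' != H)) /=;
    last by move=> w H' _ /andP[].
  apply: eq_bigr => H' H'H; rewrite htermE mulr_sumr.
  by apply: eq_big => [w|w _]; rewrite ?H'H //=; ring.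
- move=> f Of; apply: dunklL_mul_comm => //; first exact: locring_derive.
  by move=> H' w; rewrite inE => /eqP -> wH; exact: locring_logform_sub.
Qed.

(** The way back from the local presentation: uniqueness is available for monomials in the Dunkl
    operators of the full group W. *)
Lemma lspan_dspan c P : param_space c -> lspan c P ->
  exists k, dspan locring c k P.
Proof.
move=> cP; have OR := locring_coefring rho alpha H.
elim=> {P} [P P0|Q P' P [f [a [ys [Of yH ->]]]] _ [k NP'] E].
  by exists 0%N; exact: aspan_nil.
exists (maxn (a + (size ys).+1) k).
apply: (aspan_eq (P := fun phi => f * iter a (D1 c) (derives ys phi) + P' phi)).
  by move=> phi Kphi; rewrite E.
apply: aspanD; last by apply: dspan_mono NP' => //; exact: leq_maxr.
apply: (dspan_mono (A := locring) (k := (a + (size ys).+1)%N)) => //;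
  first exact: leq_maxl.
apply: dspan_mul => // {E}; elim: a => [|a IH]; last exact: dspan_dunkl1.
rewrite add0n; elim: ys yH => [|y ys IH] yH /=.
  apply: aspan_eq (dspan_dunkl_mon alpha c OR (k := 1) (m := 0%MM) _);
    last by rewrite mdeg0.
  by move=> phi _; rewrite dunkl_mon0.
have yH' : y \in H by apply: yH; rewrite inE eqxx.
apply: (aspan_eq (P := fun phi => dunklL [:: H] c y (derives ys phi))).
  by move=> phi _; rewrite dunkl1_hyper.
by apply: dspan_dunkl1 => //; apply: IH => z zs; apply: yH; rewrite inE zs orbT.
Qed.

Lemma iter_dunkl1_change c c' psi : param_space c -> param_space c' ->
  perm_eq [seq j%:R + N%:R * cval c j | j <- iota 0 N]
          [seq j%:R + N%:R * cval c' j | j <- iota 0 N] ->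
  weight 0 psi -> iter N (D1 c) psi = iter N (D1 c') psi.
Proof.
move=> cP cP' cc' wpsi; apply: (mulfI (expf_neq0 N x_neq0)).
rewrite !iter_dunkl1_euler //; apply: euler_prod_perm.
by rewrite perm_rev perm_sym perm_rev perm_sym.
Qed.

Lemma iter_dunkl1_change_mul c c' q psi : param_space c -> param_space c' ->
  perm_eq [seq j%:R + N%:R * cval c j | j <- iota 0 N]
          [seq j%:R + N%:R * cval c' j | j <- iota 0 N] ->
  weight 0 psi -> iter (q * N) (D1 c) psi = iter (q * N) (D1 c') psi.
Proof.
move=> cP cP' cc' wpsi; elim: q => [|q IH] //.
rewrite mulSn !iterD IH; apply: iter_dunkl1_change => //.
exact: weight_iterN.
Qed.

(** On weight 0 the operator x d/dv is x v_c + N c_{H,0}, and it preserves weight 0, so Euler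
    products stay in the local algebra of any parameter. *)
Lemma lspan_euler_prod c s P : param_space c -> lspan c P ->
  (forall phi, winv phi -> weight 0 (P phi)) ->
  lspan c (fun phi => euler_prod s (P phi)).
Proof.
move=> cP PL wP; have [OC OD OM] := locring_coefring rho alpha H.
suff: lspan c (fun phi => euler_prod s (P phi)) /\
    forall phi, winv phi -> weight 0 (euler_prod s (P phi)) by case.
elim: s => [|l s [IH wIH]]; first by split.
split=> [|phi Kphi w wH] /=.
  apply: (aspan_eq (P := fun phi => x * D1 c (euler_prod s (P phi))
    + (N%:R * cval c 0 - l)%:L * euler_prod s (P phi))).
    move=> phi Kphi; rewrite (@dunkl1_weight c 0); last exact: wIH.
    by rewrite rmorphB /=; ring.
  apply: aspanD; apply: lspan_mul => //; last exact: lspan_D1.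
  by apply: polyring_locring; exists (linear_form (alpha H)).
have wg := wIH _ Kphi; rewrite expr0 rmorph1 mul1r rmorphB !rmorphM /=
  wact_ratC.
rewrite wact_derive wact_x // pstab_coroot // rderiveZl wg //.
rewrite expr0 rmorph1 mul1r; congr (_ - _).
by rewrite mulrACA -rmorphM mulVf ?chi_neq0 // rmorph1 mul1r.
Qed.

(** For a > 0 some u in W_H scales f by a factor other than 1, and u f - f is divisible by x, hence
    so is f. The quotient has its weight shifted by one, since x has weight -1. *)
Lemma locring_weight_dvd a f : locring f -> (a < N)%N ->
  (forall w, w \in pst H -> wact w f = (chi w ^- a)%:L * f) ->
  exists2 g, locring g & f = x ^+ a * g.
Proof.
have [OC OD OM] := locring_coefring rho alpha H.
elim: a f => [|a IH] f Of aN wf; first by exists f; rewrite ?expr0 ?mul1r.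
have [|u uH u1] := @chi_nontriv _ _ _ _ _ rho_faithful alphaP H a.+1 HA;
  first by rewrite aN.
have [g Og gE] := locring_wact_sub alphaP HA uH Of.
have u0 : chi u ^- a.+1 - 1 != 0.
  by rewrite subr_eq0 -[1]invr1 (inj_eq invr_inj).
have fE : f = x * ((chi u ^- a.+1 - 1)^-1%:L * g).
  have E : wact u f - f = (chi u ^- a.+1 - 1)%:L * f.
    by rewrite wf // rmorphB rmorph1 mulrBl mul1r.
  by rewrite mulrCA -gE E mulrA -rmorphM mulVf // rmorph1 mul1r.
set f1 := _%:L * g in fE.
have Of1 : locring f1 by apply: (OM).
have [||h Oh hE] := IH f1 Of1; first exact: ltnW.
  move=> w wH; apply: (mulfI x_neq0); have := wf w wH.
  rewrite fE rmorphM /= wact_x // => E.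
  apply: (mulfI (_ : (chi w)^-1%:L != 0)); last rewrite mulrA E.
    by rewrite fmorph_eq0 invr_eq0 chi_neq0.
  by rewrite exprS invfM rmorphM; ring.
by exists h => //; rewrite fE hE exprS mulrA.
Qed.

Lemma lspan_sym c c' P : param_space c -> param_space c' ->
  perm_eq [seq j%:R + N%:R * cval c j | j <- iota 0 N]
          [seq j%:R + N%:R * cval c' j | j <- iota 0 N] ->
  lspan c P -> lspan c' (fun phi => \sum_(w in pst H) wact w (P phi)).
Proof.
move=> cP cP' cc'; have OR := locring_coefring rho alpha H;
  have [OC OD OM] := OR.
elim=> {P} [P P0|Q P' P [f [a [ys [Of yH ->]]]] _ IH E].
  apply: aspan_nil => phi Kphi; rewrite big1 // => w _.
  by rewrite P0 // raddf0.
(* As v_c^a produces weight a, averaging f v_c^a over W_H gives h v_c^a on invariants, and h has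
   weight -a. *)
pose h := \sum_(w in pst H) (chi w ^+ a)%:L * wact w f.
have Oh : locring h.
  by apply: coefring_sum => // w wH; apply: (OM) => //; exact: locring_wact.
have wa phi : winv phi -> weight 0 (derives ys phi).
  by move=> Kphi; apply: weight_derives => //; exact: winv_weight.
apply: (aspan_eq (P := fun phi => h * iter a (D1 c) (derives ys phi)
    + \sum_(w in pst H) wact w (P' phi))).
  move=> phi Kphi; rewrite mulr_suml -big_split; apply: eq_bigr => w wH /=.
  rewrite E // raddfD /= rmorphM /= (@weight_iter0 c a _ cP (wa _ Kphi) w wH).
  by rewrite mulrA [_%:L * _]mulrC.
apply: aspanD => //.
have aN := ltn_pmod a (nstab_gt0 rho H).
have [|g Og hE] := locring_weight_dvd Oh aN.
  move=> u uH; rewrite /h raddf_sum mulr_sumr [RHS](reindex_inj (mulgI u)) /=.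
  apply: eq_big => [w|w wH]; first by rewrite
    (groupMl _ (uH : u \in pstab_group rho H)).
  rewrite /= rmorphM /= wact_ratC -wactM chiM exprMn mulrA -rmorphM /=.
  congr (_%:L * _); rewrite mulrA [in chi u ^+ a](divn_eq a N) exprD mulnC
    exprM chi_nstab // expr1n mul1r.
  by rewrite mulVf ?mul1r // expf_neq0 ?chi_neq0.
(* With r = a %% N, the factor x^r of h turns v_c^r into an Euler product, and the remaining power
   of v_c^N is the same for [c']. The factor 1 gives the argument the shape of a generator. *)
apply: (aspan_eq (P := fun phi => g * euler_prod
    (rev [seq j%:R + N%:R * cval c j | j <- iota 0 (a %% N)])
    (1 * iter (a %/ N * N) (D1 c') (derives ys phi)))).
  move=> phi Kphi; rewrite mul1r
    -(iter_dunkl1_change_mul _ cP cP' cc' (wa _ Kphi)).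
  rewrite -iter_dunkl1_euler //; last by apply: weight_iterN => //; exact: wa.
  by rewrite -iterD addnC -divn_eq hE mulrCA mulrA.
apply: lspan_mul => //; apply: lspan_euler_prod => //.
  by apply: lspan_gen => //; exact: coefring1.
by move=> phi Kphi; rewrite mul1r; apply: weight_iterN => //; exact: wa.
Qed.

End RankOne.

(** * Change of parameter for operators with invariant values *)

Section ParameterChange.
Variables (F : numFieldType) (n : nat) (W : finGroupType).
Variable rho : mx_representation F [set: W]%G n.
Variable alpha : {vspace 'cV[F]_n} -> 'rV[F]_n.
Hypothesis rho_faithful : mx_faithful rho.
Hypothesis alphaP : defining_forms rho alpha.
Implicit Types (H : {vspace 'cV[F]_n}) (y v : 'cV[F]_n) (w u : W).
Implicit Types (psi phi f : ratfun F n) (c : param rho).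
Implicit Types (P Q Z : ratfun F n -> ratfun F n) (m : 'X_{1..n}).
Implicit Types (A : ratfun F n -> Prop).

Local Notation L := (ratfun F n).
Local Notation arr := (arrangement rho).
Local Notation pst := (pstab rho).
Local Notation "c %:L" := (ratC n c) (at level 2, format "c %:L").
Local Notation wact := (wact rho).
Local Notation logform := (logform alpha).
Local Notation hterm := (hterm alpha).
Local Notation dunklL := (dunklL alpha).

Local Notation winv := (winv rho).


Local Notation dunkl_mon := (dunkl_mon alpha).
Local Notation dspan := (dspan alpha).
Local Notation ev := (ev alpha).
Local Notation chi := (chi rho).

Local Notation symop := (symop alpha).
Local Notation polyring := (@polyring F n).

(* On W_H-invariants, alpha_H^N v_c^N is the product over j < N = n_H of
   alpha_H d/dv - (j + N c_{H,j}), where alpha_H(v) = 1: these numbers, and not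
   their order, are all that enters locally at H. *)
Definition same_exponents c c' := forall H, H \in arr ->
  perm_eq [seq j%:R + (nstab rho H)%:R * cval H c j | j <- iota 0 (nstab rho H)]
          [seq j%:R + (nstab rho H)%:R * cval H c' j | j <- iota 0
            (nstab rho H)].

Lemma same_exponents_sym c c' : same_exponents c c' -> same_exponents c' c.
Proof. by move=> cc' H HA; rewrite perm_sym; exact: cc'. Qed.

Lemma exponents_ord c H :
  [seq j%:R + (nstab rho H)%:R * cval H c j | j <- iota 0 (nstab rho H)]
  = [seq (j : nat)%:R + (nstab rho H)%:R * c H j | j : 'I_(_) <- enum
    'I_(nstab rho H)].
Proof.
rewrite -val_enum_ord -map_comp; apply: eq_map => j /=.
congr (_ + _ * c H _); apply: val_inj => /=; exact: modn_small.
Qed.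

(** Since rho_{H,j} = j/N, the exponent j + N c_{H,j} is N times the entry of c + rho, and the dot
    action permutes these entries. *)
Lemma dot_action_same_exponents s c : same_exponents c (dot_action s c).
Proof.
move=> H HA; rewrite !exponents_ord; set N := nstab rho H.
pose g (j : 'I_N) : F := (j : nat)%:R + N%:R * c H j.
have -> : [seq (j : nat)%:R + N%:R * dot_action s c j | j : 'I_(_) <- enum 'I_N]
    = [seq g j | j <- [seq ((s H)^-1%g : {perm 'I_N}) j | j : 'I_(_) <- enum
      'I_N]].
  rewrite -[RHS]map_comp; apply: eq_map => j /=.
  rewrite /dot_action /perm_param /rho_param /g; set k := _ j.
  rewrite mulrBr mulrDr ![N%:R * (_ / _)]mulrCA.
  by rewrite divff ?nstab_neq0 // !mulr1 addrC subrK addrC.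
apply: perm_map; apply: uniq_perm; rewrite ?enum_uniq //.
  by rewrite map_inj_uniq ?enum_uniq //; exact: perm_inj.
move=> j; rewrite mem_enum; symmetry; apply/mapP.
by exists (s H j); rewrite ?mem_enum ?permK.
Qed.

Lemma dspan_act_all c k P : param_space c -> dspan polyring c k P ->
  dspan polyring c k (fun phi => \sum_w wact w (P phi)).
Proof.
move=> cP NP; apply: aspan_sum => w _; apply: dspan_act NP => //.
  exact: polyring_coefring.
by move=> f; exact: polyring_wact.
Qed.

Lemma wact_sum_inv psi : winv (\sum_w wact w psi).
Proof.
move=> u; rewrite raddf_sum [RHS](reindex_inj (mulgI u)) /=.
by apply: eq_bigr => w _; rewrite wactM.
Qed.

Lemma dspan_arrring c c' k P : param_space c -> param_space c' ->
  dspan polyring c k P -> dspan (arrring rho alpha) c' k P.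
Proof.
move=> cP cP'; have AR := arrring_coefring alphaP.
apply: (aspan_map (Z := idfun)) => _ [f [m [Af mk ->]]].
apply: dspan_mul => //; first exact: polyring_arrring.
apply: (dspan_mono (A := arrring rho alpha) (k := (mdeg m).+1)) => //.
elim/mnm_ind: m {mk} => [|i m IH].
  by apply: aspan_eq (dspan_dunkl_mon alpha c' AR (ltnSn (mdeg 0%MM))) =>
    phi _; rewrite !dunkl_mon0.
rewrite mdegD mdeg1.
apply: (aspan_eq (P := fun phi =>
  dunklL arr c (delta_mx i 0) (dunkl_mon c m phi))).
  by move=> phi _; rewrite dunkl_monS.
have [g Ag gE] := dunklL_change c' c AR
  (fun H => @arrring_logform _ _ _ rho alpha H (delta_mx i 0)).
apply: (dspan_close (Z := dunklL arr c (delta_mx i 0)) (g := g) alphaP cP' AR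
  Ag gE) => // f' Af'.
apply: dunklL_mul_comm => //; first exact: arrring_derive.
by move=> H w HA wH; exact: arrring_logform_sub.
Qed.

(** Over [arrring] the operator has a symbol [s] for [c']; over the local ring at each H it has a
    symbol [t]. Uniqueness gives s = t, so the coefficients of [s] have no pole at any H and are
    polynomials. *)
Lemma dspan_change c c' k P : param_space c -> param_space c' ->
  same_exponents c c' ->
  (forall phi, winv phi -> winv (P phi)) ->
  dspan polyring c k P -> exists k', dspan polyring c' k' P.
Proof.
move=> cP cP' cc' PK NP.
have [s [sA _ sE]] := dspan_symop (arrring_coefring alphaP)
  (dspan_arrring cP cP' NP).
exists (msize s); apply: (aspan_eq (P := symop c' s)).
  by move=> phi Kphi; rewrite sE.
apply: symop_dspan; first exact: polyring_coefring.
move=> m; apply: (locring_arrring_poly alphaP) => // H HA.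
have := lspan_sym rho_faithful alphaP HA cP cP' (cc' H HA)
  (dspan_lspan alphaP HA cP NP).
set N := nstab rho H => L1.
(* On invariants the values of [P] are W-invariant, so [P] is its own average over W_H, and
   [lspan_sym] applies. *)
have L2 : lspan alpha H c' P.
  apply: (aspan_eq (P := fun phi =>
    (N%:R^-1)%:L * \sum_(w in pst H) wact w (P phi))).
    move=> phi Kphi; under eq_bigr do rewrite PK //.
    rewrite sumr_const -[X in _ * X]mulr_natl mulrA -/(nstab rho H) -/N.
    by rewrite -(rmorph_nat (ratC n)) -rmorphM mulVf ?nstab_neq0 // rmorph1
      mul1r.
  by apply: lspan_mul => //; case: (locring_coefring rho alpha H).
have [k' NP'] := lspan_dspan alphaP HA cP' L2.
have [t [tA _ tE]] := dspan_symop (locring_coefring rho alpha H) NP'.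
suff -> : s = t by [].
by apply: (symop_inj alphaP cP') => phi Kphi; rewrite -sE // tE.
Qed.

(** Composition with the homothety of ratio a. It expresses homogeneity on rational functions: an
    operator of degree -d satisfies P(scale a psi) = a^d scale a (P psi). *)
Definition scale (a : F) psi : L := rsubst a%:M psi.

Section Scaling.
Variable a : F.
Hypothesis a0 : a != 0.

Lemma scalar_unitmx : a%:M \in @unitmx F n.
Proof. by rewrite unitmxE det_scalar unitfE expf_neq0. Qed.

Lemma scale_is_zmod_morphism : zmod_morphism (scale a).
Proof. exact: rsubst_is_zmod_morphism scalar_unitmx. Qed.

Lemma scale_is_monoid_morphism : monoid_morphism (scale a).
Proof. exact: rsubst_is_monoid_morphism scalar_unitmx. Qed.

Definition scale_rmorph : {rmorphism L -> L} := HB.pack (scale a)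
  (GRing.isZmodMorphism.Build L L (scale a) scale_is_zmod_morphism)
  (GRing.isMonoidMorphism.Build L L (scale a) scale_is_monoid_morphism).

Lemma scaleM f g : scale a (f * g) = scale a f * scale a g.
Proof. exact: (rmorphM scale_rmorph). Qed.

Lemma scaleB f g : scale a (f - g) = scale a f - scale a g.
Proof. exact: (rmorphB scale_rmorph). Qed.

Lemma scale_div f g : scale a (f / g) = scale a f / scale a g.
Proof. exact: (fmorph_div scale_rmorph). Qed.

Lemma scale_sum (I : Type) (r : seq I) (p : pred I) (f : I -> L) :
  scale a (\sum_(i <- r | p i) f i) = \sum_(i <- r | p i) scale a (f i).
Proof. exact: (raddf_sum scale_rmorph). Qed.

Lemma scale_wact w psi : scale a (wact w psi) = wact w (scale a psi).
Proof.
rewrite /scale /wact !rsubst_comp ?rho_unit ?scalar_unitmx //.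
by rewrite mul_mx_scalar mul_scalar_mx.
Qed.

Lemma scale_ratC b : scale a b%:L = b%:L.
Proof. by rewrite /scale rsubst_ratC ?scalar_unitmx. Qed.

Lemma rderive_scale y psi : rderive y (scale a psi)
  = a%:L * scale a (rderive y psi).
Proof.
rewrite /scale rderive_subst ?scalar_unitmx // mul_scalar_mx rderiveZl.
by rewrite -/(scale a _) scaleM scale_ratC.
Qed.

Lemma scale_logform H y : logform H y = a%:L * scale a (logform H y).
Proof.
rewrite !logformE scale_div scale_ratC.
have -> : scale a (lform (alpha H)) = a%:L * lform (alpha H).
  rewrite /scale /lform rsubst_poly ?scalar_unitmx // psubst_linear_form
    mul_mx_scalar.
  by rewrite -/(lform _) lformZ.
by rewrite invfM mulrCA mulVKf ?fmorph_eq0.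
Qed.

Lemma hterm_scale c H y psi : hterm c H y (scale a psi)
  = a%:L * scale a (hterm c H y psi).
Proof.
rewrite !htermE scaleM mulrA -scale_logform; congr (_ * _).
rewrite scale_sum; apply: eq_bigr => w _.
by rewrite scaleM scale_ratC scale_wact.
Qed.

Lemma dunklL_scale c y psi :
  dunklL arr c y (scale a psi) = a%:L * scale a (dunklL arr c y psi).
Proof.
rewrite !dunklLE rderive_scale scaleB scale_sum.
rewrite mulrBr mulr_sumr; congr (_ - _); apply: eq_bigr => H _.
exact: hterm_scale.
Qed.

Lemma dunkl_mon_scale c m psi : param_space c ->
  dunkl_mon c m (scale a psi) = (a ^+ mdeg m)%:L * scale a (dunkl_mon c m psi).
Proof.
move=> cP; elim/mnm_ind: m => [|i m IH];
  first by rewrite !dunkl_mon0 mdeg0 expr0 rmorph1 mul1r.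
rewrite !dunkl_monS // IH dunklL_ratC dunklL_scale mdegD mdeg1 exprD expr1
  mulrA -rmorphM.
by rewrite [a * _]mulrC.
Qed.

End Scaling.

Lemma mcoeff_psubst_scalar (a : F) (p : {mpoly F[n]}) k :
  (psubst a%:M p)@_k = a ^+ mdeg k * p@_k.
Proof.
have psX m : psubst a%:M 'X_[m] = a ^+ mdeg m *: 'X_[m] :> {mpoly F[n]}.
  elim/mnm_ind: m => [|i m IH]; first by rewrite mpolyX0 rmorph1 mdeg0 expr0
    scale1r.
  rewrite mpolyXD rmorphM /= IH psubstX (bigD1 i) //= mxE eqxx mulr1n big1
    ?addr0.
    by rewrite mdegD mdeg1 exprD expr1 -scalerAl -scalerAr scalerA.
  by move=> j ji; rewrite mxE eq_sym (negPf ji) mulr0n scale0r.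
have pk : p@_k = \sum_(m <- msupp p) p@_m * (m == k)%:R.
  rewrite {1}[p]mpolyE raddf_sum /=; apply: eq_bigr => m _.
  by rewrite mcoeffZ mcoeffX.
rewrite pk {1}[p]mpolyE (raddf_sum (psubst a%:M)) raddf_sum mulr_sumr /=.
apply: eq_bigr => m _; rewrite psubstZ psX !mcoeffZ mcoeffX.
by case: eqP => [->|_]; [rewrite mulrCA|rewrite !mulr0].
Qed.

Lemma symop_sum c (I : Type) (r : seq I) (p : pred I) (E : I -> {mpoly L[n]})
  psi :
  symop c (\sum_(i <- r | p i) E i) psi = \sum_(i <- r | p i) symop c (E i) psi.
Proof.
apply: (big_morph (fun s => symop c s psi)) => [s t|]; first exact: symopD.
exact: symop0.
Qed.

(* [scale 2] detects that the operator has degree -d; with polynomial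
   coefficients and order less than d it must vanish. *)
Lemma homogeneous_zero c d (s : {mpoly L[n]}) : param_space c ->
  (forall m, polyring s@_m) -> (msize s <= d)%N ->
  (forall phi, winv phi -> symop c s (scale 2 phi)
    = (2 ^+ d)%:L * scale 2 (symop c s phi)) ->
  s = 0.
Proof.
move=> cP sP sd sE.
have t0 : (2 : F) != 0 by rewrite pnatr_eq0.
have t0' : (2^-1 : F) != 0 by rewrite invr_eq0.
have scK psi : scale 2^-1 (scale 2 psi) = psi.
  rewrite /scale rsubst_comp ?scalar_unitmx // -scalar_mxM divff //.
  exact: rsubst1.
pose E m := (2 ^+ mdeg m)%:L * scale 2^-1 s@_m - (2 ^+ d)%:L * s@_m.
pose t := \sum_(m : 'X_{1..n < msize s}) E m *: 'X_[m].
have : t = 0.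
  apply: (symop_uniq alphaP cP) => phi Kphi.
  have := congr1 (scale 2^-1) (sE _ Kphi).
  rewrite (scaleM t0') scale_ratC // scK => E1.
  have E2 : scale 2^-1 (symop c s (scale 2 phi)) =
      \sum_(m : 'X_{1..n < msize s}) (2 ^+ mdeg m)%:L * scale 2^-1 s@_m *
        dunkl_mon c m phi.
    rewrite (symopwE _ _ _ (leqnn _)) (scale_sum t0'); apply: eq_bigr => m _.
    rewrite dunkl_mon_scale // !(scaleM t0') scale_ratC // scK; ring.
  rewrite /t symop_sum; under eq_bigr do rewrite symopZ symopX mulrBl.
  rewrite sumrB -E2 E1 (symopwE _ _ _ (leqnn _)) mulr_sumr.
  by rewrite -sumrB big1 // => m _; rewrite mulrA subrr.
move=> t00; apply/mpolyP => m; rewrite mcoeff0.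
have [sm|ms] := leqP (msize s) (mdeg m).
  by apply/eqP; rewrite mcoeff_eq0 msize_mdeg_ge.
have : E m = 0 by rewrite -(mcoeff_mpoly E ms) -/t t00 mcoeff0.
have [p pE] := sP m; rewrite /E pE /scale rsubst_poly ?scalar_unitmx //.
rewrite -!polyfracM -polyfracN -polyfracD => /eqP;
  rewrite polyfrac_eq0 => /eqP E0.
suff -> : p = 0 by rewrite rmorph0.
apply/mpolyP => k; have := congr1 (mcoeff k) E0.
rewrite mcoeffB !mcoeffCM mcoeff_psubst_scalar mcoeff0 mulrA -mulrBl => /eqP.
rewrite mulf_eq0 => /orP[|/eqP //]; rewrite exprVn subr_eq0 => /eqP E1.
have : 2 ^+ mdeg m = 2 ^+ (d + mdeg k) :> F by rewrite exprD -E1 divfK //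
  expf_neq0.
rewrite -!natrX => /eqP; rewrite eqr_nat eqn_exp2l // => /eqP Em.
by have := leq_trans ms sd; rewrite Em ltnNge leq_addr.
Qed.

Lemma sym_dunkl_mon_change c c' m phi : param_space c -> param_space c' ->
  same_exponents c c' -> winv phi ->
  \sum_w wact w (dunkl_mon c m phi) = \sum_w wact w (dunkl_mon c' m phi).
Proof.
move=> cP cP' cc' Kphi; have PR := @polyring_coefring F n.
have NP c1 : param_space c1 ->
    dspan polyring c1 (mdeg m).+1 (fun phi =>
      \sum_w wact w (dunkl_mon c1 m phi)).
  by move=> c1P; apply: dspan_act_all => //; exact: dspan_dunkl_mon.
have [|k Nk] := dspan_change cP cP' cc' _ (NP c cP).
  by move=> psi _; exact: wact_sum_inv.
pose D psi := \sum_w wact w (dunkl_mon c m psi)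
  - \sum_w wact w (dunkl_mon c' m psi).
have DP : dspan polyring c' (maxn k (mdeg m).+1) D.
  apply: (aspan_eq (P := fun psi => \sum_w wact w (dunkl_mon c m psi)
      + (-1) * \sum_w wact w (dunkl_mon c' m psi))).
    by move=> psi _; rewrite mulN1r.
  apply: aspanD; first by apply: dspan_mono Nk => //; exact: leq_maxl.
  apply: dspan_mul => //; first by apply: coefringN => //; exact: coefring1.
  by apply: dspan_mono (NP c' cP') => //; exact: leq_maxr.
(* [dspan_change] gives polynomial coefficients but no bound on the order; a second normal form,
   with arbitrary rational coefficients, gives the bound. By uniqueness the two have the same
   symbol. *)
have DA : dspan (fun _ : L => True) c' (mdeg m) D.
  apply: (aspan_eq (P := fun psi =>
    \sum_w wact w (dunkl_mon c m psi - dunkl_mon c' m psi))).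
    by move=> psi _; rewrite /D -sumrB; apply: eq_bigr => w _; rewrite raddfB.
  apply: aspan_sum => w _; apply: (dspan_act _ _ (A := fun _ : L => True)) =>
    //.
  exact: dunkl_mon_change.
have [s [sP _ sE]] := dspan_symop PR DP.
have [t [_ tk tE]] := dspan_symop (@coefring_all F n) DA.
have st : s = t by apply: (symop_inj alphaP cP') => psi Kpsi; rewrite -sE // tE.
have t0 : (2 : F) != 0 by rewrite pnatr_eq0.
have s0 : s = 0.
  apply: (homogeneous_zero (d := mdeg m) cP' sP); first by rewrite st.
  move=> psi Kpsi.
  have Ks : winv (scale 2 psi) by move=> w; rewrite -scale_wact // Kpsi.
  rewrite -!sE // /D; under eq_bigr do rewrite dunkl_mon_scale // rmorphM /=
    wact_ratC -scale_wact //.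
  under [X in _ - X]eq_bigr do rewrite dunkl_mon_scale // rmorphM /= wact_ratC
    -scale_wact //.
  rewrite -!mulr_sumr -mulrBr; congr (_ * _).
  by rewrite (scaleB t0) !(scale_sum t0).
have := sE _ Kphi; rewrite s0 symop0 /D => /eqP.
by rewrite subr_eq0 => /eqP.
Qed.

End ParameterChange.

(** * Invariant polynomials in the Dunkl operators *)

HB.lock Definition dpoly (F : numFieldType) (n : nat) (W : finGroupType)
    (rho : mx_representation F [set: W]%G n)
    (alpha : {vspace 'cV[F]_n} -> 'rV[F]_n)
    (c : param rho) (p : {mpoly F[n]}) (psi : ratfun F n) : ratfun F n :=
  symop alpha c (map_mpoly (ratC n) p) psi.

Section ConstantCoefficients.
Variables (F : numFieldType) (n : nat) (W : finGroupType).
Variable rho : mx_representation F [set: W]%G n.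
Variable alpha : {vspace 'cV[F]_n} -> 'rV[F]_n.
Hypothesis rho_faithful : mx_faithful rho.
Hypothesis alphaP : defining_forms rho alpha.
Implicit Types (H : {vspace 'cV[F]_n}) (y v : 'cV[F]_n) (w u : W).
Implicit Types (psi phi f : ratfun F n) (c : param rho).
Implicit Types (P Q Z : ratfun F n -> ratfun F n) (m : 'X_{1..n}).
Implicit Types (A : ratfun F n -> Prop).

Local Notation L := (ratfun F n).
Local Notation arr := (arrangement rho).
Local Notation pst := (pstab rho).
Local Notation "c %:L" := (ratC n c) (at level 2, format "c %:L").
Local Notation wact := (wact rho).
Local Notation logform := (logform alpha).
Local Notation hterm := (hterm alpha).
Local Notation dunklL := (dunklL alpha).

Local Notation winv := (winv rho).


Local Notation dunkl_mon := (dunkl_mon alpha).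
Local Notation dspan := (dspan alpha).
Local Notation ev := (ev alpha).
Local Notation chi := (chi rho).

Local Notation symop := (symop alpha).
Local Notation polyring := (@polyring F n).

Local Notation dpoly := (dpoly alpha).
Local Notation same_exponents := (@same_exponents F n W rho).

Lemma dpoly_symop c p psi : dpoly c p psi = symop c (map_mpoly (ratC n) p) psi.
Proof. by rewrite dpoly.unlock. Qed.

Lemma dpolyE c p psi : dpoly c p psi
  = \sum_(m <- msupp p) (p@_m)%:L * dunkl_mon c m psi.
Proof.
rewrite !dpoly_symop {1}[p]mpolyE (raddf_sum (map_mpoly _)) symop_sum;
  apply: eq_bigr => m _ /=.
by rewrite map_mpolyZ map_mpolyX symopZ symopX.
Qed.

Lemma dpolyD c p q psi : dpoly c (p + q) psi = dpoly c p psi + dpoly c q psi.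
Proof. by rewrite !dpoly_symop (raddfD (map_mpoly _)) symopD. Qed.

Lemma dpolyZ c a p psi : dpoly c (a *: p) psi = a%:L * dpoly c p psi.
Proof. by rewrite !dpoly_symop map_mpolyZ symopZ. Qed.

Lemma dpoly_sum c (I : Type) (r : seq I) (P : pred I) (p : I -> {mpoly F[n]})
  psi :
  dpoly c (\sum_(i <- r | P i) p i) psi = \sum_(i <- r | P i) dpoly c (p i) psi.
Proof.
apply: (big_morph (fun p => dpoly c p psi)) => [q s|]; first exact: dpolyD.
by rewrite !dpoly_symop raddf0 symop0.
Qed.

Lemma dpolyX c i p psi : param_space c ->
  dpoly c ('X_i * p) psi = dunklL arr c (delta_mx i 0) (dpoly c p psi).
Proof.
move=> cP; rewrite [dpoly c p psi]dpolyE raddf_sum.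
rewrite {1}[p]mpolyE mulr_sumr dpoly_sum; apply: eq_bigr => m _ /=.
rewrite -scalerAr dpolyZ -mpolyXD !dpoly_symop map_mpolyX symopX dunklL_ratC.
by rewrite dunkl_monS.
Qed.

Lemma dpoly_wact c w p psi : param_space c ->
  wact w (dpoly c p psi) = dpoly c (psubst (rho w)^T p) (wact w psi).
Proof.
move=> cP; move: {2}(wact w psi) (erefl (wact w psi)) => g gE.
elim/mpoly_var_ind: p => [a|p q IHp IHq|i p IH].
- rewrite psubstC !dpoly_symop map_mpolyC -[(ratC n a)%:MP]mulr1 mul_mpolyC
  -mpolyX0.
  by rewrite !symopZ !symopX !dunkl_mon0 rmorphM /= wact_ratC gE.
- rewrite (dpolyD c p q) (rmorphD (psubst _)) (rmorphD (wact w)) /= IHp IHq.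
  by rewrite -dpolyD.
rewrite dpolyX // dunklL_wact // IH (rmorphM (psubst _)) /= psubstX mulr_suml
  [RHS]dpoly_sum.
rewrite [LHS]dunklL_basis; apply: eq_bigr => k _ /=.
rewrite -scalerAl dpolyZ dpolyX //; congr (_%:L * _).
by rewrite -colE !mxE.
Qed.

(** For invariant p the function p(y_c) phi is invariant, hence equal to its average over W; this
    reduces the claim to averaged monomials. *)
Lemma dpoly_change c c' p phi : param_space c -> param_space c' ->
  same_exponents c c' ->
  dual_invariant rho p -> winv phi -> dpoly c p phi = dpoly c' p phi.
Proof.
move=> cP cP' cc' pK Kphi.
have avg c1 : param_space c1 -> #|W|%:R * dpoly c1 p phi
    = \sum_(m <- msupp p) (p@_m)%:L * \sum_w wact w (dunkl_mon c1 m phi).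
  move=> c1P; transitivity (\sum_w wact w (dpoly c1 p phi)).
    under eq_bigr do rewrite dpoly_wact // pK Kphi.
    by rewrite sumr_const mulr_natl cardT.
  under eq_bigr do rewrite dpolyE raddf_sum.
  rewrite exchange_big; apply: eq_bigr => m _; rewrite mulr_sumr.
  by apply: eq_bigr => w _ /=; rewrite rmorphM /= wact_ratC.
have W0 : #|W|%:R != 0 :> L.
  rewrite -(rmorph_nat (ratC n)) fmorph_eq0 pnatr_eq0 -lt0n.
  by apply/card_gt0P; exists 1%g.
apply: (mulfI W0); rewrite !avg //; apply: eq_bigr => m _.
by rewrite (sym_dunkl_mon_change rho_faithful alphaP m cP cP' cc' Kphi).
Qed.

End ConstantCoefficients.

(** * Transfer to operators on the regular functions of the complement *)

Section RegularFunctions.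
Variables (F : numFieldType) (n : nat) (W : finGroupType).
Variable rho : mx_representation F [set: W]%G n.
Variable alpha : {vspace 'cV[F]_n} -> 'rV[F]_n.
Hypothesis rho_faithful : mx_faithful rho.
Hypothesis alphaP : defining_forms rho alpha.
Implicit Types (H : {vspace 'cV[F]_n}) (y v : 'cV[F]_n) (w u : W).
Implicit Types (psi phi f : ratfun F n) (c : param rho).
Implicit Types (P Q Z : ratfun F n -> ratfun F n) (m : 'X_{1..n}).
Implicit Types (A : ratfun F n -> Prop).

Local Notation L := (ratfun F n).
Local Notation arr := (arrangement rho).
Local Notation pst := (pstab rho).
Local Notation "c %:L" := (ratC n c) (at level 2, format "c %:L").
Local Notation wact := (wact rho).
Local Notation logform := (logform alpha).
Local Notation hterm := (hterm alpha).
Local Notation dunklL := (dunklL alpha).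

Local Notation winv := (winv rho).


Local Notation dunkl_mon := (dunkl_mon alpha).
Local Notation dspan := (dspan alpha).
Local Notation ev := (ev alpha).
Local Notation chi := (chi rho).

Local Notation symop := (symop alpha).
Local Notation polyring := (@polyring F n).

Local Notation same_exponents := (@same_exponents F n W rho).
Local Notation D := (coordring rho).
Implicit Types (g h : coordring rho).

Lemma val_act_op w g : val (act_op w g) = wact w (val g).
Proof. by rewrite /wact rsubst.unlock. Qed.

Lemma val_derive_op y g : val (derive_op y g) = rderive y (val g).
Proof. by rewrite rderive.unlock. Qed.

Lemma val_scale (a : F) g : val (a *: g) = a%:L * val g.
Proof. exact: val_coordringZ. Qed.

Lemma val_sub g h : val (g - h) = val g - val h.
Proof. by []. Qed.

Lemma val_sum (I : Type) (r : seq I) (P : pred I) (E : I -> D -> D) g :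
  val ((\sum_(i <- r | P i) E i) g) = \sum_(i <- r | P i) val (E i g).
Proof. by rewrite fct_sumE raddf_sum. Qed.

Lemma val_idem_op H j g : val (idem_op H j g)
  = ((nstab rho H)%:R^-1)%:L * \sum_(w in pst H) (chi w ^- j)%:L * wact w
    (val g).
Proof.
rewrite /idem_op [X in val X](_ : _ = (nstab rho H)%:R^-1 *:
  ((\sum_(w in pst H) (\det (rho w) ^- j) *: act_op w) g)) //.
rewrite val_scale val_sum; congr (_ * _); apply: eq_bigr => w _.
by rewrite [X in val X](_ : _ = (\det (rho w) ^- j) *: act_op w g) // val_scale
  val_act_op.
Qed.

Lemma val_dunkl c y g : val (dunkl alpha c y g) = dunklL arr c y (val g).
Proof.
rewrite dunklLE /dunkl.
rewrite [X in val X](_ : _ = derive_op y g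
  - (\sum_(H <- arr) (alpha H *m y) 0 0 *:
    (mul_op (inv_form rho (alpha H)) \o
      \sum_(j < nstab rho H) ((nstab rho H)%:R * c H j) *: idem_op H j)) g) //.
rewrite val_sub val_derive_op val_sum big_seq [in RHS]big_seq; congr (_ - _).
apply: eq_bigr => H HA.
rewrite [X in val X](_ : _ = (alpha H *m y) 0 0 *: (inv_form rho (alpha H) *
  ((\sum_(j < nstab rho H) ((nstab rho H)%:R * c H j) *: idem_op H j) g))) //.
rewrite val_scale val_coordringM (inv_formE alphaP HA) htermE logformE mulrA;
  congr (_ * _).
rewrite val_sum.
transitivity (\sum_(j < nstab rho H) \sum_(w in pst H)
   (c H j * chi w ^- j)%:L * wact w (val g)).
  apply: eq_bigr => j _.
  rewrite [X in val X](_ : _ = ((nstab rho H)%:R * c H j) *: idem_op H j g) //.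
  rewrite val_scale val_idem_op mulrA -rmorphM mulrAC divff ?nstab_neq0 //
    mul1r mulr_sumr.
  by apply: eq_bigr => w _; rewrite rmorphM mulrA.
rewrite exchange_big; apply: eq_bigr => w _ /=.
by rewrite /dunkl_coef rmorph_sum mulr_suml.
Qed.

Lemma val_sym_op g : val (sym_op rho g)
  = (#|W|%:R^-1)%:L * \sum_w wact w (val g).
Proof.
rewrite [X in val X](_ : _ = #|W|%:R^-1 *: ((\sum_(w : W) act_op w) g)) //.
rewrite val_scale val_sum; congr (_ * _); apply: eq_bigr => w _.
exact: val_act_op.
Qed.

Lemma winv_sym_op g : winv (val (sym_op rho g)).
Proof.
by move=> w; rewrite val_sym_op rmorphM /= wact_ratC wact_sum_inv.
Qed.

Lemma sym_op_winv g : winv (val g) -> sym_op rho g = g.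
Proof.
move=> Kg; apply: val_inj; rewrite val_sym_op; under eq_bigr do rewrite Kg.
rewrite sumr_const -[X in _ * X]mulr_natl cardT mulrA.
have W0 : #|W|%:R != 0 :> F by rewrite pnatr_eq0 -lt0n; apply/card_gt0P;
  exists 1%g.
by rewrite -(rmorph_nat (ratC n)) -rmorphM -cardT mulVf // rmorph1 mul1r.
Qed.

Definition dunkl_mon_op c (m : 'X_{1..n}) : D -> D :=
  \big[comp/idfun]_(i < n) iter (m i) (comp (dunkl alpha c (delta_mx i 0)))
    idfun.

Lemma val_dunkl_mon_op c m g : val (dunkl_mon_op c m g) = dunkl_mon c m (val g).
Proof.
rewrite /dunkl_mon_op dunkl_monE /monop.
elim: (index_enum _) g => [|i r IH] g; first by rewrite !big_nil.
rewrite !big_cons /= !iter_compE -IH; set h := (\big[_/_]_(_ <- _) _) g.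
elim: (m i) => // k E; rewrite !iterS val_dunkl.
by congr (dunklL _ _ _ _); exact: E.
Qed.

Lemma cherednik_dunkl_mon_op c m : cherednik alpha c (dunkl_mon_op c m).
Proof.
have [C1 _ CM] : operator_algebra (cherednik alpha c) by exact:
  generated_algebraP.
rewrite /dunkl_mon_op; elim/big_ind: _ => // i _.
elim: (m i) => // k IH; rewrite iterS; apply: (CM) => //.
by apply: generated_algebra_sub; right; exists (delta_mx i 0).
Qed.

(* H_c acts on the left on H_c e, whose elements are read as maps defined on
   the invariants. *)
Lemma cherednik_dspan c (Q : D -> D) : param_space c -> cherednik alpha c Q ->
  exists k P, dspan polyring c k P /\
    forall g, winv (val g) -> val (Q g) = P (val g).
Proof.
move=> cP; have PR := @polyring_coefring F n; have [PC PD PM] := PR.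
(* The operators that preserve normal forms are an algebra, so generators suffice. The function h is
   tied to P by its value only, since P acts on rational functions and is not known to preserve
   regular ones. *)
pose S (Q : D -> D) := forall k P, dspan polyring c k P ->
  exists k' P', dspan polyring c k' P' /\
  forall g h, winv (val g) -> val h = P (val g) -> val (Q h) = P' (val g).
have SA : operator_algebra S.
  split=> [k P NP|a Q1 Q2 S1 S2 k P NP|Q1 Q2 S1 S2 k P NP].
  - by exists k, P.
  - have [k1 [P1 [NP1 E1]]] := S1 _ _ NP; have [k2 [P2 [NP2 E2]]] := S2 _ _ NP.
    exists (maxn k1 k2), (fun phi => a%:L * P1 phi + P2 phi); split.
      apply: aspanD; last by apply: dspan_mono NP2 => //; exact: leq_maxr.
      by apply: dspan_mul => //; apply: dspan_mono NP1 => //; exact: leq_maxl.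
    move=> g h Kg hE; rewrite [X in val X](_ : _ = a *: Q1 h + Q2 h) //.
    by rewrite val_coordringD val_scale (E1 _ _ Kg hE) (E2 _ _ Kg hE).
  - have [k2 [P2 [NP2 E2]]] := S2 _ _ NP; have [k1 [P1 [NP1 E1]]] := S1 _ _ NP2.
    exists k1, P1; split=> // g h Kg hE /=.
    by apply: E1 => //; exact: E2.
move=> QC; suff SQ : S Q.
  have [|k [P [NP E]]] := SQ 1%N (dunkl_mon c 0%MM);
    first by apply: dspan_dunkl_mon; rewrite ?mdeg0.
  by exists k, P; split=> // g Kg; apply: E => //; rewrite dunkl_mon0.
apply: (generated_algebra_min SA _ QC) =>
  _ [[[p _ <-]|[w _ <-]]|[y _ <-]] k P NP.
- exists k, (fun phi => polyfrac p * P phi); split.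
    by apply: dspan_mul => //; exists p.
  by move=> g h Kg hE; rewrite [X in val X](_ : _ = polyreg rho p * h) //
    val_coordringM hE.
- exists k, (fun phi => wact w (P phi)); split.
    by apply: dspan_act => // f; exact: polyring_wact.
  by move=> g h Kg hE; rewrite val_act_op hE.
- exists k.+1, (fun phi => dunklL arr c y (P phi)); split.
    apply: (dspan_close (Z := dunklL arr c y) (g := fun=> 0) (y := y) alphaP cP
      PR) NP => //.
    + by move=> w; exact: coefring0.
    + by move=> psi; rewrite big1 ?addr0 // => w _; rewrite mul0r.
    + move=> f Pf; apply: dunklL_mul_comm => //; first exact: polyring_derive.
      by move=> H w HA wH; exact: polyring_logform_sub.
  by move=> g h Kg hE; rewrite val_dunkl hE.
Qed.

Lemma spherical_sub c c' : param_space c -> param_space c' ->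
  same_exponents c c' ->
  (spherical alpha c `<=` spherical alpha c')%classic.
Proof.
move=> cP cP' cc' _ [Q QC <-].
have PR := @polyring_coefring F n; have [PC PD PM] := PR.
have [k [P [NP PE]]] := cherednik_dspan cP QC.
pose T phi := (#|W|%:R^-1)%:L * \sum_w wact w (P phi).
have TK phi : winv (T phi).
  by move=> w; rewrite /T rmorphM /= wact_ratC wact_sum_inv.
have NT : dspan polyring c k T by apply: dspan_mul => //; exact: dspan_act_all.
have [k' NT'] := dspan_change rho_faithful alphaP cP cP' cc'
  (fun phi _ => TK phi) NT.
have [s [sP _ sE]] := dspan_symop PR NT'.
have [p pE] := choice sP.
(* As the coefficients of [s] are polynomials, the normal form for [c'] is an explicit element of
   H_{c'}. *)
pose Q' := \sum_(m <- msupp s)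
  (mul_op (polyreg rho (p m)) \o dunkl_mon_op c' m).
have valQ' g : val (Q' g) = symop c' s (val g).
  rewrite /Q' val_sum symopE; apply: eq_bigr => m _.
  rewrite [X in val X](_ : _ = polyreg rho (p m) * dunkl_mon_op c' m g) //.
  by rewrite val_coordringM val_dunkl_mon_op pE.
have Q'C : cherednik alpha c' Q'.
  have CA : operator_algebra (cherednik alpha c') by exact: generated_algebraP.
  apply: operator_algebra_sum => // m _; case: (CA) => _ _; apply.
    by apply: generated_algebra_sub; left; left; exists (p m).
  exact: cherednik_dunkl_mon_op.
exists Q' => //; apply/funext => g /=; set h := sym_op rho g.
have Kh : winv (val h) by exact: winv_sym_op.
have E : val (Q' h) = val (sym_op rho (Q h)).
  by rewrite valQ' -sE // val_sym_op (PE h Kh).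
(* On invariants [Q'] already has invariant values, so the outer e acts trivially on them. *)
rewrite sym_op_winv; first exact: val_inj.
by rewrite E; exact: winv_sym_op.
Qed.

Lemma dunkl_poly_sym c c' p : param_space c -> param_space c' ->
  same_exponents c c' ->
  dual_invariant rho p ->
  dunkl_poly alpha c p \o sym_op rho = dunkl_poly alpha c' p \o sym_op rho.
Proof.
move=> cP cP' cc' pK.
have val_dp c1 g : val (dunkl_poly alpha c1 p g) = dpoly alpha c1 p (val g).
  rewrite /dunkl_poly val_sum dpolyE; apply: eq_bigr => m _.
  rewrite [X in val X](_ : _ = p@_m *: dunkl_mon_op c1 m g) //.
  by rewrite val_scale val_dunkl_mon_op.
apply/funext => g; apply: val_inj; rewrite /= !val_dp.
exact: (dpoly_change rho_faithful alphaP cP cP' cc' pK (winv_sym_op g)).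
Qed.

End RegularFunctions.

Theorem theorem3p6 (R : realType) (n : nat) (W : finGroupType)
    (rho : mx_representation R[i] [set: W]%G n)
    (rho_faithful : mx_faithful rho)
    (rho_irreducible : irreducible_rep rho)
    (rho_reflection : reflection_rep rho)
    (alpha : {vspace 'cV[R[i]]_n} -> 'rV[R[i]]_n)
    (alphaP : defining_forms rho alpha)
    (s : permparam rho) (sP : perm_group s)
    (c : param rho) (cP : param_space c) :
  spherical alpha c = spherical alpha (dot_action s c)
  /\ (forall f : {mpoly R[i][n]}, dual_invariant rho f ->
        dunkl_poly alpha c f \o sym_op rho
        = dunkl_poly alpha (dot_action s c) f \o sym_op rho).
Proof.
have cP' := dot_action_param_space sP cP.
have cc' : same_exponents c (dot_action s c) by exact:
  dot_action_same_exponents.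
split=> [|f fK]; last exact: dunkl_poly_sym.
apply/seteqP; split; first exact: spherical_sub.
(* The reverse inclusion comes from the symmetry of [same_exponents], in place of an inverse for the
   dot action. *)
by apply: spherical_sub => //; exact: same_exponents_sym.
Qed.
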